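(* Let $k\ge1$ be an integer. Every $k$-fan-bundle planar graph $G$ is contained in $H\boxtimes P\boxtimes K_{6(2k+3)^2}$ for some graph $H$ with treewidth at most $\binom{2k+6}{3}-1$ and some path $P$, and thus $G$ has row treewidth at most $\binom{2k+6}{3}\,6(2k+3)^2-1$.
   Context: Graphs are finite, simple, undirected. In a $k$-fan-bundle planar embedding of a graph $G$ in the plane, each edge is drawn in three parts: the first and last parts are fan-bundles, which may be shared by several edges of a fan (edges with a common end-vertex), while the middle part is unbundled. A fan-bundle is a curve anchored at a vertex $u$ (its origin) with another endpoint (its terminal); a vertex may be incident to several bundles. An edge $uv$ is drawn as a bundle anchored at $u$, followed by a curve (the unbundled part) joining the terminal of that bundle to the terminal of a bundle anchored at $v$. Each fan-bundle can cross at most $k$ other fan-bundles, while the unbundled parts are crossing-free. A graph is $k$-fan-bundle planar if it admits such an embedding. Contained means isomorphic to a subgraph. The strong product $G_1\boxtimes G_2$ has vertex set $V(G_1)\times V(G_2)$ with distinct $(a,v),(b,u)$ adjacent iff ($a=b$ or $ab\in E(G_1)$) and ($u=v$ or $uv\in E(G_2)$). The row treewidth of $G$ is the minimum treewidth of a graph $H'$ with $G$ contained in $H'\boxtimes P'$ for some path $P'$. *)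

(* Defs.v *)
From Stdlib Require Import Reals.
From mathcomp Require Import all_boot.

Set Implicit Arguments.
Unset Strict Implicit.
Unset Printing Implicit Defensive.

Definition point := (R * R)%type.

(* A curve is parametrised by [0,1]; we take it defined and continuous on
   all of R (every continuous path on [0,1] extends continuously). *)
Definition curve := R -> point.

Definition is_curve (c : curve) : Prop :=
  continuity (fun t => fst (c t)) /\ continuity (fun t => snd (c t)).

Definition on01 (t : R) : Prop := Rle 0 t /\ Rle t 1.

(* Two fan-bundles b, b' cross iff they share a point other than a common
   origin vertex (a crossing is a common interior point). *)
Definition bundles_cross (n : nat) (V : Type) (pos : V -> point)
  (orig : 'I_n -> V) (bc : 'I_n -> curve) (b b' : 'I_n) : Prop :=
  exists s t, on01 s /\ on01 t /\ bc b s = bc b' t /\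
    ~ (orig b = orig b' /\ bc b s = pos (orig b)).

(* k-fan-bundle planar embedding of the graph (V, E):
   - pos : vertices as distinct points;
   - n fan-bundles, bundle b anchored at (origin) orig b, drawn as curve bc b
     from pos (orig b) (at time 0) to its terminal bc b 1;
   - terminals pairwise distinct and distinct from vertex points;
   - edge uv uses bundle bsel u v (anchored at u) and bsel v u (anchored at v),
     and its unbundled part mid u v joins the two terminals
     (mid v u is mid u v reversed);
   - each bundle crosses at most k other bundles;
   - unbundled parts are crossing-free: they meet a bundle only at the
     terminal of one of their own two bundles, and meet the unbundled part of
     another edge only at common endpoints. *)
Definition kfb_planar (k : nat) (V : finType) (E : rel V) : Prop :=
  exists (n : nat) (pos : V -> point) (orig : 'I_n -> V)
         (bc : 'I_n -> curve) (bsel : V -> V -> 'I_n) (mid : V -> V -> curve),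
    injective pos /\
    (forall b, is_curve (bc b) /\ bc b R0 = pos (orig b)) /\
    (forall b b', b <> b' -> bc b R1 <> bc b' R1) /\
    (forall b v, bc b R1 <> pos v) /\
    (forall u v, E u v -> orig (bsel u v) = u) /\
    (forall u v, E u v ->
       is_curve (mid u v) /\ mid u v R0 = bc (bsel u v) R1 /\
       mid u v R1 = bc (bsel v u) R1 /\
       (forall t, mid v u t = mid u v (Rminus 1 t))) /\
    (forall b (s : seq 'I_n), uniq s ->
       (forall b', b' \in s -> b' <> b /\ bundles_cross pos orig bc b b') ->
       size s <= k) /\
    (forall u v b s t, E u v -> on01 s -> on01 t -> mid u v s = bc b t ->
       (b = bsel u v \/ b = bsel v u) /\ mid u v s = bc b R1) /\
    (forall u v x y s t, E u v -> E x y ->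
       ~ ((x = u /\ y = v) \/ (x = v /\ y = u)) ->
       on01 s -> on01 t -> mid u v s = mid x y t ->
       (mid u v s = mid u v R0 \/ mid u v s = mid u v R1) /\
       (mid x y t = mid x y R0 \/ mid x y t = mid x y R1)).

Definition is_graph (V : finType) (E : rel V) : Prop :=
  symmetric E /\ irreflexive E.

Definition is_tree (I : finType) (T : rel I) : Prop :=
  is_graph T /\ (exists i : I, True) /\ (forall i j, connect T i j) /\
  #|[set p : I * I | T p.1 p.2]| = (#|I| - 1).*2.

Definition tree_decomp (W : finType) (EW : rel W) (I : finType) (T : rel I)
  (bag : I -> {set W}) : Prop :=
  is_tree T /\
  (forall w, exists i, w \in bag i) /\
  (forall w w', EW w w' -> exists i, (w \in bag i) && (w' \in bag i)) /\
  (forall w i j, w \in bag i -> w \in bag j ->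
     connect [rel a b | [&& T a b, w \in bag a & w \in bag b]] i j).

Definition tw_le (W : finType) (EW : rel W) (t : nat) : Prop :=
  exists (I : finType) (T : rel I) (bag : I -> {set W}),
    tree_decomp EW T bag /\ forall i, #|bag i| <= t.+1.

Definition strong (A B : finType) (EA : rel A) (EB : rel B) : rel (A * B) :=
  fun p q => [&& p != q, (p.1 == q.1) || EA p.1 q.1 & (p.2 == q.2) || EB p.2 q.2].

Definition path_rel (p : nat) : rel 'I_p :=
  fun i j => (i.+1 == j :> nat) || (j.+1 == i :> nat).

Definition complete_rel (m : nat) : rel 'I_m := fun i j => i != j.

Arguments path_rel p : clear implicits.
Arguments complete_rel m : clear implicits.

Definition contained (V : finType) (E : rel V) (U : finType) (F : rel U) : Prop :=
  exists f : V -> U, injective f /\ forall u v, E u v -> F (f u) (f v).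

Definition row_tw_le (V : finType) (E : rel V) (t : nat) : Prop :=
  exists (W : finType) (EW : rel W) (p : nat),
    is_graph EW /\ tw_le EW t /\ contained E (strong EW (path_rel p)).

(* Main.v *)
Require Import Defs.
From Stdlib Require Import Reals Lra ZArith Lia ClassicalEpsilon.
From Coquelicot Require Import Rcomplements Compactness.
From mathcomp Require Import all_boot zify.

Set Implicit Arguments.
Unset Strict Implicit.
Unset Printing Implicit Defensive.
Local Open Scope nat_scope.

(* The drawing is contracted to a finite graph: the pixels of a fine triangulated
   board, with a small box around each vertex ("hub"), and each terminal together
   with part of the unbundled curves leaving it, shrunk to single nodes.  A bundle
   becomes a path from its hub to its terminal node, an edge becomes an adjacency
   of two terminal nodes, and bundles sharing a node cross.  Two bundles may meet
   arbitrarily often, so there is no bounded-depth planar minor to start from;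
   instead the only facts used about the plane are that there is no K5 minor
   model, and that recolouring one class of a K4 minor model by the other three
   colours creates a three-coloured triangle (both are parity counts).

   The nodes are then consumed in rounds.  A component of the remaining nodes sees
   at most three earlier rounds, and the next round removes from it a connected set
   touching all of them: at most three "legs" issued from a three-coloured
   triangle, each descending a breadth-first layering of the vertices along whole
   bundles until it reaches a partly consumed bundle, of which it takes the
   remaining head or tail.  A vertex belongs to the round that first hits one of its
   bundles.  Each further round hitting a bundle is charged to a bundle crossing
   it, so that following an edge passes through at most 2k+3 rounds.  Since each
   round sees at most three earlier ones, which see each other, the rounds
   reachable in s such hops number at most C(s+3,3): these sets are the bags.  The
   layering gives the path, and each round takes boundedly many vertices per layer. *)

(** * Parity on the triangulated board *)

(** No separation theorem for curves is used; parities of triangle counts stand in for it. This is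
    why the invariant carried through the rounds is a complete minor model: each remaining component
    is one class of such a model and the rounds it sees are the other classes, so excluding K5
    leaves at most three of them.

    The hop bound is delicate because a crossing bundle can lose its tail and its head in different
    rounds and would then be charged twice. Two closure rules restore single charging. An anchor
    whose live head meets a foot gives up that head in the same round. An anchor in use whose two
    live ends both meet the live tail of one cut non-anchor bundle gives up both ends, the tail of
    such a bundle being added to keep the round connected. A non-anchor tail is then hit by at most
    [k + 2] rounds and an anchor head by at most [k + 1], whence [2 * k + 3].

    Near one layer a round involves at most [39 + 9 * k] relevant bundles, each accounting for at
    most [k + 1] new vertices; the product is below [6 * (2 * k + 3) ^ 2]. *)

Definition pt := (nat * nat)%type.

Definition lat1 (x y : pt) :=
  [|| (y == (x.1.+1, x.2)), (y == (x.1, x.2.+1)) | (y == (x.1.+1, x.2.+1))].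
Definition lat (x y : pt) := lat1 x y || lat1 y x.

(** Each unit square is cut by its rising diagonal; the boolean is [false] for the triangle below
    the diagonal and [true] for the one above. *)
Definition face := (pt * bool)%type.
Definition v0 (F : face) : pt := F.1.
Definition v1 (F : face) : pt :=
  if F.2 then (F.1.1, F.1.2.+1) else (F.1.1.+1, F.1.2).
Definition v2 (F : face) : pt := (F.1.1.+1, F.1.2.+1).
Definition onf (v : pt) (F : face) := [|| v == v0 F, v == v1 F | v == v2 F].

(* The faces below the edge [xy]: the winding parity of a walk around a face
   is the number of its steps lying above that face. *)
Definition fill1 (x y : pt) (F : face) :=
  (x.1 != y.1) && (F.1.1 == x.1) &&
  ((F.1.2 < x.2) || ((y.2 != x.2) && (F == (x, false)))).
Definition fill x y F := (fill1 x y F && lat1 x y) (+) (fill1 y x F && lat1 y x).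

Fixpoint fillw (x : pt) (p : seq pt) (F : face) :=
  if p is y :: p' then fill x y F (+) fillw y p' F else false.

(** Indicator of the open vertical ray above [q]; it measures how the fill changes from one column
    of faces to the next. *)
Definition ray (q x : pt) := (x.1 == q.1) && (q.2 < x.2).

(** The six faces around [v] are compared in cyclic order. Passing a horizontal or diagonal edge at
    [v] changes nothing. Passing the vertical edge above or below [v] changes the column, and the
    discrepancy is a sum of [ray] values at the two ends of the step, which telescopes along a
    walk. *)
Lemma fill_jump v x y : 0 < v.1 -> 0 < v.2 -> x != v -> y != v -> lat x y ->
  let L i j := ((i, j), false) : face in let U i j := ((i, j), true) : face in
  let a := v.1 in let b := v.2 in
  [/\ fill x y (L a b) = fill x y (U a b),
      fill x y (U a b) (+) fill x y (L a.-1 b) = ray v x (+) ray v y,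
      fill x y (L a.-1 b) = fill x y (U a.-1 b.-1),
      fill x y (U a.-1 b.-1) = fill x y (L a.-1 b.-1) &
      fill x y (L a.-1 b.-1) (+) fill x y (U a b.-1) = ray (a, b.-1) x (+) ray (a, b.-1) y
      /\ fill x y (U a b.-1) = fill x y (L a b)].
Proof.
case: v x y => a b [x1 x2] [y1 y2] /=.
case: a => // a _; case: b => // b _ /=.
rewrite /lat /lat1 /fill /fill1 /ray /lat1 -!pair_eqE /pair_eq /= -!pair_eqE /pair_eq /=.
move=> h1 h2.
by case/orP=> /or3P[] /andP[/eqP e1 /eqP e2]; subst; split; lia.
Qed.

Lemma lat_sym x y : lat x y = lat y x.
Proof. by rewrite /lat orbC. Qed.

Lemma fillw_jump v x p : 0 < v.1 -> 0 < v.2 -> v \notin x :: p -> path lat x p ->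
  let L i j := ((i, j), false) : face in let U i j := ((i, j), true) : face in
  let a := v.1 in let b := v.2 in let y := last x p in
  [/\ fillw x p (L a b) = fillw x p (U a b),
      fillw x p (U a b) (+) fillw x p (L a.-1 b) = ray v x (+) ray v y,
      fillw x p (L a.-1 b) = fillw x p (U a.-1 b.-1),
      fillw x p (U a.-1 b.-1) = fillw x p (L a.-1 b.-1) &
      fillw x p (L a.-1 b.-1) (+) fillw x p (U a b.-1) = ray (a, b.-1) x (+) ray (a, b.-1) y
      /\ fillw x p (U a b.-1) = fillw x p (L a b)].
Proof.
move=> va vb; elim: p x => [|z p IH] x /=; first by rewrite !addbb.
rewrite !inE !negb_or => /and3P[xv zv pv] /andP[xz zp].
rewrite eq_sym in xv; rewrite eq_sym in zv.
have [i1 i2 i3 i4 [i5 i6]] := fill_jump va vb xv zv xz.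
have [] := IH z _ zp; first by rewrite inE negb_or eq_sym zv.
move=> j1 j2 j3 j4 [j5 j6].
have eqadd (s t s' t' : bool) : s = s' -> t = t' -> s (+) t = s' (+) t' by move=> -> ->.
have tel (a a' b b' s t u : bool) : a (+) a' = s (+) t -> b (+) b' = t (+) u ->
    (a (+) b) (+) (a' (+) b') = s (+) u.
  by case: a a' b b' s t u => [] [] [] [] [] [] [].
split; last split.
- exact: eqadd i1 j1.
- exact: tel i2 j2.
- exact: eqadd i3 j3.
- exact: eqadd i4 j4.
- exact: tel i5 j5.
- exact: eqadd i6 j6.
Qed.

Lemma onf_cases v F : onf v F ->
  [\/ F = (v, false), F = (v, true), [/\ 0 < v.1 & F = ((v.1.-1, v.2), false)] |
   [\/ [/\ 0 < v.1, 0 < v.2 & F = ((v.1.-1, v.2.-1), true)],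
      [/\ 0 < v.1, 0 < v.2 & F = ((v.1.-1, v.2.-1), false)] |
      [/\ 0 < v.2 & F = ((v.1, v.2.-1), true)]]].
Proof.
case: F => [[i j] u]; case/or3P=> /eqP->; rewrite /v0 /v1 /v2 /=.
- by case: u; [apply: Or42 | apply: Or41].
- by case: u; [apply: Or44; apply: Or33 | apply: Or43].
- by apply: Or44; case: u; [apply: Or31 | apply: Or32].
Qed.

Section Closed.
Variables (x y z : pt) (p q r : seq pt).
Hypotheses (ep : last x p = y) (eq_ : last y q = z) (er : last x r = z).
Hypotheses (pp : path lat x p) (pq : path lat y q) (pr : path lat x r).
Definition wind F := fillw x p F (+) fillw y q F (+) fillw x r F.

(** The [ray] terms produced at the two vertical edges depend only on the ends of the three walks,
    so they cancel over the closed walk: its winding parity is constant around any vertex it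
    avoids. *)
Lemma wind_vertex v F : 0 < v.1 -> 0 < v.2 ->
  v \notin x :: p -> v \notin y :: q -> v \notin x :: r ->
  onf v F -> wind F = wind (v, false).
Proof.
move=> va vb vp vq vr.
have [i1 i2 i3 i4 [i5 i6]] := fillw_jump va vb vp pp.
have [j1 j2 j3 j4 [j5 j6]] := fillw_jump va vb vq pq.
have [k1 k2 k3 k4 [k5 k6]] := fillw_jump va vb vr pr.
have tel (a b c a' b' c' s t u : bool) : a (+) a' = s (+) t -> b (+) b' = t (+) u ->
    c (+) c' = s (+) u -> a (+) b (+) c = a' (+) b' (+) c'.
  by case: a b c a' b' c' s t u => [] [] [] [] [] [] [] [] [].
have e1 : wind (v, false) = wind (v, true).
  by rewrite /wind (surjective_pairing v) i1 j1 k1.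
have e2 : wind (v, true) = wind ((v.1.-1, v.2), false).
  move: i2 j2 k2; rewrite /wind (surjective_pairing v) ep eq_ er /=; exact: tel.
have e3 : wind ((v.1.-1, v.2), false) = wind ((v.1.-1, v.2.-1), true).
  by rewrite /wind i3 j3 k3.
have e4 : wind ((v.1.-1, v.2.-1), true) = wind ((v.1.-1, v.2.-1), false).
  by rewrite /wind i4 j4 k4.
have e6 : wind ((v.1, v.2.-1), true) = wind (v, false).
  by rewrite /wind (surjective_pairing v) i6 j6 k6.
case/onf_cases; last case; (try case); intros; subst; rewrite -?e4 -?e3 -?e2 -?e1 ?e6 //.
Qed.
End Closed.

Lemma lat_face x y : lat x y -> exists F, onf x F && onf y F.
Proof.
have H u v : lat1 u v -> exists F, onf u F && onf v F.
  case/or3P=> /eqP->; [exists (u, false)|exists (u, true)|exists (u, false)];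
    by rewrite /onf /v0 /v1 /v2 /= !eqxx ?orbT.
by case/orP=> /H // [F /andP[h1 h2]]; exists F; rewrite h2.
Qed.

(** * A Stokes formula modulo 2 for two-coloured edges *)

Section Sums.
Variable c : pt -> nat.

Definition chi (s t : nat) (x y : pt) :=
  ((c x == s) && (c y == t)) || ((c x == t) && (c y == s)).
Definition dchi s t (F : face) :=
  chi s t (v0 F) (v1 F) (+) chi s t (v1 F) (v2 F) (+) chi s t (v0 F) (v2 F).
(** A potential along the vertical segment from the bottom row up to [x]. Its values at the inner
    vertices of a walk cancel in pairs. *)
Definition psi s t (x : pt) :=
  \big[addb/false]_(0 <= j < x.2) chi s t (x.1, j) (x.1, j.+1).
Definition fsum M (g : face -> bool) :=
  \big[addb/false]_(0 <= i < M) \big[addb/false]_(0 <= j < M)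
     (g ((i, j), false) (+) g ((i, j), true)).

Lemma chiC s t x y : chi s t x y = chi s t y x.
Proof. by rewrite /chi orbC; congr (_ || _); rewrite andbC. Qed.

(** Diagonals and inner horizontal edges of the column are sides of two of its faces, so only the
    top edge and the two vertical sides survive. *)
Lemma col_sum s t a b : chi s t (a, 0) (a.+1, 0) = false ->
  \big[addb/false]_(0 <= j < b) (dchi s t ((a, j), false) (+) dchi s t ((a, j), true))
  = chi s t (a, b) (a.+1, b) (+) psi s t (a, b) (+) psi s t (a.+1, b).
Proof.
move=> h0; rewrite /psi /=; elim: b => [|b IH]; first by rewrite !big_geq // h0.
rewrite !big_nat_recr //= IH /dchi /v0 /v1 /v2 /=.
by do 7?[move: (chi _ _ _ _) => ?]; do 2?[move: (\big[_/_]_(_ <= _ < _) _) => ?];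
   repeat match goal with b : bool |- _ => case: b => // end.
Qed.

Lemma fsumD M g h : fsum M (fun F => g F (+) h F) = fsum M g (+) fsum M h.
Proof.
rewrite /fsum -big_split; apply: eq_bigr => i _; rewrite -big_split.
by apply: eq_bigr => j _ /=; rewrite addbACA.
Qed.

Lemma eq_fsum M g h : g =1 h -> fsum M g = fsum M h.
Proof. by move=> e; apply: eq_bigr => i _; apply: eq_bigr => j _; rewrite !e. Qed.

Lemma fsum0 M g : (forall F, g F = false) -> fsum M g = false.
Proof.
by move=> e; rewrite /fsum big1 // => i _; rewrite big1 // => j _; rewrite !e.
Qed.

Lemma fsum_ex M g : fsum M g -> exists F, g F.
Proof.
rewrite /fsum => h.
have [i _] : exists2 i, true & \big[addb/false]_(0 <= j < M)
     (g ((i, j), false) (+) g ((i, j), true)).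
  move: h; elim/big_ind: _ => //.
  - by move=> x y hx hy; case: x hx => [hx _|_]; [exact: hx | case: y hy => [hy _|//]; exact: hy].
  - by move=> i _ hi; exists i.
elim/big_ind: _ => //.
- by move=> x y hx hy; case: x hx => [hx _|_]; [exact: hx | case: y hy => [hy _|//]; exact: hy].
- by move=> j _; case e: (g ((i, j), false)) => // h'; [exists ((i, j), false)|exists ((i, j), true)].
Qed.

(** The faces below a non-vertical edge are full squares of one column, plus the lower triangle
    under a diagonal, and [col_sum] evaluates them. Under a vertical edge there is nothing, and the
    two [psi] values differ exactly by that edge. *)
Lemma stokes1 M s t x y : (forall a, chi s t (a, 0) (a.+1, 0) = false) ->
  lat1 x y -> x.1 < M -> y.2 < M ->
  fsum M (fun F => fill x y F && dchi s t F) = chi s t x y (+) psi s t x (+) psi s t y.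
Proof.
move=> h0 xy xM yM.
have nyx : lat1 y x = false by case: x y xy {xM yM} => a b [a' b']; rewrite /lat1 -!pair_eqE /pair_eq /=; lia.
rewrite (@eq_fsum M _ (fun F => fill1 x y F && dchi s t F)); last first.
  move=> F; rewrite /fill xy nyx. by rewrite andbT andbF addbF.
case: x y xy {nyx} xM yM => a b [a' b'] /= /or3P[] /eqP[-> ->] /= aM bM.
- rewrite /fsum (bigD1_seq a) ?mem_index_iota ?iota_uniq //= [X in _ (+) X]big1_seq ?addbF.
    rewrite (@big_cat_nat _ _ _ b) //=; last by lia.
    rewrite [X in _ (+) X]big1_seq ?addbF; last first.
      move=> j; rewrite mem_index_iota /= => /andP[bj _].
      by rewrite /fill1 /= !eqxx ltnNge bj /= ?andbF.
    rewrite -[RHS](col_sum b (h0 a)); apply: eq_big_seq => j; rewrite mem_index_iota => /andP[_ jb].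
    by rewrite /fill1 /= eqxx jb /= neq_ltn ltnSn.
  move=> i /andP[ia _]; rewrite big1_seq // => j _.
  by rewrite /fill1 /= (negbTE ia) !andbF.
- rewrite /fsum big1_seq; last by move=> i _; rewrite big1_seq // => j _; rewrite /fill1 /= eqxx.
  rewrite {2}/psi /= big_nat_recr //= -/(psi s t (a, b)).
  by case: (chi _ _ _ _); case: (psi _ _ _).
- rewrite /fsum (bigD1_seq a) ?mem_index_iota ?iota_uniq //= [X in _ (+) X]big1_seq ?addbF.
    rewrite (@big_cat_nat _ _ _ b) //=; last by lia.
    rewrite [X in _ (+) X]big_ltn; last by lia.
    rewrite [X in _ (+) (_ (+) X)]big1_seq ?addbF; last first.
      move=> j; rewrite mem_index_iota /= => /andP[bj _].
      rewrite /fill1 /= ltnNge (ltnW bj) /= -!pair_eqE /pair_eq /= -!pair_eqE /pair_eq /=.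
      by rewrite (gtn_eqF bj) !andbF.
    have -> : \big[addb/false]_(0 <= j < b)
       ((fill1 (a, b) (a.+1, b.+1) ((a, j), false) && dchi s t ((a, j), false))
        (+) (fill1 (a, b) (a.+1, b.+1) ((a, j), true) && dchi s t ((a, j), true)))
      = chi s t (a, b) (a.+1, b) (+) psi s t (a, b) (+) psi s t (a.+1, b).
      rewrite -[RHS](col_sum b (h0 a)); apply: eq_big_seq => j; rewrite mem_index_iota => /andP[_ jb].
      by rewrite /fill1 /= eqxx jb /= neq_ltn ltnSn.
    rewrite /fill1 /= !eqxx ltnn neq_ltn ltnSn neq_ltn ltnSn orbT /=.
    rewrite [psi s t (a.+1, b.+1)]/psi /= big_nat_recr //= -/(psi s t (a.+1, b)).
    rewrite /dchi /v0 /v1 /v2 /=.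
    have -> : ((a, b, true) == (a, b, false)) = false by apply/eqP; case.
    by do 3?[move: (chi _ _ _ _) => ?]; do 2?[move: (psi _ _ _) => ?];
      repeat match goal with b : bool |- _ => case: b => // end.
  move=> i /andP[ia _]; rewrite big1_seq // => j _.
  by rewrite /fill1 /= (negbTE ia) !andbF.
Qed.

Lemma stokes M s t x p : (forall a, chi s t (a, 0) (a.+1, 0) = false) ->
  path lat x p -> (forall y, y \in x :: p -> y.1 < M /\ y.2 < M) ->
  fsum M (fun F => fillw x p F && dchi s t F) =
  \big[addb/false]_(e <- zip (x :: p) p) chi s t e.1 e.2
    (+) psi s t x (+) psi s t (last x p).
Proof.
move=> h0; elim: p x => [|y p IH] x /=.
  by move=> _ _; rewrite big_nil fsum0 // addbb.
case/andP=> xy py xM; rewrite big_cons /=.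
rewrite (@eq_fsum M _ (fun F => (fill x y F && dchi s t F) (+) (fillw y p F && dchi s t F))); last first.
  by move=> F; rewrite andb_addl.
rewrite fsumD IH //; last by move=> z zp; apply: xM; rewrite inE zp orbT.
have -> : fsum M (fun F => fill x y F && dchi s t F) = chi s t x y (+) psi s t x (+) psi s t y.
  have [x1 x2] := xM x (mem_head _ _).
  have [y1 y2] : y.1 < M /\ y.2 < M by apply: xM; rewrite !inE eqxx orbT.
  case/orP: xy => xy; first exact: stokes1.
  rewrite chiC -addbA [X in _ (+) X]addbC addbA -(stokes1 h0 xy y1 x2).
  by apply: eq_fsum => F; rewrite /fill addbC.
rewrite -/(zip (y :: p) p).
by do 2?[move: (chi _ _ _ _) => ?]; do 3?[move: (psi _ _ _) => ?]; move: (\big[_/_]_(_ <- _) _) => ?;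
   repeat match goal with b : bool |- _ => case: b => // end.
Qed.

(** With no two-coloured edge on the border, the column sums telescope in [psi]. *)
Lemma total M s t : (forall a, chi s t (a, 0) (a.+1, 0) = false) ->
  (forall a, chi s t (a, M) (a.+1, M) = false) ->
  psi s t (0, M) = false -> psi s t (M, M) = false -> fsum M (dchi s t) = false.
Proof.
move=> h0 hM l r; rewrite /fsum.
rewrite (eq_bigr (fun a => psi s t (a, M) (+) psi s t (a.+1, M))); last first.
  by move=> a _; rewrite (col_sum M (h0 a)) hM.
have H n : \big[addb/false]_(0 <= a < n) (psi s t (a, M) (+) psi s t (a.+1, M))
   = psi s t (0, M) (+) psi s t (n, M).
  elim: n => [|n IH]; first by rewrite big_geq // addbb.
  rewrite big_nat_recr //= IH.
  by do 3?[move: (psi _ _ _) => ?]; repeat match goal with b : bool |- _ => case: b => // end.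
by rewrite H l r.
Qed.
End Sums.

(** * Sperner parity, and odd triangle counts in K4 models *)

Section Parity.
Variables (c : pt -> nat) (M rho : nat).
Definition real (x : pt) := (0 < x.1 < M) && (0 < x.2 < M).
Hypothesis ring : forall x : pt, ~~ ((1 < x.1 < M.-1) && (1 < x.2 < M.-1)) -> c x = rho.

Definition hasc s F := [|| c (v0 F) == s, c (v1 F) == s | c (v2 F) == s].
Definition tri s t u F := [&& hasc s F, hasc t F & hasc u F].

(** One of two distinct colours differs from [rho], so the face has a vertex off the ring, and the
    remaining vertices are one step away from it. *)
Lemma hasc_real s t F : s != t -> hasc s F -> hasc t F -> forall v, onf v F -> real v.
Proof.
move=> st hs ht.
have [v vF vin] : exists2 v, onf v F & (1 < v.1 < M.-1) && (1 < v.2 < M.-1).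
  have H v : onf v F -> c v != rho -> exists2 v, onf v F & (1 < v.1 < M.-1) && (1 < v.2 < M.-1).
    by move=> vF vr; exists v => //; apply: contraR vr => /ring->.
  have K r : r != rho -> hasc r F -> exists2 v, onf v F & (1 < v.1 < M.-1) && (1 < v.2 < M.-1).
    move=> rr; case/or3P=> /eqP e; [apply: (H (v0 F))|apply: (H (v1 F))|apply: (H (v2 F))];
    by rewrite ?e // /onf eqxx ?orbT.
  case: (eqVneq s rho) => [e|sr]; last exact: (K s).
  by apply: (K t) => //; rewrite -e eq_sym.
move=> w; move: vF vin; rewrite /onf /real /v0 /v1 /v2; case: F v w {hs ht} => [[i j] u] [a b] [a' b'] /=.
by rewrite -!pair_eqE /pair_eq /=; case: u; rewrite /=; lia.
Qed.

(** As in Sperner's lemma, a triangle has an odd number of [s]-[t] edges exactly when its vertices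
    carry [s], [t] and one further colour. *)
Lemma dchi_tri cols s t F : uniq [:: s, t & cols] ->
  (forall x, c x \in [:: s, t & cols]) ->
  dchi c s t F = \big[addb/false]_(u <- cols) tri s t u F.
Proof.
move=> un al; rewrite /dchi /chi /tri /hasc.
have /= := (al (v0 F), al (v1 F), al (v2 F)); move: (c (v0 F)) (c (v1 F)) (c (v2 F)) => x y z [[]].
case/and3P: un; rewrite !inE !negb_or => /andP[st sc] tc uc.
have big_in r (P : bool) (g : nat -> bool) : (forall u, u \in cols -> g u = P && (u == r)) ->
    \big[addb/false]_(u <- cols) g u = P && (r \in cols).
  move=> hg; rewrite (eq_big_seq (fun u => P && (u == r))) // => {hg}.
  elim: cols uc {sc tc al} => [|u cs IH] /=; first by rewrite big_nil andbF.
  case/andP=> ucs uc; rewrite big_cons IH // inE; case: P {IH} => //=.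
  by case: (eqVneq u r) ucs => [->/negbTE->|] //=.
have F0 u r : u \in cols -> (r == s) || (r == t) -> (r == u) = false.
  by move=> uc' /orP[] /eqP->; apply/negbTE; apply: contraTneq uc' => <-.
move=> hx hy hz.
have [r [P [E H]]] : exists r P, (P && (r \in cols) =
 (((x == s) && (y == t) || (x == t) && (y == s)) (+) ((y == s) && (z == t) || (y == t) && (z == s)) (+) ((x == s) && (z == t) || (x == t) && (z == s))))
  /\ forall u, u \in cols -> [&& [|| x == s, y == s | z == s], [|| x == t, y == t | z == t] & [|| x == u, y == u | z == u]] = P && (u == r); last first.
  by rewrite -E (big_in r P).
have sf : s \in cols = false by apply/negbTE.
have tf : t \in cols = false by apply/negbTE.
have ts : (t == s) = false by rewrite eq_sym; apply/negbTE.
have dec w : w \in [:: s, t & cols] -> [\/ w = s, w = t | w \in cols /\ (w == s) = false /\ (w == t) = false].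
  rewrite !inE => /or3P[/eqP->|/eqP->|wc]; [exact: Or31|exact: Or32|apply: Or33].
  by split=> //; split; apply/negbTE; apply: contraTneq wc => ->.
have [xs|xt|[xc [xs xt]]] := dec _ hx; have [ys|yt|[yc [ys yt]]] := dec _ hy;
have [zs|zt|[zc [zs zt]]] := dec _ hz; subst; rewrite ?xs ?xt ?ys ?yt ?zs ?zt ?eqxx ?ts ?(negbTE st) /=;
try (exists s, false; split=> // u uc'; rewrite /= ?(F0 u s) ?(F0 u t) ?eqxx ?orbT //; fail).
all: first [ exists x, true; rewrite /= ?xc; split=> // u uc'; rewrite ?(F0 u s) ?(F0 u t) ?eqxx ?orbT ?orbF //= [u == _]eq_sym //; fail
 | exists y, true; rewrite /= ?yc; split=> // u uc'; rewrite ?(F0 u s) ?(F0 u t) ?eqxx ?orbT ?orbF //= [u == _]eq_sym //; fail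
 | exists z, true; rewrite /= ?zc; split=> // u uc'; rewrite ?(F0 u s) ?(F0 u t) ?eqxx ?orbT ?orbF //= [u == _]eq_sym //; fail | idtac].
Qed.

Lemma total_tri cols s t : uniq [:: s, t & cols] ->
  (forall x, c x \in [:: s, t & cols]) -> 1 < M ->
  \big[addb/false]_(u <- cols) fsum M (tri s t u) = false.
Proof.
move=> un al M1.
have st : s != t by move: un => /=; rewrite inE negb_or => /andP[/andP[]].
have mono x y : c x = rho -> c y = rho -> chi c s t x y = false.
  rewrite /chi => -> ->.
  by apply/negP => /orP[] /andP[/eqP e1 /eqP e2]; move: st; rewrite -e1 -e2 eqxx.
have <- : fsum M (dchi c s t) = \big[addb/false]_(u <- cols) fsum M (tri s t u).
  rewrite (eq_fsum M (fun F => dchi_tri F un al)).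
  elim: cols {un al} => [|u cs IH]; first by rewrite big_nil fsum0 // => F; rewrite big_nil.
  by rewrite big_cons -IH -fsumD; apply: eq_fsum => F; rewrite big_cons.
apply: total.
- by move=> a; apply: mono; apply: ring => /=; lia.
- by move=> a; apply: mono; apply: ring => /=; lia.
- by rewrite /psi big1 // => j _; apply: mono; apply: ring => /=; lia.
- by rewrite /psi big1 // => j _; apply: mono; apply: ring => /=; lia.
Qed.

Definition cls (s : nat) v := real v && (c v == s).

Hypothesis conn : forall x y, real x -> real y -> c x = c y ->
  exists p, [/\ path lat x p, last x p = y & all (cls (c x)) p].

(** Consecutive vertices of a walk in the connected class [z] share a face, so [S] takes a single
    value on all counted faces; the weight keeps or kills the whole even count. *)
Lemma fsum_const z (S : face -> bool) s t :
  (forall v F, real v -> c v = z -> onf v F -> S F = S (v, false)) ->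
  s != z -> fsum M (tri s t z) = false -> fsum M (fun F => S F && tri s t z F) = false.
Proof.
move=> Sc sz T.
have St v w : real v -> real w -> c v = z -> c w = z -> S (v, false) = S (w, false).
  move=> rv rw cv cw; have [p [pp <- ap]] := conn rv rw (etrans cv (esym cw)).
  rewrite cv in ap; elim: p v pp ap rv cv => [|y p IH] v //= /andP[vy py] /andP[/andP[ry /eqP cy] ap] rv cv.
  have [F /andP[vF yF]] := lat_face vy.
  by rewrite -(Sc _ _ rv cv vF) (Sc _ _ ry cy yF) IH.
have key F : tri s t z F -> exists v, [/\ real v, c v = z & S F = S (v, false)].
  case/and3P=> hs _ hz; have rF := hasc_real sz hs hz.
  have [v vF cv] : exists2 v, onf v F & c v = z.
    case/or3P: hz => /eqP e; [exists (v0 F)|exists (v1 F)|exists (v2 F)]; by rewrite /onf ?eqxx ?orbT.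
  by exists v; split; rewrite ?(rF v vF) //; apply: Sc => //; exact: rF.
apply/negbTE/negP => h; have [F0 /andP[S0 t0]] := fsum_ex h.
have [v [rv cv ev]] := key _ t0.
move: h; rewrite (@eq_fsum M _ (tri s t z)) ?T // => F.
case e: (tri s t z F); rewrite ?andbF // andbT.
by have [w [rw cw ->]] := key _ e; rewrite (St w v) // -ev.
Qed.

Variables (s t u z : nat).
Hypothesis un : uniq [:: s; t; u; z].
Hypothesis al : forall x, c x \in [:: s; t; u; z].
Hypothesis adjc : forall a b, a \in [:: s; t; u; z] -> b \in [:: s; t; u; z] -> a != b ->
  exists x y, [/\ cls a x, cls b y & lat x y].

Lemma cross_cat a b x p q :
  \big[addb/false]_(e <- zip (x :: p ++ q) (p ++ q)) chi c a b e.1 e.2 =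
  \big[addb/false]_(e <- zip (x :: p) p) chi c a b e.1 e.2 (+)
  \big[addb/false]_(e <- zip (last x p :: q) q) chi c a b e.1 e.2.
Proof.
elim: p x => [|y p IH] x /=; first by rewrite big_nil.
by rewrite !big_cons -/(zip (y :: p ++ q) (p ++ q)) -/(zip (y :: p) p) IH addbA.
Qed.

Lemma cross_mono a b r x p : a != b -> cls r x -> all (cls r) p ->
  \big[addb/false]_(e <- zip (x :: p) p) chi c a b e.1 e.2 = false.
Proof.
move=> ab; elim: p x => [|y p IH] x /=; first by rewrite big_nil.
move=> xr /andP[yr ap]; rewrite big_cons -/(zip (y :: p) p) IH // addbF /chi.
case/andP: xr => _ /eqP->; case/andP: yr => _ /eqP->.
by case: (eqVneq r a) => [->|] //=; rewrite ?(negbTE ab) ?andbF.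
Qed.

(** These are the edges of the K4 drawn as walks: each stays in its two classes and crosses between
    them an odd number of times, the data that [stokes] consumes. *)
Lemma walks : exists (b : nat -> pt), (forall a, a \in [:: s; t; u; z] -> cls a (b a)) /\
  forall a a', a \in [:: s; t; u; z] -> a' \in [:: s; t; u; z] -> a != a' ->
  exists p, [/\ path lat (b a) p, last (b a) p = b a',
    all (fun v => real v && (c v \in [:: a; a'])) (b a :: p),
    forall d, d \in [:: s; t; u; z] -> d \notin [:: a; a'] -> forall d', d' != d ->
      \big[addb/false]_(e <- zip (b a :: p) p) chi c d d' e.1 e.2 = false &
    \big[addb/false]_(e <- zip (b a :: p) p) chi c a a' e.1 e.2].
Proof.
have [b hb] : exists b : nat -> pt, forall a, a \in [:: s; t; u; z] -> cls a (b a).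
  have [st [su sz]] : s != t /\ s != u /\ s != z by move: un; rewrite /= !inE !negb_or => /andP[/and3P[]].
  have ms : s \in [:: s; t; u; z] by rewrite !inE eqxx.
  have mt : t \in [:: s; t; u; z] by rewrite !inE eqxx orbT.
  have mu : u \in [:: s; t; u; z] by rewrite !inE eqxx !orbT.
  have mz : z \in [:: s; t; u; z] by rewrite !inE eqxx !orbT.
  have [x [y [hx hy _]]] := adjc ms mt st.
  have [_ [x' [_ hx' _]]] := adjc ms mu su.
  have [_ [y' [_ hy' _]]] := adjc ms mz sz.
  exists (fun a => if a == s then x else if a == t then y else if a == u then x' else y').
  by move=> a; rewrite !inE; do 3 case: eqP => [-> //|_]; move=> /= /eqP->.
exists b; split=> // a a' ha ha' aa'.
have [x [y [hx hy xy]]] := adjc ha ha' aa'.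
have cr r v w : cls r v -> cls r w -> exists p, [/\ path lat v p, last v p = w & all (cls r) p].
  move=> /andP[rv /eqP cv] /andP[rw /eqP cw]; rewrite -cv; apply: conn => //; by rewrite cv cw.
have [p [pp lp ap]] := cr a _ _ (hb a ha) hx.
have [q [pq lq aq]] := cr a' _ _ hy (hb a' ha').
exists (p ++ y :: q); rewrite last_cat cat_path lp /= xy pp pq; split=> //.
- have W r v : cls r v -> r \in [:: a; a'] -> real v && (c v \in [:: a; a']).
    by case/andP=> -> /eqP->.
  have ma : a \in [:: a; a'] by rewrite inE eqxx.
  have ma' : a' \in [:: a; a'] by rewrite !inE eqxx orbT.
  rewrite (W a) ?hb //= all_cat /= (W a' y) //=; apply/andP; split.
    by apply/allP => v vp; apply: (W a) => //; exact: (allP ap).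
  by apply/allP => v vp; apply: (W a') => //; exact: (allP aq).
- move=> d hd nd d' dd'; rewrite cross_cat (@cross_mono d d' a) ?hb 1?eq_sym //= lp.
  rewrite big_cons -/(zip (y :: q) q) (@cross_mono d d' a') 1?eq_sym // addbF /chi /=.
  case/andP: hx => _ /eqP->; case/andP: hy => _ /eqP->.
  by apply/negP => /orP[] /andP[/eqP e1 /eqP e2]; move: nd; rewrite !inE ?e1 ?e2 eqxx ?orbT.
- rewrite cross_cat (@cross_mono a a' a) ?hb //= lp.
  rewrite big_cons -/(zip (y :: q) q) (@cross_mono a a' a') //= addbF /chi /=.
  by case/andP: hx => _ /eqP->; case/andP: hy => _ /eqP->; rewrite !eqxx.
Qed.

Lemma tri_perm a b d F : tri a b d F = tri a d b F /\ tri a b d F = tri b a d F.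
Proof. by rewrite /tri; case: (hasc a F); case: (hasc b F); case: (hasc d F). Qed.

(** Suppose the count is even; by [total_tri] so is that of [s], [t], [z]. The winding parities of
    the four triangles of the K4 add up to zero on every face. Three of them are constant around the
    remaining colour of the counted faces, so they weigh an even count to an even one; the fourth
    weighs it to an odd number by the Stokes formula. *)
Theorem odd_tri : 1 < M -> fsum M (tri s t u).
Proof.
move=> M1; apply/negP => /negP n0.
have [b [hb W]] := walks.
have ms : s \in [:: s; t; u; z] by rewrite !inE eqxx.
have mt : t \in [:: s; t; u; z] by rewrite !inE eqxx orbT.
have mu : u \in [:: s; t; u; z] by rewrite !inE eqxx !orbT.
have mz : z \in [:: s; t; u; z] by rewrite !inE eqxx !orbT.
have [st su sz] : [/\ s != t, s != u & s != z] by move: un; rewrite /= !inE !negb_or => /andP[/and3P[]].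
have [tu tz uz] : [/\ t != u, t != z & u != z].
  by move: un; rewrite /= !inE !negb_or => /and4P[_ /andP[]].
have nst : fsum M (tri s t u) = false by apply/negbTE.
have T2 a d e f : uniq [:: a; d; e; f] -> [:: a; d; e; f] =i [:: s; t; u; z] ->
    fsum M (tri a d e) = fsum M (tri a d f).
  move=> uq eqm; have := @total_tri [:: e; f] a d uq (fun x => etrans (eqm _) (al x)) M1.
  by rewrite !big_cons big_nil addbF; do 2 case: (fsum _ _).
have eqm f g h i : [:: f; g; h; i] =i [:: s; t; u; z] -> forall x, c x \in [:: f; g; h; i].
  by move=> e x; rewrite e.
have W2 a d : a \in [:: s; t; u; z] -> d \in [:: s; t; u; z] -> a != d -> True by [].
have [pst [st1 st2 st3 st4 st5]] := W s t ms mt st.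
have [psu [su1 su2 su3 su4 su5]] := W s u ms mu su.
have [psz [sz1 sz2 sz3 sz4 sz5]] := W s z ms mz sz.
have [ptu [tu1 tu2 tu3 tu4 tu5]] := W t u mt mu tu.
have [ptz [tz1 tz2 tz3 tz4 tz5]] := W t z mt mz tz.
have [puz [uz1 uz2 uz3 uz4 uz5]] := W u z mu mz uz.
have avoid x p a d f v : all (fun v => real v && (c v \in [:: a; d])) (x :: p) ->
    f \notin [:: a; d] -> c v = f -> v \notin x :: p.
  by move=> ap nf cv; apply/negP => /(allP ap) /andP[_]; rewrite cv (negbTE nf).
have cst a d f g x y w p q r : path lat x p -> last x p = y -> path lat y q -> last y q = w ->
    path lat x r -> last x r = w ->
    all (fun v => real v && (c v \in [:: a; d])) (x :: p) ->
    all (fun v => real v && (c v \in [:: d; f])) (y :: q) ->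
    all (fun v => real v && (c v \in [:: a; f])) (x :: r) ->
    g \notin [:: a; d; f] -> forall v F, real v -> c v = g -> onf v F ->
    wind x y p q r F = wind x y p q r (v, false).
  move=> h1 h2 h3 h4 h5 h6 h7 h8 h9 /norP[n1 /norP[n2 /norP[n3 _]]] v F /andP[/andP[v1 _] /andP[v2 _]] cv vF.
  apply: (wind_vertex h2 h4 h6 h1 h3 h5 v1 v2 _ _ _ vF); apply: avoid; eauto;
   by rewrite !inE !negb_or ?n1 ?n2 ?n3.
have ntri a d e : [:: a; d; e] \in [:: [:: s; t; z]; [:: s; t; u]; [:: s; u; t]; [:: t; u; s]] ->
   fsum M (tri a d e) = false.
  have p1 : fsum M (tri s t z) = false.
    have := @total_tri [:: u; z] s t un al M1; rewrite !big_cons big_nil addbF nst.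
    by case: (fsum _ _).
  rewrite !inE => /or4P[] /eqP[-> -> ->] //.
    by rewrite -nst; apply: eq_fsum => F; have [-> _] := tri_perm s u t F.
  rewrite -nst; apply: eq_fsum => F; have [-> _] := tri_perm t u s F.
  by have [_ ->] := tri_perm t s u F.
have [ts us zs] : [/\ t != s, u != s & z != s] by split; rewrite eq_sym.
have [ut zt zu] : [/\ u != t, z != t & z != u] by split; rewrite eq_sym.
pose A := wind (b s) (b t) pst ptu psu.
pose B := wind (b s) (b t) pst ptz psz.
pose C := wind (b s) (b u) psu puz psz.
pose D := wind (b t) (b u) ptu puz ptz.
(* Each of the six walks is a side of two of the four triangles. *)
have E0 F : A F (+) B F (+) C F (+) D F = false.
  rewrite /A /B /C /D /wind.
  by do 6?[move: (fillw _ _ F) => ?]; repeat match goal with x : bool |- _ => case: x => // end.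
have eB : fsum M (fun F => B F && tri s t u F) = false.
  apply: (fsum_const _ su); last by apply: ntri; rewrite !inE eqxx ?orbT.
  apply: (cst s t z u (b s) (b t) (b z)) => //; rewrite !inE !negb_or us ut uz //.
have eC : fsum M (fun F => C F && tri s t u F) = false.
  rewrite (@eq_fsum M _ (fun F => C F && tri s u t F)); last by move=> F; have [-> _] := tri_perm s t u F.
  apply: (fsum_const _ st); last by apply: ntri; rewrite !inE eqxx ?orbT.
  by apply: (cst s u z t (b s) (b u) (b z)) => //; rewrite !inE !negb_or ts tu tz.
have eD : fsum M (fun F => D F && tri s t u F) = false.
  rewrite (@eq_fsum M _ (fun F => D F && tri t u s F)); last first.
    by move=> F; have [_ ->] := tri_perm s t u F; have [-> _] := tri_perm t s u F.
  apply: (fsum_const _ ts); last by apply: ntri; rewrite !inE eqxx ?orbT.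
  by apply: (cst t u z s (b t) (b u) (b z)) => //; rewrite !inE !negb_or st su sz.
have eA2 : fsum M (fun F => A F && tri s t z F) = false.
  apply: (fsum_const _ sz); last by apply: ntri; rewrite !inE eqxx ?orbT.
  by apply: (cst s t u z (b s) (b t) (b u)) => //; rewrite !inE !negb_or zs zt zu.
(* By [stokes], the weighted sum counts the [s]-[t] crossings of the closed walk. Only the side from
   [b s] to [b t] has an odd number, and the [psi] terms cancel. *)
have eA1 : fsum M (fun F => A F && dchi c s t F).
  have h0 a : chi c s t (a, 0) (a.+1, 0) = false.
    rewrite /chi.
    have [-> ->] : c (a, 0) = rho /\ c (a.+1, 0) = rho by split; apply: ring; rewrite /= andbF.
    by apply/negP => /orP[] /andP[/eqP e1 /eqP e2]; move: st; rewrite -e1 -e2 eqxx.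
  have bnd x p a d : all (fun v => real v && (c v \in [:: a; d])) (x :: p) ->
      forall y, y \in x :: p -> y.1 < M /\ y.2 < M.
    by move=> ap y /(allP ap) /andP[/andP[/andP[_ ->] /andP[_ ->]]].
  rewrite (@eq_fsum M _ (fun F => ((fillw (b s) pst F && dchi c s t F)
     (+) (fillw (b t) ptu F && dchi c s t F)) (+) (fillw (b s) psu F && dchi c s t F))); last first.
    by move=> F; rewrite /A /wind !andb_addl.
  rewrite !fsumD (stokes h0 st1 (bnd _ _ _ _ st3)) (stokes h0 tu1 (bnd _ _ _ _ tu3)) (stokes h0 su1 (bnd _ _ _ _ su3)).
  rewrite st5 tu4 ?(su4 t) // ?inE ?negb_or ?st ?su ?ts ?tu //.
  have -> : \big[addb/false]_(e <- zip (b s :: psu) psu) chi c s t e.1 e.2 = false.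
    rewrite -[RHS](su4 t mt _ s st) ?inE ?negb_or ?ts ?tu //.
    by apply: eq_bigr => e _; rewrite /chi orbC; congr (_ || _); rewrite andbC.
  by rewrite st2 tu2 su2; do 3?[move: (psi _ _ _ _) => ?]; repeat match goal with x : bool |- _ => case: x => // end.
(* The faces coloured [s], [t], [z] contribute zero by [eA2], so [dchi] may be replaced by the faces
   coloured [s], [t], [u]. *)
have eA : fsum M (fun F => A F && tri s t u F).
  suff -> : fsum M (fun F => A F && tri s t u F) = fsum M (fun F => A F && dchi c s t F) by [].
  rewrite -[LHS]addbF -eA2 -fsumD; apply: eq_fsum => F.
  by rewrite (dchi_tri F un al) !big_cons big_nil addbF andb_addr.
have : fsum M (fun F => (A F (+) B F (+) C F (+) D F) && tri s t u F) = false.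
  by apply: fsum0 => F; rewrite E0.
rewrite (@eq_fsum M _ (fun F => ((A F && tri s t u F) (+) (B F && tri s t u F) (+) (C F && tri s t u F)) (+) (D F && tri s t u F))); last first.
  by move=> F; rewrite !andb_addl.
by rewrite !fsumD eA eB eC eD.
Qed.
End Parity.

(** * Minor models on a contracted board *)

Section GraphDefs.
Variables (N : finType) (adj : rel N).
Definition within (A : pred N) : rel N := [rel a b | [&& adj a b, A a & A b]].
(** The fibres of [f] are the branch sets of a complete minor that uses every node. *)
Definition minor_model (f : N -> nat) :=
  (forall x y, f x = f y -> connect (within (fun n => f n == f x)) x y) /\
  (forall x y, f x != f y -> exists a b, [/\ f a = f x, f b = f y & adj a b]).
Definition planar_like :=
  (forall f s, minor_model f -> uniq (map f s) -> size s <= 4) /\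
  (forall f g c a1 a2 a3, minor_model f -> uniq [:: f c; f a1; f a2; f a3] ->
     (forall n, f n \in [:: f c; f a1; f a2; f a3]) ->
     (forall n, f n != f c -> g n = f n) ->
     (forall n, f n = f c -> g n \in [:: f a1; f a2; f a3]) ->
     exists x y z, [/\ [/\ g x = f a1, g y = f a2 & g z = f a3],
        adj x y, adj y z, adj x z & [|| f x == f c, f y == f c | f z == f c]]).
End GraphDefs.

Section Board.
Variables (N : finType) (adj : rel N) (M : nat) (pi : pt -> N) (r0 : N).
Hypothesis M1 : 1 < M.
Hypothesis pi_ring : forall x : pt, ~~ ((1 < x.1 < M.-1) && (1 < x.2 < M.-1)) -> pi x = r0.
Hypothesis pi_adj : forall a b, adj a b <->
  a != b /\ exists x y, [/\ real M x, real M y, lat x y, pi x = a & pi y = b].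
Hypothesis pi_conn : forall x y, real M x -> real M y -> pi x = pi y ->
  exists p, [/\ path lat x p, last x p = y & all (fun v => real M v && (pi v == pi x)) p].

(** Node walks lift to pixel walks: an adjacency is realised by a lattice edge, and the pixels of
    one node are connected. *)
Lemma board_conn f x y : minor_model adj f -> real M x -> real M y -> f (pi x) = f (pi y) ->
  exists p, [/\ path lat x p, last x p = y & all (cls (f \o pi) M (f (pi x))) p].
Proof.
move=> [fc _] rx ry e; have /connectP[q] := fc _ _ e.
have base x' y' : real M x' -> real M y' -> pi x' = pi y' ->
  exists p, [/\ path lat x' p, last x' p = y' & all (cls (f \o pi) M (f (pi x'))) p].
  move=> rx' ry' e'; have [p [p1 p2 p3]] := pi_conn rx' ry' e'; exists p; split=> //.
  by apply: sub_all p3 => v /andP[rv /eqP ev]; rewrite /cls rv /= ev.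
elim: q x rx e => [|n q IH] x rx e /=; first by move=> _ /esym/base; exact.
case/andP=> /and3P[xn _ /eqP fn] pq ly.
have [_ [u [v [ru rv uv eu ev]]]] := (pi_adj _ _).1 xn.
have [p1 [a1 b1 c1]] := base _ _ rx ru (esym eu).
subst n.
have [|||p2 [a2 b2 c2]] := IH v rv; first by rewrite fn.
- by rewrite fn.
- by [].
exists (p1 ++ v :: p2); rewrite cat_path last_cat /= a1 b1 uv a2 b2; split=> //.
rewrite all_cat c1 /= /cls rv /= fn eqxx /=.
by move: c2; rewrite fn.
Qed.

Lemma board_adj f m n : minor_model adj f -> f m != f n ->
  exists x y, [/\ cls (f \o pi) M (f m) x, cls (f \o pi) M (f n) y & lat x y].
Proof.
move=> [_ fa] /fa[a [b [<- <- ab]]].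
have [_ [x [y [rx ry xy <- <-]]]] := (pi_adj _ _).1 ab.
by exists x, y; rewrite /cls rx ry !eqxx.
Qed.

Lemma board_ring f (x : pt) : ~~ ((1 < x.1 < M.-1) && (1 < x.2 < M.-1)) -> (f \o pi) x = f r0 :> nat.
Proof. by move=> h; rewrite /= pi_ring. Qed.

Lemma board_odd f s0 s1 s2 s3 : minor_model adj f ->
  uniq [:: f s0; f s1; f s2; f s3] -> (forall n, f n \in [:: f s0; f s1; f s2; f s3]) ->
  fsum M (tri (f \o pi) (f s0) (f s1) (f s2)).
Proof.
move=> mf un al.
apply: (@odd_tri _ _ _ (@board_ring f) _ _ _ _ (f s3)) => //.
- by move=> x y rx ry e; apply: board_conn.
- by move=> x; apply: al.
- move=> a b; rewrite !inE => ha hb; case/or4P: ha => /eqP->; case/or4P: hb => /eqP->;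
  by move/(board_adj mf).
Qed.

Lemma tri_ext (c c' : pt -> nat) a b d : (forall x, (c x == a) = (c' x == a)) ->
  (forall x, (c x == b) = (c' x == b)) -> (forall x, (c x == d) = (c' x == d)) ->
  tri c a b d =1 tri c' a b d.
Proof. by move=> h1 h2 h3 F; rewrite /tri /hasc !h1 !h2 !h3. Qed.

(** Completeness is what makes arbitrary merging safe: the merged classes are pairwise adjacent,
    hence their union is connected. *)
Lemma minor_merge f h : minor_model adj f -> minor_model adj (h \o f).
Proof.
move=> [fc fa].
have sub x y : f x = f y -> connect (within adj (fun n => h (f n) == h (f x))) x y.
  move=> e; apply: connect_sub (fc _ _ e) => u v /and3P[uv /eqP fu /eqP fv].
  by apply: connect1; rewrite /within /= uv fu fv !eqxx.
split=> x y /= hxy; last first.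
  have /fa[u [v [fu fv uv]]] : f x != f y by apply: contraNneq hxy => ->.
  by exists u, v; rewrite fu fv.
case: (eqVneq (f x) (f y)) => [|/fa[u [v [fu fv uv]]]]; first exact: sub.
apply: connect_trans (sub _ _ (esym fu)) (connect_trans (connect1 _) _); first last.
- by rewrite hxy -fv; apply: sub.
- by rewrite /within /= uv fu fv hxy eqxx.
Qed.

(** With five classes, merging two leaves a K4, so every triple of classes has an odd triangle
    count; the three triples through a fixed pair then have an odd sum, against [total_tri]. For the
    recolouring, the count of three-coloured faces is odd before, by [board_odd], and even after,
    when only three colours are left. *)
Lemma board_planar : planar_like adj.
Proof.
split.
  move=> f s mf us; rewrite leqNgt; apply/negP => s5.
  have [a0 [a1 [a2 [a3 [a4 [s' es]]]]]] : exists a0 a1 a2 a3 a4 s', s = [:: a0, a1, a2, a3, a4 & s'].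
    by case: s s5 {us} => [|a0 [|a1 [|a2 [|a3 [|a4 s']]]]] // _; exists a0, a1, a2, a3, a4, s'.
  subst s; move: s5 => _.
  have uq : uniq [:: f a0; f a1; f a2; f a3; f a4].
    by move: us; rewrite -[map f _]/([:: f a0; f a1; f a2; f a3; f a4] ++ map f s') cat_uniq => /andP[].
  move: uq; set c0 := f a0; set c1 := f a1; set c2 := f a2; set c3 := f a3; set c4 := f a4 => uq.
  pose h x := if x \in [:: c1; c2; c3; c4] then x else c0.
  have mh : minor_model adj (h \o f) by exact: minor_merge.
  have h5 x : h x \in [:: c0; c1; c2; c3; c4].
    by rewrite /h; case: ifP => hx; rewrite inE ?hx ?orbT ?eqxx.
  have hi x : x \in [:: c0; c1; c2; c3; c4] -> h x = x.
    by rewrite inE /h => /orP[/eqP->|->] //; case: ifP.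
  (* every three of the five classes carry an odd number of faces: merge the
     other two *)
  have odd3 b0 b1 b2 b3 b4 : [:: f b0; f b1; f b2; f b3; f b4] =i [:: c0; c1; c2; c3; c4] ->
      uniq [:: f b0; f b1; f b2; f b3; f b4] ->
      fsum M (tri (h \o f \o pi) (f b0) (f b1) (f b2)).
    move=> eqb ub; pose k x := if x == f b4 then f b3 else x.
    have mem i : i \in [:: f b0; f b1; f b2; f b3; f b4] -> h i = i by rewrite eqb; apply: hi.
    have hb0 : h (f b0) = f b0 by apply: mem; rewrite !inE eqxx.
    have hb1 : h (f b1) = f b1 by apply: mem; rewrite !inE eqxx ?orbT.
    have hb2 : h (f b2) = f b2 by apply: mem; rewrite !inE eqxx ?orbT.
    have hb3 : h (f b3) = f b3 by apply: mem; rewrite !inE eqxx ?orbT.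
    move: (ub); rewrite /= !inE !negb_or => /and5P[/and4P[u01 u02 u03 u04] /and3P[u12 u13 u14] /andP[u23 u24] u34 _].
    have k0 : k (f b0) = f b0 by rewrite /k (negbTE u04).
    have k1 : k (f b1) = f b1 by rewrite /k (negbTE u14).
    have k2 : k (f b2) = f b2 by rewrite /k (negbTE u24).
    have k3 : k (f b3) = f b3 by rewrite /k (negbTE u34).
    have := @board_odd (k \o (h \o f)) b0 b1 b2 b3 (minor_merge k mh).
    rewrite /= hb0 hb1 hb2 hb3 k0 k1 k2 k3 => H.
    have kE x r : r != f b3 -> r != f b4 -> (h x == r) = (k (h x) == r).
      move=> r3 r4; rewrite /k; case: (eqVneq (h x) (f b4)) => // ->.
      by rewrite eq_sym (negbTE r4) eq_sym (negbTE r3).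
    rewrite (@eq_fsum M _ (tri (k \o (h \o f) \o pi) (f b0) (f b1) (f b2))); last first.
      by apply: tri_ext => x /=; apply: kE.
    apply: H; first by rewrite /= !inE !negb_or u01 u02 u03 u12 u13 u23.
    move=> n; have := h5 (f n); rewrite -eqb /k !inE.
    by case: (eqVneq (h (f n)) (f b4)) => [_ _|_]; rewrite ?eqxx ?orbT //= orbF.
  have := @total_tri (h \o f \o pi) M (h (f r0)) (@board_ring (h \o f)) [:: c2; c3; c4] c0 c1 uq (fun x => h5 _) M1.
  rewrite !big_cons big_nil.
  rewrite (odd3 a0 a1 a2 a3 a4) // (odd3 a0 a1 a3 a2 a4) ?(odd3 a0 a1 a4 a2 a3) //.
  - by move=> x; rewrite !inE -/c0 -/c1 -/c2 -/c3 -/c4; do 5 case: (x == _).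
  - by rewrite (@perm_uniq _ _ [:: c0; c1; c2; c3; c4]) //; apply/permP => P; rewrite /= -/c0 -/c1 -/c2 -/c3 -/c4;
      move: (P c0) (P c1) (P c2) (P c3) (P c4); do 5 case.
  - by move=> x; rewrite !inE -/c0 -/c1 -/c2 -/c3 -/c4; do 5 case: (x == _).
  - by rewrite (@perm_uniq _ _ [:: c0; c1; c2; c3; c4]) //; apply/permP => P; rewrite /= -/c0 -/c1 -/c2 -/c3 -/c4;
      move: (P c0) (P c1) (P c2) (P c3) (P c4); do 5 case.
move=> f g c a1 a2 a3 mf un al gf gc.
have o0 : fsum M (tri (f \o pi) (f a1) (f a2) (f a3)).
  apply: (board_odd (s3 := c)) => //.
    by rewrite -(rot_uniq 3).
  by move=> n; rewrite -(mem_rot 3) al.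
have ung : uniq [:: f a1; f a2; f a3] by case/andP: un.
have alg n : g n \in [:: f a1; f a2; f a3].
  case: (eqVneq (f n) (f c)) => [/gc|nc] //.
  by rewrite gf //; move: (al n); rewrite inE (negbTE nc).
have tg : fsum M (tri (g \o pi) (f a1) (f a2) (f a3)) = false.
  have := @total_tri (g \o pi) M (g r0) (@board_ring g) [:: f a3] (f a1) (f a2) ung (fun x => alg _) M1.
  by rewrite big_cons big_nil addbF.
pose meets F := [|| f (pi (v0 F)) == f c, f (pi (v1 F)) == f c | f (pi (v2 F)) == f c].
(* Off the recoloured class the two colourings agree, and a face meeting that class is not counted
   before; so the change of parity comes from such faces. *)
have /fsum_ex[F /andP[mF tF]] : fsum M (fun F => meets F && tri (g \o pi) (f a1) (f a2) (f a3) F).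
  suff -> : fsum M (fun F => meets F && tri (g \o pi) (f a1) (f a2) (f a3) F) =
     fsum M (tri (g \o pi) (f a1) (f a2) (f a3)) (+) fsum M (tri (f \o pi) (f a1) (f a2) (f a3)).
    by rewrite tg o0.
  rewrite -fsumD; apply: eq_fsum => F; rewrite /meets.
  have cn : f c \notin [:: f a1; f a2; f a3] by case/andP: un.
  case: (boolP [|| _, _ | _]) => mF /=.
    suff -> : tri (f \o pi) (f a1) (f a2) (f a3) F = false by rewrite addbF.
    apply/negbTE/negP; rewrite /tri /hasc /= => /and3P[].
    move: cn; rewrite !inE !negb_or => /and3P[n1 n2 n3].
    have /= := un; rewrite !inE !negb_or => /and4P[_ /andP[n12 n13] n23 _].
    move: mF n1 n2 n3 n12 n13 n23.
    move: (f (pi (v0 F))) (f (pi (v1 F))) (f (pi (v2 F))) (f c) (f a1) (f a2) (f a3); lia.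
  move: mF; rewrite !negb_or => /and3P[m0 m1 m2].
  by rewrite /tri /hasc /= !gf // addbb.
have pick s : hasc (g \o pi) s F -> exists2 v, onf v F & g (pi v) = s.
  by case/or3P=> /eqP e; [exists (v0 F)|exists (v1 F)|exists (v2 F)]; rewrite // /onf eqxx ?orbT.
have [h1 h2 h3] : [/\ hasc (g \o pi) (f a1) F, hasc (g \o pi) (f a2) F & hasc (g \o pi) (f a3) F].
  by case/and3P: tF.
have n12 : f a1 != f a2 by move: ung; rewrite /= !inE !negb_or => /andP[/andP[]].
have n13 : f a1 != f a3 by move: ung; rewrite /= !inE !negb_or => /andP[/andP[]].
have n23 : f a2 != f a3 by move: ung; rewrite /= !inE !negb_or => /and3P[].
have rF := hasc_real (@board_ring g) n12 h1 h2.
have lF i j : onf i F -> onf j F -> i != j -> lat i j.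
  rewrite /onf => /or3P[] /eqP-> /or3P[] /eqP->; rewrite ?eqxx //= => _;
  by rewrite /v0 /v1 /v2; case: F {mF tF h1 h2 h3 rF pick} => [[a b] []]; rewrite /lat /lat1 -!pair_eqE /pair_eq /=; lia.
have v_adj i j : onf i F -> onf j F -> g (pi i) != g (pi j) -> adj (pi i) (pi j).
  move=> iF jF nij; apply/pi_adj; split; first by apply: contraNneq nij => ->.
  exists i, j; split=> //; [exact: rF|exact: rF|apply: lF => //].
  by apply: contraNneq nij => ->.
have [[[x xF gx] [y yF gy]] [z zF gz]] := (pick _ h1, pick _ h2, pick _ h3).
exists (pi x), (pi y), (pi z); split=> //; try by apply: v_adj => //; rewrite ?gx ?gy ?gz.
have xy : x != y by apply: contraNneq n12 => e; rewrite -gx e gy.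
have xz : x != z by apply: contraNneq n13 => e; rewrite -gx e gz.
have yz : y != z by apply: contraNneq n23 => e; rewrite -gy e gz.
move: mF xF yF zF xy xz yz; rewrite /meets /onf.
by move=> h /or3P[] /eqP-> /or3P[] /eqP-> /or3P[] /eqP->; rewrite ?eqxx //= => _ _ _;
  case/or3P: h => ->; rewrite ?orbT.
Qed.
End Board.

(** * Tree decomposition from a hop relation *)

(* [pot a b c] is the worst size of the union of three bags of radii [a-1], [b-1],
   [c-1] at mutually related nodes (radius -1 standing for the empty set). *)
Definition pot a b c := 'C((maxn a (maxn b c)).+2, 3) +
  'C((a + b + c - maxn a (maxn b c) - minn a (minn b c)).+1, 2) + minn a (minn b c).

Lemma potC12 a b c : pot a b c = pot b a c.
Proof. by rewrite /pot; congr (binomial _ _ + binomial _ _ + _); lia. Qed.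
Lemma potC23 a b c : pot a b c = pot a c b.
Proof. by rewrite /pot; congr (binomial _ _ + binomial _ _ + _); lia. Qed.

Lemma pot_sorted a b c : c <= b -> b <= a -> pot a b c = 'C(a.+2, 3) + 'C(b.+1, 2) + c.
Proof. by move=> cb ba; rewrite /pot; congr (binomial _ _ + binomial _ _ + _); lia. Qed.

Lemma pot_mono a b c a' b' c' : a <= a' -> b <= b' -> c <= c' -> pot a b c <= pot a' b' c'.
Proof. by move=> h1 h2 h3; rewrite /pot !leq_add // ?leq_bin2l //; lia. Qed.

(** Removing the third centre costs one element and leaves radius [c] to its successors, which
    absorb it into any larger radius. When radii tie, Pascal's rule pays for the element. *)
Lemma pot_elim a b c : pot (maxn a c) (maxn b c) c < pot a b c.+1.
Proof.
wlog ba : a b / b <= a.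
  by move=> H; case/orP: (leq_total b a) => h; [exact: H | rewrite potC12 (potC12 a); exact: H].
case: (leqP c.+1 b) => cb.
  have e1 : maxn a c = a by lia.
  have e2 : maxn b c = b by lia.
  by rewrite e1 e2 !pot_sorted; lia.
have -> : maxn b c = c by lia.
case: (leqP c.+1 a) => ca.
  have -> : maxn a c = a by lia.
  rewrite (potC23 a b) pot_sorted ?pot_sorted; try lia.
  have := binS c.+1 1; rewrite bin1; lia.
have -> : maxn a c = c by lia.
rewrite (potC23 a b) (potC12 a) !pot_sorted //; try lia.
have := binS c.+2 2; have := binS c.+1 1; rewrite bin1; lia.
Qed.

Section Bags.
Variables (T : nat) (A : rel 'I_T).
Hypothesis Alt : forall j y, A j y -> y < j.
Hypothesis Acard : forall j, #|[set y | A j y]| <= 3.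
Hypothesis Aclique : forall j y y', A j y -> A j y' -> y' < y -> A y y'.

Fixpoint bag s j : {set 'I_T} :=
  if s is s'.+1 then j |: \bigcup_(y | A j y) bag s' y else [set j].
Definition bag' g j := if g is g'.+1 then bag g' j else set0.

Lemma bag'S g j : 0 < g -> bag' g j = j |: \bigcup_(y | A j y) bag' g.-1 y.
Proof.
case: g => [|[|g]] //= _.
by rewrite big1 ?setU0.
Qed.

Lemma bag_mono s s' j : s <= s' -> bag s j \subset bag s' j.
Proof.
elim: s s' j => [|s IH] [|s'] j //= h; first by rewrite sub1set !inE eqxx.
apply: setUS; apply/bigcupsP => y Ay; apply: subset_trans (IH s' y h) _.
by apply: bigcup_sup.
Qed.

Lemma bag'_mono g g' j : g <= g' -> bag' g j \subset bag' g' j.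
Proof. by case: g g' => [|g] [|g'] //= h; rewrite ?sub0set //; apply: bag_mono. Qed.

Definition cl (z1 z2 : 'I_T) (g1 g2 : nat) := 0 < g1 -> 0 < g2 ->
  (A z1 z2 || A z2 z1).

Lemma cl_sym z1 z2 g1 g2 : cl z1 z2 g1 g2 -> cl z2 z1 g2 g1.
Proof. by move=> h a b; rewrite orbC; apply: h. Qed.

Definition U3 (z1 z2 z3 : 'I_T) g1 g2 g3 := bag' g1 z1 :|: bag' g2 z2 :|: bag' g3 z3.

Lemma U3_sup z1 z2 z3 g1 g2 g3 : [/\ bag' g1 z1 \subset U3 z1 z2 z3 g1 g2 g3,
  bag' g2 z2 \subset U3 z1 z2 z3 g1 g2 g3 & bag' g3 z3 \subset U3 z1 z2 z3 g1 g2 g3].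
Proof. by split; apply/subsetP => x h; rewrite !inE h ?orbT. Qed.

(** The centre [z3] of largest index is removed. Its lower neighbours number at most three, are
    mutually related, and include the other active centres. What remains is covered by three bags
    around them, with radii raised to at least [g] where an old centre is also a neighbour. *)
Lemma bag_elim n : (forall (z1 z2 z3 : 'I_T) g1 g2 g3, (0 < g1 -> z1 < n) -> (0 < g2 -> z2 < n) -> (0 < g3 -> z3 < n) ->
    cl z1 z2 g1 g2 -> cl z1 z3 g1 g3 -> cl z2 z3 g2 g3 -> #|U3 z1 z2 z3 g1 g2 g3| <= pot g1 g2 g3) ->
  forall (z1 z2 z3 : 'I_T) g1 g2 g, z3 < n.+1 -> (0 < g1 -> A z3 z1) -> (0 < g2 -> A z3 z2) ->
    cl z1 z2 g1 g2 -> #|U3 z1 z2 z3 g1 g2 g.+1| <= pot g1 g2 g.+1.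
Proof.
move=> IH z1 z2 z3 g1 g2 g z3n A1 A2 c12.
(* By symmetry, an inactive first centre forces an inactive second one, which leaves three cases by
   the number of active old centres. *)
wlog g12 : z1 z2 g1 g2 A1 A2 c12 / (g1 == 0) ==> (g2 == 0).
  move=> H; case: (boolP ((g1 == 0) ==> (g2 == 0))) => h; first exact: H.
  rewrite potC12 /U3 (setUC (bag' g1 z1)); apply: H => //; first exact: cl_sym.
  by move: h; case: (g1) (g2) => [|a] [|b].
apply: leq_trans (pot_elim g1 g2 g).
suff [w1 [w2 [w3 [d1 [d2 [d3 [H1 H2 H3 HA sub]]]]]]] : exists w1 w2 w3 d1 d2 d3,
  [/\ d1 <= maxn g1 g, d2 <= maxn g2 g, d3 <= g,
    [/\ 0 < d1 -> A z3 w1, 0 < d2 -> A z3 w2 & 0 < d3 -> A z3 w3] /\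
    [/\ cl w1 w2 d1 d2, cl w1 w3 d1 d3 & cl w2 w3 d2 d3] &
    U3 z1 z2 z3 g1 g2 g.+1 \subset z3 |: U3 w1 w2 w3 d1 d2 d3].
  apply: leq_trans (subset_leq_card sub) _; rewrite cardsU1.
  apply: leq_trans (leq_add (leq_b1 _) (leqnn _)) _; rewrite add1n ltnS.
  apply: leq_trans (pot_mono H1 H2 H3).
  case: HA => [[a1 a2 a3] [b1 b2 b3]].
  have lt w d : (0 < d -> A z3 w) -> 0 < d -> w < n by move=> h /h/Alt; lia.
  by apply: IH => //; apply: lt.
pose D := enum ([set y | A z3 y] :\: ([set y | (0 < g1) && (y == z1)] :|: [set y | (0 < g2) && (y == z2)])).
(* Missing neighbours are padded with the dummy centre [z3] of radius 0, whose bag is empty. *)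
pose w i := nth z3 D i; pose d i := if i < size D then g else 0.
have Aw i : 0 < d i -> A z3 (w i).
  rewrite /d; case: ifP => // iD _; have := mem_nth z3 iD.
  by rewrite mem_enum !inE => /andP[].
have clw i z h : (0 < h -> A z3 z) -> (h > 0 -> z \notin D) -> cl z (w i) h (d i).
  move=> Az zD h0 d0; have a1 := Az h0; have a2 := Aw _ d0.
  case: (ltngtP z (w i)) => zw; [|by rewrite (Aclique a1 a2)|].
    by rewrite (Aclique a2 a1) ?orbT.
  case/negP: (zD h0); rewrite (val_inj zw) mem_nth //.
  by move: d0; rewrite /d; case: ifP.
have clww i j : i != j -> cl (w i) (w j) (d i) (d j).
  move=> ij h0 d0; have a1 := Aw _ h0; have a2 := Aw _ d0.
  case: (ltngtP (w i) (w j)) => zw; [by rewrite (Aclique a2 a1) ?orbT|by rewrite (Aclique a1 a2)|].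
  move/val_inj/eqP: zw; rewrite nth_uniq ?enum_uniq ?(negbTE ij) //.
    by move: h0; rewrite /d; case: ifP.
  by move: d0; rewrite /d; case: ifP.
have sizeD : size D + (0 < g1) + (0 < g2) <= 3.
  apply: leq_trans (Acard z3); rewrite -cardE cardsD.
  set I := _ :&: _.
  suff : (0 < g1) + (0 < g2) <= #|I|.
    by have := subset_leq_card (subsetIl [set y | A z3 y] ([set y | (0 < g1) && (y == z1)] :|: [set y | (0 < g2) && (y == z2)])); rewrite -/I; lia.
  case: (posnP g2) => [e2|p2].
    rewrite addn0; case: (posnP g1) => [//|p1]; rewrite card_gt0.
    by apply/set0Pn; exists z1; rewrite !inE p1 eqxx A1.
  have p1 : 0 < g1 by move: g12 p2; case: (g1) (g2) => [|a] [|b].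
  rewrite p1 -[_ + _]/2.
  have ne : z1 != z2.
    by apply/eqP => e; have := c12 p1 p2; rewrite e orbb => /Alt; rewrite ltnn.
  apply: leq_trans (_ : #|[set z1; z2]| <= _); first by rewrite cards2 ne.
  by apply/subset_leq_card/subsetP => y; rewrite !inE p1 p2 => /orP[]/eqP->; rewrite ?eqxx ?A1 ?A2 ?orbT.
have dg i : d i <= g by rewrite /d; case: ifP.
have zD h z : (0 < h -> A z3 z) -> [|| (h == g1) && (z == z1) | (h == g2) && (z == z2)] -> h > 0 -> z \notin D.
  move=> _ hz h0; rewrite mem_enum !inE negb_and negbK.
  by case/orP: hz => /andP[/eqP eh /eqP ->]; rewrite -eh h0 eqxx ?orbT.
have cov y : A z3 y -> [|| (0 < g1) && (y == z1), (0 < g2) && (y == z2) | y \in D].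
  by move=> Ay; rewrite mem_enum !inE Ay andbT orbA orbN.
have subA (X : {set 'I_T}) : bag' g1 z1 \subset X -> bag' g2 z2 \subset X ->
    (forall y, A z3 y -> bag' g y \subset X) -> U3 z1 z2 z3 g1 g2 g.+1 \subset z3 |: X.
  move=> x1 x2 x3; rewrite /U3 !subUset.
  rewrite (subset_trans x1 (subsetUr _ _)) (subset_trans x2 (subsetUr _ _)).
  rewrite bag'S //= subUset subsetUl /=; apply/bigcupsP => y Ay.
  exact: subset_trans (x3 y Ay) (subsetUr _ _).
have Dw (X : {set 'I_T}) n0 y : size D <= n0 -> (forall i, i < n0 -> bag' (d i) (w i) \subset X) -> y \in D -> bag' g y \subset X.
  move=> sD hX yD; have iD : index y D < size D by rewrite index_mem.
  have := hX (index y D) (leq_trans iD sD).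
  by rewrite /d iD /w nth_index.
case: (posnP g1) => [e1|p1].
  have e2 : g2 = 0 by move: g12; rewrite e1 /= => /eqP.
  exists (w 0), (w 1), (w 2), (d 0), (d 1), (d 2); split.
  - exact: leq_trans (dg _) (leq_maxr _ _).
  - exact: leq_trans (dg _) (leq_maxr _ _).
  - exact: dg.
  - by split; split; rewrite ?e1 //; by [apply: Aw | apply: clww].
  apply: subA; rewrite ?e1 ?e2 ?sub0set // => y /cov; rewrite e1 e2 /= => yD.
  apply: (Dw _ 3) yD => [|i]; first by move: sizeD; rewrite e1 e2; lia.
  by case: i => [|[|[|]]] // _; case: (U3_sup (w 0) (w 1) (w 2) (d 0) (d 1) (d 2)).
case: (posnP g2) => [e2|p2].
  exists z1, (w 0), (w 1), (maxn g1 g), (d 0), (d 1); split=> //.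
  - exact: leq_trans (dg _) (leq_maxr _ _).
  - have zz : z1 \notin D by apply: (zD g1); rewrite ?eqxx.
    split; split; try exact: Aw; try exact: clww; try (by move=> _; apply: A1).
    + by apply: clw => // _; apply: A1.
    + by apply: clw => // _; apply: A1.
  have s1 : bag' (maxn g1 g) z1 \subset U3 z1 (w 0) (w 1) (maxn g1 g) (d 0) (d 1).
    by rewrite /U3 -setUA subsetUl.
  apply: subA; rewrite ?e2 ?sub0set //.
    exact: subset_trans (bag'_mono _ (leq_maxl _ _)) s1.
  move=> y /cov; rewrite e2 p1 /= => /orP[/eqP->|].
    exact: subset_trans (bag'_mono _ (leq_maxr _ _)) s1.
  apply: (Dw _ 2) => [|i]; first by move: sizeD; rewrite e2 p1; lia.
  by case: i => [|[|]] // _; case: (U3_sup z1 (w 0) (w 1) (maxn g1 g) (d 0) (d 1)).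
exists z1, z2, (w 0), (maxn g1 g), (maxn g2 g), (d 0); split=> //.
- have zz1 : z1 \notin D by apply: (zD g1); rewrite ?eqxx.
  have zz2 : z2 \notin D by apply: (zD g2); rewrite ?eqxx ?orbT.
  split; split; try exact: Aw; try (by move=> _; apply: A1); try (by move=> _; apply: A2).
  + by move=> _ _; apply: c12.
  + by apply: clw => // _; apply: A1.
  + by apply: clw => // _; apply: A2.
have s1 : bag' (maxn g1 g) z1 \subset U3 z1 z2 (w 0) (maxn g1 g) (maxn g2 g) (d 0).
  by rewrite /U3 -setUA subsetUl.
have s2 : bag' (maxn g2 g) z2 \subset U3 z1 z2 (w 0) (maxn g1 g) (maxn g2 g) (d 0).
  by rewrite /U3 -setUA setUCA subsetUl.
apply: subA.
- exact: subset_trans (bag'_mono _ (leq_maxl _ _)) s1.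
- exact: subset_trans (bag'_mono _ (leq_maxl _ _)) s2.
move=> y /cov; rewrite p1 p2 /= => /or3P[/eqP->|/eqP->|].
- exact: subset_trans (bag'_mono _ (leq_maxr _ _)) s1.
- exact: subset_trans (bag'_mono _ (leq_maxr _ _)) s2.
apply: (Dw _ 1) => [|i]; first by move: sizeD; rewrite p2 p1; lia.
by case: i => [|] // _; rewrite /U3 subsetUr.
Qed.

(** The active centre of largest index is moved to the third place; since [A] decreases indices,
    being related to it then means being one of its lower neighbours. *)
Lemma U3_card n (z1 z2 z3 : 'I_T) g1 g2 g3 : (0 < g1 -> z1 < n) -> (0 < g2 -> z2 < n) -> (0 < g3 -> z3 < n) ->
  cl z1 z2 g1 g2 -> cl z1 z3 g1 g3 -> cl z2 z3 g2 g3 -> #|U3 z1 z2 z3 g1 g2 g3| <= pot g1 g2 g3.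
Proof.
elim: n z1 z2 z3 g1 g2 g3 => [|n IH] z1 z2 z3 g1 g2 g3 n1 n2 n3 c12 c13 c23.
  move: n1 n2 n3; case: (g1) => [|a] h1; last by have := h1 isT.
  case: (g2) => [|b] h2; last by have := h2 isT.
  case: (g3) => [|c] h3; last by have := h3 isT.
  by rewrite /U3 /= !setU0 cards0.
have step : forall (z1 z2 z3 : 'I_T) g1 g2 g3, (0 < g1 -> z1 < n.+1) -> (0 < g2 -> z2 < n.+1) -> (0 < g3 -> z3 < n.+1) ->
    cl z1 z2 g1 g2 -> cl z1 z3 g1 g3 -> cl z2 z3 g2 g3 -> 0 < g3 -> (0 < g1 -> z1 <= z3) -> (0 < g2 -> z2 <= z3) ->
    #|U3 z1 z2 z3 g1 g2 g3| <= pot g1 g2 g3.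
  move=> {z1 z2 z3 g1 g2 g3 n1 n2 n3 c12 c13 c23} z1 z2 z3 g1 g2 [//|g] n1 n2 n3 c12 c13 c23 _ l1 l2.
  apply: (bag_elim IH) => //; first exact: n3.
    by move=> p; case/orP: (c13 p isT) => // /Alt; rewrite ltnNge l1.
  by move=> p; case/orP: (c23 p isT) => // /Alt; rewrite ltnNge l2.
have U12 a b c x y z : U3 a b c x y z = U3 b a c y x z by rewrite /U3 (setUC (bag' x a)).
have U23 a b c x y z : U3 a b c x y z = U3 a c b x z y by rewrite /U3 setUAC.
have [i3|i3] := boolP [&& 0 < g3, (0 < g1) ==> (z1 <= z3) & (0 < g2) ==> (z2 <= z3)].
  by case/and3P: i3 => p /implyP a /implyP b; apply: step.
have [i2|i2] := boolP [&& 0 < g2, (0 < g1) ==> (z1 <= z2) & (0 < g3) ==> (z3 <= z2)].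
  case/and3P: i2 => p /implyP a /implyP b; rewrite U23 potC23; apply: step => //; exact: cl_sym.
have [i1|i1] := boolP [&& 0 < g1, (0 < g2) ==> (z2 <= z1) & (0 < g3) ==> (z3 <= z1)].
  case/and3P: i1 => p /implyP a /implyP b; rewrite U12 potC12 U23 potC23; apply: step => //; exact: cl_sym.
have [e1 e2 e3] : [/\ g1 = 0, g2 = 0 & g3 = 0].
  clear -i1 i2 i3; move: i1 i2 i3; case: (posnP g1) (posnP g2) (posnP g3) => [->|p1] [->|p2] [->|p3] //=; lia.
by rewrite /U3 e1 e2 e3 /= !setU0 cards0.
Qed.

(** This is the known bound for weak colouring numbers in treewidth three; a single bag is a triple
    with two empty members. *)
Lemma bag_card s j : #|bag s j| <= 'C(s + 3, 3).
Proof.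
have -> : bag s j = U3 j j j s.+1 0 0 by rewrite /U3 /= !setU0.
apply: leq_trans (@U3_card T j j j s.+1 0 0 _ _ _ _ _ _) _ => //.
by rewrite pot_sorted // addn0 addn3 /= addn0.
Qed.

End Bags.

Section Tree.
Variables (T : nat) (A : rel 'I_T.+1) (s : nat).
Hypothesis Alt : forall j y, A j y -> y < j.
Hypothesis Acard : forall j, #|[set y | A j y]| <= 3.
Hypothesis Aclique : forall j y y', A j y -> A j y' -> y' < y -> A y y'.
Hypothesis Ane : forall j : 'I_T.+1, 0 < j -> exists y, A j y.

Lemma par_ex (j : 'I_T.+1) : exists y : 'I_T.+1, (0 < j) ==> (A j y && [forall y', A j y' ==> (y' <= y)]).
Proof.
case: (posnP j) => [_|/Ane[y0 Ay0]]; first by exists ord0.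
by case: (arg_maxnP val Ay0) => y Ay my; exists y; rewrite Ay; apply/forallP => y'; apply/implyP/my.
Qed.
Definition par j := xchoose (par_ex j).
Lemma parA (j : 'I_T.+1) : 0 < j -> A j (par j).
Proof. by move=> h; have /implyP/(_ h)/andP[] := xchooseP (par_ex j). Qed.
Lemma parM j y : A j y -> y <= par j.
Proof.
move=> Ay; have h : 0 < j by apply: leq_ltn_trans (Alt Ay).
by have /implyP/(_ h)/andP[_ /forallP/(_ y)/implyP] := xchooseP (par_ex j); apply.
Qed.

Definition tree_rel : rel 'I_T.+1 := fun i j => ((0 < j) && (par j == i)) || ((0 < i) && (par i == j)).
Definition bag_rel : rel 'I_T.+1 := fun a b => (a != b) && [exists j, (a \in bag A s j) && (b \in bag A s j)].

Lemma tree_sym : symmetric tree_rel. Proof. by move=> i j; rewrite /tree_rel orbC. Qed.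

(** The other neighbours of [j] are neighbours of its largest one, the parent, by [Aclique].
    Membership of [w] thus climbs to [w] itself, so the bags containing [w] form a subtree. *)
Lemma bag_par w (j : 'I_T.+1) : w \in bag A s j -> w != j -> (0 < j) && (w \in bag A s (par j)).
Proof.
case: s => [|i] /=; first by rewrite inE => ->.
rewrite inE => /orP[/set1P->|/bigcupP[y Ay wy] _]; first by rewrite eqxx.
have j0 : 0 < j by apply: leq_ltn_trans (Alt Ay).
rewrite j0 /=; case: (ltngtP y (par j)) (parM Ay) => // [yp|/val_inj <-] _.
  by rewrite inE; apply/orP; right; apply/bigcupP; exists y => //; apply: (Aclique (parA j0) Ay yp).
exact: (subsetP (bag_mono A y (leqnSn i))).
Qed.

Lemma bag_connect w (j : 'I_T.+1) : w \in bag A s j ->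
  connect [rel a b | [&& tree_rel a b, w \in bag A s a & w \in bag A s b]] j w.
Proof.
have [n jn] := ubnP (val j); elim: n j jn => // n IH j jn wj.
case: (eqVneq w j) => [->|wNj]; first exact: connect0.
have /andP[j0 wp] := bag_par wj wNj.
apply: connect_trans (connect1 _) (IH (par j) _ wp).
  by rewrite /= wj wp /tree_rel j0 eqxx orbT.
have := Alt (parA j0); move: jn; rewrite /= ltnS => a b; exact: leq_trans b a.
Qed.

Lemma tree_isTree : is_tree tree_rel.
Proof.
have plt (j : 'I_T.+1) : 0 < j -> par j < j by move/parA/Alt.
split; first split; first exact: tree_sym.
  by move=> i; rewrite /tree_rel orbb; case: posnP => //= /plt; apply: contraTF => /eqP->; rewrite ltnn.
split; first by exists ord0.
have c0 (j : 'I_T.+1) : connect tree_rel j ord0.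
  have [n jn] := ubnP (val j); elim: n j jn => // n IH j jn.
  case: (posnP j) => [j0|j0]; first by rewrite (_ : j = ord0); [exact: connect0 | exact: val_inj].
  apply: connect_trans (connect1 _) (IH (par j) _); first by rewrite /tree_rel j0 eqxx orbT.
  by move: jn (plt _ j0); rewrite ltnS => a b; exact: leq_trans b a.
split.
  by move=> i j; apply: connect_trans (c0 i) _; rewrite (sym_connect_sym tree_sym).
rewrite card_ord subn1 /=.
(* Every non-root node contributes its parent edge in both orientations. *)
pose F (p : bool * 'I_T) := if p.1 then (lift ord0 p.2, par (lift ord0 p.2)) else (par (lift ord0 p.2), lift ord0 p.2).
have ltF (i : 'I_T) : par (lift ord0 i) < lift ord0 i by apply: plt.
rewrite (_ : [set p | _] = F @: setT).
  rewrite card_imset ?cardsT ?card_prod ?card_bool ?card_ord ?mul2n // => -[[] i] [[] j] e;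
    have e1 := congr1 fst e; have e2 := congr1 snd e; rewrite /F /= in e1 e2.
  - by rewrite (lift_inj e1).
  - by have := ltF i; have := ltF j; rewrite -e1 e2 ltnNge => /negbTE/= H /ltnW; rewrite H.
  - by have := ltF i; have := ltF j; rewrite e1 -e2 ltnNge => /negbTE/= H /ltnW; rewrite H.
  - by rewrite (lift_inj e2).
apply/setP => -[i j]; rewrite inE /=; apply/idP/imsetP.
  case/orP=> /andP[h0 /eqP e].
    case: (unliftP ord0 j) h0 e => [j' ->|->] // _ e; by exists (false, j'); rewrite // /F /= e.
  case: (unliftP ord0 i) h0 e => [j' ->|->] // _ e; by exists (true, j'); rewrite // /F /= e.
by case=> -[[] k] _ [-> ->]; rewrite /tree_rel /= eqxx ?orbT.
Qed.

Lemma bag_tw : tw_le bag_rel ('C(s + 3, 3) - 1).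
Proof.
exists 'I_T.+1, tree_rel, (bag A s); split; last first.
  move=> i; apply: leq_trans (bag_card Alt Acard Aclique s i) _.
  by rewrite subn1; apply: leqSpred.
split; first exact: tree_isTree.
split; first by move=> w; exists w; case: (s) => [|i]; rewrite /= !inE eqxx.
split; first by move=> w w' /andP[_ /existsP].
move=> w i j /bag_connect wi /bag_connect wj; apply: connect_trans wi _.
by rewrite sym_connect_sym // => a b /=; rewrite tree_sym (andbC (w \in bag A s a)).
Qed.

Lemma bag_rel_graph : is_graph bag_rel.
Proof.
split; last by move=> i; rewrite /bag_rel eqxx.
move=> i j; rewrite /bag_rel eq_sym; congr (_ && _).
by apply: eq_existsb => k; rewrite andbC.
Qed.
End Tree.

(** The complete factor is moved next to the bounded treewidth factor: replacing each vertex by [m]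
    clones keeps the tree and multiplies bag sizes by [m]. *)
Lemma row_tw_of_product (V : finType) (E : rel V) (W : finType) (EW : rel W) p m t :
  0 < m -> is_graph EW -> tw_le EW t ->
  contained E (strong (strong EW (path_rel p)) (complete_rel m)) ->
  row_tw_le E (t.+1 * m - 1).
Proof.
move=> m0 [sW iW] [I [T [bg [[TT [cv [ed cn]]] sz]]]] [f [fi fe]].
have sK : symmetric (complete_rel m) by move=> i j; rewrite /complete_rel eq_sym.
exists (W * 'I_m)%type, (strong EW (complete_rel m)), p; split; [|split].
- split=> [[a b] [c d]|[a b]]; last by rewrite /strong eqxx.
  by rewrite /strong /= !(eq_sym c) (eq_sym d) sW sK (eq_sym (c, d)).
- exists I, T, (fun i => setX (bg i) setT); split; last first.
    by move=> i; rewrite cardsX cardsT card_ord; move: (leq_mul (sz i) (leqnn m)); lia.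
  split=> //; split; last split.
  + by case=> w a; have [i wi] := cv w; exists i; rewrite !inE wi.
  + case=> [w a] [w' a'] /and3P[_ /= h _]; case/orP: h => [/eqP->|/ed[i]].
      by have [i wi] := cv w'; exists i; rewrite !inE wi.
    by case/andP=> h1 h2; exists i; rewrite !inE h1 h2.
  + case=> w a i j; rewrite !inE !andbT => wi wj; have := cn w i j wi wj.
    by apply: connect_sub => x y /and3P[Txy hx hy]; apply: connect1; rewrite /= Txy !inE hx hy.
- exists (fun v => ((f v).1.1, (f v).2, (f v).1.2)); split.
    move=> u v [h1 h2 h3]; apply: fi; move: h1 h2 h3.
    by case: (f u) (f v) => [[a b] c] [[a' b'] c'] /= -> -> ->.
  move=> u v /fe; case: (f u) (f v) => [[a b] c] [[a' b'] c'] /=.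
  rewrite /strong /= /complete_rel -!pair_eqE /pair_eq /= => /and3P[h1 h2 h3].
  apply/and3P; split; last 1 first.
  + by case/orP: h2 => [/andP[_ ->]|/and3P[]] //; rewrite orbT.
  + by apply: contra h1 => /andP[/eqP[-> ->] /eqP ->]; rewrite !eqxx.
  + apply/orP; case: (eqVneq (a, c) (a', c')) => [e|ne]; [by left; case: e => -> ->; rewrite !eqxx|right].
    apply/and3P; split.
    * by move: ne; rewrite -pair_eqE.
    * have ha : (a == a') || EW a a'; [by case/orP: h2 => [/andP[-> _]|/and3P[_ -> _]] | exact: ha].
    * by rewrite orbN.
Qed.

(** * Connected sets of nodes *)

Section Conn.
Variables (N : finType) (adj : rel N).
Hypothesis adj_sym : symmetric adj.
Definition conn (K : {set N}) := forall x y, x \in K -> y \in K -> connect (within adj (fun n => n \in K)) x y.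

Lemma within_csym Q : connect_sym (within adj Q).
Proof. by apply: sym_connect_sym => x y; rewrite /within /= adj_sym; congr (_ && _); rewrite andbC. Qed.
Lemma within_sub (Q Q' : pred N) x y : (forall n, Q n -> Q' n) -> connect (within adj Q) x y -> connect (within adj Q') x y.
Proof.
move=> QQ; apply: connect_sub => a b /and3P[ab Qa Qb]; apply: connect1.
by rewrite /within /= ab !QQ.
Qed.
Lemma within_in (Q : pred N) x n : connect (within adj Q) x n -> Q x -> Q n.
Proof.
case/connectP => p; elim: p x => [|z p IH] x /=; first by move=> _ ->.
by case/andP=> /and3P[_ _ Qz] pz ln _; apply: (IH z).
Qed.

Lemma conn0 : conn set0. Proof. by move=> x y; rewrite inE. Qed.
Lemma conn_star (K : {set N}) h : (forall x, x \in K -> connect (within adj (fun n => n \in K)) h x) -> conn K.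
Proof. by move=> H x y /H hx /H hy; apply: connect_trans hy; rewrite within_csym. Qed.
Lemma connU (K1 K2 : {set N}) a b : conn K1 -> conn K2 -> a \in K1 -> b \in K2 -> (a == b) || adj a b -> conn (K1 :|: K2).
Proof.
move=> c1 c2 a1 b2 ab; apply: (@conn_star _ a) => x; rewrite inE => /orP[x1|x2].
  by apply: within_sub (c1 _ _ a1 x1) => n n1; rewrite inE n1.
have ab' : connect (within adj (fun n => n \in K1 :|: K2)) a b.
  case/orP: ab => [/eqP->|ab]; first exact: connect0.
  by apply: connect1; rewrite /within /= ab !inE a1 b2 orbT.
apply: connect_trans ab' _.
by apply: within_sub (c2 _ _ b2 x2) => n n1; rewrite inE n1 orbT.
Qed.
Lemma conn_bigU (I : finType) (P : pred I) (K : {set N}) (F : I -> {set N}) :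
  conn K -> (forall i, P i -> conn (F i) /\ exists a b, [/\ a \in K, b \in F i & (a == b) || adj a b]) ->
  conn (K :|: \bigcup_(i | P i) F i).
Proof.
move=> cK H; case: (set_0Vmem K) => [K0|[x0 x0K]].
  rewrite big1 ?setU0 // => i /H[_ [a [b []]]]; by rewrite K0 inE.
apply: (@conn_star _ x0) => x; rewrite inE => /orP[xK|/bigcupP[i Pi xi]].
  by apply: within_sub (cK _ _ x0K xK) => n nK; rewrite inE nK.
have [cF [a [b [aK bF ab]]]] := H i Pi.
apply: within_sub (connU cK cF aK bF ab (_ : x0 \in _) (_ : x \in _)); rewrite ?inE ?x0K ?xi ?orbT //.
move=> n; rewrite !inE => /orP[->//|nF]; apply/orP; right; apply/bigcupP; by exists i.
Qed.
Lemma conn_path x p : path adj x p -> conn [set n in x :: p].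
Proof.
move=> pp; apply: (@conn_star _ x) => y; rewrite inE.
elim: p x pp => [|z p IH] x /=; first by move=> _; rewrite inE => /eqP->; exact: connect0.
move=> /andP[xz pz]; rewrite inE => /orP[/eqP->|h]; first exact: connect0.
apply: connect_trans (connect1 _) (within_sub _ (IH z pz h)).
  by rewrite /within /= xz !inE !eqxx orbT.
by move=> n; rewrite !inE => ->; rewrite orbT.
Qed.
Lemma connU1 (K : {set N}) a b : conn K -> b \in K -> adj a b -> conn (a |: K).
Proof.
move=> cK bK ab; apply: (@connU _ _ a b) => //; rewrite ?set11 ?ab ?orbT //.
by move=> x y; rewrite !inE => /eqP-> /eqP->; exact: connect0.
Qed.

(* Contract the rest of [C] after removing a component [C'] of [C :\: X]
   together with the classes that [C'] does not see. *)
Lemma model_step f (C C' X : {set N}) e (A := fun y => [exists n, exists n', [&& n \in C', n' \notin C, adj n n' & f n' == y]]) :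
  minor_model adj f -> (forall n, (n \in C) = (f n == e)) -> C' \subset C :\: X -> X \subset C -> X != set0 -> C' != set0 ->
  conn X -> conn C' -> conn C ->
  (forall n n', n \in C' -> adj n n' -> n' \in C -> n' \notin X -> n' \in C') ->
  (forall n n', n \in C -> n' \notin C -> adj n n' -> f n' < e) ->
  (forall n n', n \in C -> n' \notin C -> adj n n' -> exists m m', [/\ m \in X, m' \notin C, adj m m' & f m' = f n']) ->
  minor_model adj (fun n => if n \in C' then e.+1 else if n \in C then e else if A (f n) then f n else e).
Proof.
move=> [fc fa] fC CC XC X0 C'0 cX cC' cC C'max lowlab touch; set f' := (fun n => _).
have C'C n : n \in C' -> n \in C by move/(subsetP CC); rewrite inE => /andP[].
have C'X n : n \in C' -> n \notin X by move/(subsetP CC); rewrite inE => /andP[].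
have XCn n : n \in X -> n \in C by apply: (subsetP XC).
have XC' n : n \in X -> n \notin C' by move=> nX; apply: contraTN nX; exact: C'X.
have AL y : A y -> y < e.
  by move=> /existsP[n /existsP[n' /and4P[nC' n'C nn' /eqP <-]]]; apply: lowlab n'C nn'; exact: C'C.
have [xX xXX] := set0Pn _ X0; have [z0 z0C'] := set0Pn _ C'0.
pose R := [set n | f' n == e].
(* A walk inside [C] that starts outside [C'] cannot enter [C'] before meeting [X], as [C'] is a
   component of the rest. An unseen class touches [C] by completeness, necessarily at a node outside
   [C']. *)
have cR : conn R.
  have inR n : n \in X -> n \in R by move=> nX; rewrite inE /f' (negbTE (XC' _ nX)) (XCn _ nX).
  have CR n : n \in C -> n \notin C' -> n \in R by move=> nC nC'; rewrite inE /f' (negbTE nC') nC.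
  have c1 n : n \in C -> n \notin C' -> connect (within adj (fun n => n \in R)) xX n.
    move=> nC nC'; have /connectP[p] := cC _ _ nC (XCn _ xXX).
    elim: p n nC nC' => [|m p IH] n nC nC' /=; first by move=> _ <-; exact: connect0.
    case/andP=> /and3P[nm _ mC] pm lm.
    case: (boolP (n \in X)) => nX.
      by apply: within_sub (cX _ _ xXX nX) => a /inR.
    have mC' : m \notin C'.
      by apply: contra nC' => mC'; apply: C'max mC' _ nC nX; rewrite adj_sym.
    apply: connect_trans (IH m mC mC' pm lm) (connect1 _).
    by rewrite /within /= adj_sym nm (CR _ mC mC') (CR _ nC nC').
  apply: (@conn_star _ xX) => n nR; case: (boolP (n \in C)) => nC.
    by apply: c1 => //; apply: contraTN nR => nC'; rewrite inE /f' nC' eqn_leq ltnn.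
  have nA : ~~ A (f n).
    apply: contraTN nR => nA; rewrite inE /f' (negbTE (contra (@C'C n) nC)) (negbTE nC) nA.
    by rewrite neq_ltn AL.
  have ne : f n != f xX.
    by have := XCn _ xXX; rewrite fC => /eqP->; rewrite -fC.
  have [a [b [fa' fb ab]]] := fa _ _ ne.
  have bC : b \in C by rewrite fC fb -fC XCn.
  have aC : a \notin C by rewrite fC fa' -fC.
  have bC' : b \notin C'.
    apply: contra nA => bC'; apply/existsP; exists b; apply/existsP; exists a.
    by rewrite bC' aC adj_sym ab fa' eqxx.
  have cls m : f m = f n -> m \in R.
    move=> fm; have mC : m \notin C by rewrite fC fm -fC.
    by rewrite inE /f' (negbTE (contra (@C'C m) mC)) (negbTE mC) fm (negbTE nA).
  apply: connect_trans (c1 b bC bC') _.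
  apply: connect_trans (connect1 _) (within_sub _ (fc a n fa')).
    by rewrite /within /= adj_sym ab (CR _ bC bC') (cls a fa').
  by move=> m /eqP fm; apply: cls; rewrite fm.
have f'V n : [\/ n \in C' /\ f' n = e.+1, n \in R /\ f' n = e | [/\ n \notin C, A (f n) & f' n = f n]].
  have RE : (n \in R) = (f' n == e) by rewrite inE.
  case: (boolP (n \in C')) => nC'; first by constructor 1; rewrite /f' nC'.
  case: (boolP (n \in C)) => nC; first by constructor 2; rewrite RE /f' (negbTE nC') nC eqxx.
  case: (boolP (A (f n))) => nA; last by constructor 2; rewrite RE /f' (negbTE nC') (negbTE nC) (negbTE nA) eqxx.
  by constructor 3; rewrite /f' (negbTE nC') (negbTE nC) nA.
have Acls n m : n \notin C -> A (f n) -> f m = f n -> f' m = f n.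
  move=> nC An fm; have mC : m \notin C by rewrite fC fm -fC.
  by rewrite /f' (negbTE (contra (@C'C m) mC)) (negbTE mC) fm An.
split=> x y.
  case: (f'V x) => [[xC' ->]|[xR ->]|[xC Ax fx]] fxy.
  - apply: within_sub (cC' _ _ xC' _) => [n nC'|]; first by rewrite /f' nC'.
    case: (f'V y) => [[]|[yR fy]|[yC /AL Ay fy]] //; first by move: fxy; rewrite fy; clear; lia.
    by move: fxy Ay; rewrite fy; clear; lia.
  - apply: within_sub (cR _ _ xR _) => [n|]; rewrite inE => //.
    by rewrite -fxy.
  - rewrite fx in fxy *; have Lx := AL _ Ax.
    case: (f'V y) => [[_ fy]|[_ fy]|[yC Ay fy]]; [move: fxy Lx; rewrite fy; clear; lia | move: fxy Lx; rewrite fy; clear; lia|].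
    rewrite fy in fxy; apply: within_sub (fc _ _ fxy) => m /eqP fm.
    by rewrite (Acls x m) ?eqxx.
wlog lxy : x y / f' x < f' y.
  move=> H ne; case: (ltngtP (f' x) (f' y)) ne => // l ne; first by apply: H; rewrite // neq_ltn l.
  have [|a [b [h1 h2 h3]]] := H y x l; first by rewrite neq_ltn l.
  by exists b, a; split=> //; rewrite adj_sym.
move=> _.
(* The hypothesis on [X] enters here: since [X] still touches every class that [C] touched, the
   enlarged class [e] is adjacent to the kept classes. *)
have Aadj z n : n \notin C -> A (f n) -> f' z = e -> exists a b, [/\ f' a = f n, f' b = f' z & adj a b].
  move=> nC An ->; case/existsP: (An) => m /existsP[m' /and4P[mC' m'C mm' /eqP fm']].
  have [a [b [aX bC ab fb]]] := touch _ _ (C'C _ mC') m'C mm'.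
  exists b, a; rewrite (Acls n b nC An) ?fb // adj_sym ab; split=> //.
  by rewrite /f' (negbTE (XC' _ aX)) (XCn _ aX).
case: (f'V y) => [[yC' fy]|[yR fy]|[yC Ay fy]]; case: (f'V x) => [[xC' fx]|[xR fx]|[xC Ax fx]]; rewrite ?fx ?fy in lxy *;
  try (by move: lxy; rewrite ?ltnn //; clear; lia).
- have /connectP[p] := cC _ _ (C'C _ yC') (XCn _ xXX).
  elim: p y yC' {lxy fy} => [|m p IH] y yC' /=; first by move=> _ ey; have := XC' _ xXX; rewrite ey yC'.
  case/andP=> /and3P[ym _ mC] pm lm; case: (boolP (m \in C')) => mC'; first by apply: IH pm lm.
  by exists m, y; rewrite adj_sym ym /f' yC' (negbTE mC') mC.
- case/existsP: (Ax) => m /existsP[m' /and4P[mC' m'C mm' /eqP fm']].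
  by exists m', m; rewrite (Acls x m' xC Ax fm') adj_sym mm' /f' mC'.
- by have := Aadj y x xC Ax fy; rewrite fy.
- by move: lxy (AL _ Ay); clear; lia.
- by move: lxy (AL _ Ay); clear; lia.
- have [|a [b [fa' fb ab]]] := fa x y; first by rewrite neq_ltn lxy.
  by exists a, b; rewrite (Acls x a) ?(Acls y b).
Qed.
End Conn.

Lemma card_inj_rel (I A : finType) (D : {set I}) (X : {set A}) (R : I -> A -> bool) :
  (forall e, e \in D -> exists2 a, a \in X & R e a) ->
  (forall e e' a, e \in D -> e' \in D -> R e a -> R e' a -> e = e') -> #|D| <= #|X|.
Proof.
move=> ex inj; case: (set_0Vmem X) => [X0|[a0 _]].
  case: (set_0Vmem D) => [->|[e /ex[a]]]; first by rewrite cards0.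
  by rewrite X0 inE.
pose f e := odflt a0 [pick a in X | R e a].
have fP e : e \in D -> (f e \in X) && R e (f e).
  by move/ex => [a aX Ra]; rewrite /f; case: pickP => [a' //|/(_ a)]; rewrite aX Ra.
have fi : {in D &, injective f}.
  by move=> e e' eD eD' ff; have /andP[_ h] := fP _ eD; have /andP[_] := fP _ eD'; rewrite -ff => h'; apply: (inj _ _ (f e)).
rewrite -(card_in_imset fi); apply/subset_leq_card/subsetP => _ /imsetP[e eD ->].
by have /andP[] := fP _ eD.
Qed.

(** * Bundles and consumption times *)

Section System.
Variables (N V B : finType) (adj : rel N) (hub : V -> N) (orig : B -> V) (bof : V -> B) (tl : B -> seq N).
Definition bundle_nodes b := hub (orig b) :: tl b.
Definition term b := last (hub (orig b)) (tl b).
Definition crossing b b' := (b' != b) && [exists n, [&& n \in bundle_nodes b, n \in bundle_nodes b' & ~~ ((orig b == orig b') && (n == hub (orig b)))]].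
Definition star v : pred N := fun n => [exists b, (orig b == v) && (n \in bundle_nodes b)].

(* [c n] is the round consuming the node [n]; at time [e] the nodes with
   [e <= c n] are still alive. *)
Section State.
Variable c : N -> nat.
Definition alive e : pred N := fun n => e <= c n.
(** Liveness is required of the whole stretch from [n] to the terminal: a live node behind a
    consumed one belongs to a gap and is not in the live tail. *)
Definition live_suf e b n := (n \in bundle_nodes b) && all (alive e) (drop (index n (bundle_nodes b)) (bundle_nodes b)).
Definition live_pre e b n := (n \in bundle_nodes b) && all (alive e) (take (index n (bundle_nodes b)).+1 (bundle_nodes b)).
Definition all_live e b := all (alive e) (bundle_nodes b).
Definition xs v := c [arg min_(n < hub v | star v n) c n].
Definition anc v := odflt (bof v) [pick b | (orig b == v) && has (fun n => c n == xs v) (bundle_nodes b)].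
Definition is_anchor e b := (anc (orig b) == b) && (xs (orig b) < e).

(* Round [e] consumes the bundles of [W] entirely, the live tails of those of [S]
   and the live heads of those of [P]; the tails in [FS] are the feet of the legs.
   Heads matter only for anchors, through which the round of a vertex is reached. *)
Record uses e (W S P FS : {set B}) : Prop := Uses {
  usW : forall b, b \in W -> all (fun n => c n == e) (bundle_nodes b);
  usS : forall b, b \in S -> [/\ ~~ all_live e b, alive e (term b) & forall n, live_suf e b n -> c n = e];
  usP : forall b, b \in P -> [/\ is_anchor e b, alive e (hub (orig b)) & forall n, live_pre e b n -> c n = e];
  us_hit : forall b n, c n = e -> (live_suf e b n && (xs (orig b) < e)) || (live_pre e b n && is_anchor e b) ->
    exists a, [|| (a \in W) && (n \in bundle_nodes a), (a \in S) && live_suf e a n | (a \in P) && live_pre e a n];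
  us_foot : forall a g n, a \in FS -> is_anchor e g -> live_suf e a n -> live_pre e g n -> g \in P;
  us_conn : forall a, a \in S -> is_anchor e a -> (a \in FS) || (a \in P);
  us_both : forall a b m n, is_anchor e a -> a \in S :|: P -> ~~ all_live e b -> ~~ is_anchor e b ->
    live_suf e a m -> live_suf e b m -> live_pre e a n -> live_suf e b n -> (a \in S) && (a \in P) }.
End State.

Hypothesis pathP : forall b, path adj (hub (orig b)) (tl b).
Hypothesis pb_uniq : forall b, uniq (bundle_nodes b).
Hypothesis bofP : forall v, orig (bof v) = v.
Hypothesis adj_sym : symmetric adj.

Lemma hub_pb b : hub (orig b) \in bundle_nodes b. Proof. exact: mem_head. Qed.
Lemma term_pb b : term b \in bundle_nodes b. Proof. exact: mem_last. Qed.
Lemma star_hub v : star v (hub v).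
Proof. by apply/existsP; exists (bof v); rewrite bofP eqxx -{1}(bofP v) hub_pb. Qed.
Lemma star_pb b n : n \in bundle_nodes b -> star (orig b) n.
Proof. by move=> nb; apply/existsP; exists b; rewrite eqxx. Qed.

Section Pieces.
Variable c : N -> nat.

Lemma xs_le v n : star v n -> xs c v <= c n.
Proof. by rewrite /xs; case: arg_minnP => [|i si mi]; [exact: star_hub | exact: mi]. Qed.
Lemma xs_ex v : exists2 n, star v n & c n = xs c v.
Proof. by rewrite /xs; case: arg_minnP => [|i si mi]; [exact: star_hub | exists i]. Qed.
Lemma ancP v : orig (anc c v) = v /\ exists2 n, n \in bundle_nodes (anc c v) & c n = xs c v.
Proof.
rewrite /anc; case: pickP => [b /andP[/eqP -> /hasP[n nb /eqP e]]|no] /=; first by split=> //; exists n.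
have [n /existsP[b /andP[/eqP ob nb]] e] := xs_ex v.
by have := no b; rewrite ob eqxx andTb => /negbT/hasPn/(_ n nb); rewrite e eqxx.
Qed.

Lemma suf_pb e b n : live_suf c e b n -> n \in bundle_nodes b. Proof. by case/andP. Qed.
Lemma pre_pb e b n : live_pre c e b n -> n \in bundle_nodes b. Proof. by case/andP. Qed.
Lemma suf_U e b n : live_suf c e b n -> alive c e n.
Proof. by case/andP=> nb; rewrite (drop_nth n) ?index_mem // nth_index //= => /andP[]. Qed.
Lemma pre_U e b n : live_pre c e b n -> alive c e n.
Proof.
case/andP=> nb; rewrite (take_nth n) ?index_mem // nth_index // all_rcons => /andP[]//.
Qed.
Lemma pre_hub e b n : live_pre c e b n -> live_pre c e b (hub (orig b)).
Proof. by rewrite /live_pre hub_pb => /andP[_] /=; rewrite eqxx take0 /= andbT => /andP[]. Qed.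
Lemma suf_term e b n : live_suf c e b n -> live_suf c e b (term b).
Proof.
case/andP=> nb; rewrite /live_suf term_pb (_ : index (term b) (bundle_nodes b) = size (tl b)).
  move=> h; apply/allP => m md; apply: (allP h).
  have le : index n (bundle_nodes b) <= size (tl b) by move: nb; rewrite -index_mem /= ltnS.
  by move: md; rewrite -(subnK le) -drop_drop => /mem_drop.
by rewrite /term (last_nth (hub (orig b))) -[nth _ _ _]/(nth (hub (orig b)) (bundle_nodes b) (size (tl b))) index_uniq ?pb_uniq /=.
Qed.
Lemma suf_mono e e' b n : e <= e' -> live_suf c e' b n -> live_suf c e b n.
Proof. by move=> ee /andP[nb h]; rewrite /live_suf nb; apply: sub_all h => m; apply: leq_trans. Qed.
Lemma pre_mono e e' b n : e <= e' -> live_pre c e' b n -> live_pre c e b n.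
Proof. by move=> ee /andP[nb h]; rewrite /live_pre nb; apply: sub_all h => m; apply: leq_trans. Qed.
Lemma suf_pre_whole e b n : live_suf c e b n -> live_pre c e b n -> all_live c e b.
Proof.
case/andP=> _ h1 /andP[nb h2]; rewrite /all_live -(cat_take_drop (index n (bundle_nodes b)) (bundle_nodes b)) all_cat h1 andbT.
by move: h2; rewrite (take_nth n) ?index_mem // all_rcons => /andP[].
Qed.
Lemma suf_hub_whole e b : live_suf c e b (hub (orig b)) -> all_live c e b.
Proof. by rewrite /live_suf /= eqxx => /andP[]. Qed.
Lemma cut_owned e b : ~~ all_live c e b -> xs c (orig b) < e.
Proof.
case/allPn => n nb; rewrite /alive -ltnNge; apply: leq_ltn_trans.
exact: xs_le (star_pb nb).
Qed.
End Pieces.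

(** * Counting the rounds met along an edge *)

Section Static.
Variables (T : nat) (c : N -> 'I_T.+1) (W S P FS : 'I_T.+1 -> {set B}) (k : nat).
Let c' : N -> nat := fun n => val (c n).
Hypothesis us : forall e : 'I_T.+1, uses c' e (W e) (S e) (P e) (FS e).
Hypothesis crossk : forall b, #|[set b' | crossing b b']| <= k.

Definition used e a n := [|| (a \in W e) && (n \in bundle_nodes a), (a \in S e) && live_suf c' e a n | (a \in P e) && live_pre c' e a n].
(* The rounds hitting the live tail of [b], resp. the live head of [g]. *)
Definition Tt b := [set e : 'I_T.+1 | [exists n, live_suf c' e b n && (c n == e)]].
Definition To g := [set e : 'I_T.+1 | [exists n, [&& live_pre c' e g n, c n == e & e < c (hub (orig g))]]].

Lemma used_c e a n : used e a n -> c n = e.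
Proof.
move=> h; apply: val_inj; case/or3P: h => /andP[h1 h2].
- by have /allP/(_ n h2)/eqP := usW (us e) h1.
- by have [_ _] := usS (us e) h1; apply.
- by have [_ _] := usP (us e) h1; apply.
Qed.
Lemma used_pb e a n : used e a n -> n \in bundle_nodes a.
Proof. by case/or3P => /andP[_]; [|exact: suf_pb|exact: pre_pb]. Qed.

Lemma WW e e' a n : a \in W e -> used e' a n -> e = e'.
Proof.
move=> aW h; rewrite -(used_c h); apply: val_inj.
by have /allP/(_ n (used_pb h))/eqP := usW (us e) aW.
Qed.
(** The live tail contains the terminal, so the round taking the tail is the round of the
    terminal. *)
Lemma SS e e' a : a \in S e -> a \in S e' -> e = e'.
Proof.
have S1 d : a \in S d -> c (term a) = d.
  move=> h; have [_ Ut su] := usS (us d) h; apply: val_inj; apply: su.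
  rewrite /live_suf term_pb (_ : index (term a) (bundle_nodes a) = size (tl a)).
    by rewrite (drop_nth (hub (orig a))) //= drop_size /= andbT -last_nth.
  by rewrite /term (last_nth (hub (orig a))) -[nth _ _ _]/(nth (hub (orig a)) (bundle_nodes a) (size (tl a))) index_uniq ?pb_uniq /=.
by move=> /S1 <- /S1.
Qed.
Lemma Phub e a : a \in P e -> c (hub (orig a)) = e.
Proof.
move=> h; have [_ Uh pr] := usP (us e) h; apply: val_inj; apply: pr.
by rewrite /live_pre hub_pb /= eqxx take0 /= andbT.
Qed.
Lemma PP e e' a : a \in P e -> a \in P e' -> e = e'. Proof. by move=> /Phub <- /Phub. Qed.

Lemma S_anc e e' a : a \in S e -> a \in P e' -> is_anchor c' e a.
Proof.
move=> aS aP; have [cut _ _] := usS (us e) aS; rewrite /is_anchor (cut_owned cut) andbT.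
by have [/andP[]] := usP (us e') aP.
Qed.

(** A bundle serves two different rounds only by giving its tail to one and its head to the
    other. *)
Lemma used_split e e' a n n' : used e a n -> used e' a n' ->
  [\/ e = e', [/\ a \in S e, live_suf c' e a n, a \in P e' & live_pre c' e' a n'] |
      [/\ a \in P e, live_pre c' e a n, a \in S e' & live_suf c' e' a n']].
Proof.
move=> u1 u2; case/or3P: (u1) => /andP[h1 h2].
- by constructor 1; exact: WW u2.
- case/or3P: (u2) => /andP[h1' h2'].
  + by constructor 1; rewrite (WW h1' u1).
  + by constructor 1; apply: SS h1'.
  + by constructor 2.
- case/or3P: (u2) => /andP[h1' h2'].
  + by constructor 1; rewrite (WW h1' u1).
  + by constructor 3.
  + by constructor 1; apply: PP h1'.
Qed.

(* A cut non-anchor [b] meets the terminal part of [a] when [a] is in [S] and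
   its hub part when [a] is in [P]; the rule [us_both] makes these coincide. *)
Lemma both_once b a (e e' : 'I_T.+1) n n' : ~~ all_live c' e b -> ~~ all_live c' e' b -> anc c' (orig b) != b ->
  used e a n -> used e' a n' -> live_suf c' e b n -> live_suf c' e' b n' -> e = e'.
Proof.
move=> cut cut' nb u1 u2 s1 s2.
have na (d : 'I_T.+1) : ~~ is_anchor c' d b by rewrite /is_anchor (negbTE nb).
have key (d d' : 'I_T.+1) m m' : ~~ all_live c' d b -> d <= d' -> a \in S d -> live_suf c' d a m -> a \in P d' -> live_pre c' d' a m' ->
    live_suf c' d b m -> live_suf c' d' b m' -> d = d'.
  move=> cutd dd aS sm aP pm bm bm'; suff h : a \in P d by exact: PP h aP.
  have := us_both (us d) (S_anc aS aP) _ cutd (na d) sm bm (pre_mono dd pm) (suf_mono dd bm').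
  by rewrite inE aS => /(_ isT)/andP[].
have key' (d d' : 'I_T.+1) m m' : ~~ all_live c' d b -> d <= d' -> a \in P d -> live_pre c' d a m -> a \in S d' -> live_suf c' d' a m' ->
    live_suf c' d b m -> live_suf c' d' b m' -> d = d'.
  move=> cutd dd aP pm aS sm bm bm'; suff h : a \in S d by exact: SS h aS.
  have [ia _ _] := usP (us d) aP.
  have := us_both (us d) ia _ cutd (na d) (suf_mono dd sm) (suf_mono dd bm') pm bm.
  by rewrite inE aP orbT => /(_ isT)/andP[].
case: (used_split u1 u2) => // -[h1 h2 h3 h4]; case/orP: (leq_total e e') => ee.
- exact: (key _ _ n n').
- by apply/esym; apply: (key' _ _ n' n).
- exact: (key' _ _ n n').
- by apply/esym; apply: (key _ _ n' n).
Qed.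

(** A round that finds [b] intact and hits it has the least number occurring on [b]. *)
Lemma Tt_whole b : exists e0, forall e, e \in Tt b -> all_live c' e b -> e = e0.
Proof.
pose n0 := [arg min_(n < hub (orig b) | n \in bundle_nodes b) c n].
exists (c n0) => e; rewrite inE => /existsP[n /andP[sn /eqP <-]] /allP wh.
rewrite /n0; case: arg_minnP => [|m mb mmin]; first exact: hub_pb.
by have h := wh m mb; apply: val_inj; apply/eqP; rewrite eqn_leq; apply/andP; split; [exact: h | exact: (mmin n (suf_pb sn))].
Qed.
Lemma S_self b : exists e1, forall e, b \in S e -> e = e1.
Proof.
case: (pickP (fun e => b \in S e)) => [e1 h|no]; first by exists e1 => e /SS; apply.
by exists ord0 => e; rewrite no.
Qed.

(** The bundle given by [us_hit] is not [b], since [b] is cut and its tail is not taken. The common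
    node is not the hub either, as a live tail reaching the hub would make [b] intact. *)
Lemma Tt_used b e : e \in Tt b -> ~~ all_live c' e b -> b \notin S e -> exists a n,
  [/\ crossing b a, used e a n & live_suf c' e b n].
Proof.
rewrite inE => /existsP[n /andP[sn /eqP cn]] cut nS.
have [|a ua] := us_hit (us e) (b := b) (n := n) (congr1 val cn).
  by rewrite sn (cut_owned cut).
exists a, n; split=> //; apply/andP; split; last first.
  apply/existsP; exists n; rewrite (suf_pb sn) (used_pb ua) /=.
  by apply/negP => /andP[_ /eqP e1]; move: cut; rewrite e1 in sn; rewrite (suf_hub_whole sn).
apply/eqP => ab; subst a; case/or3P: ua => /andP[h1 h2]; last 2 first.
- by rewrite h1 in nS.
- by rewrite (suf_pre_whole sn h2) in cut.
case/negP: cut; apply/allP => m mb; have /allP/(_ m mb)/eqP := usW (us e) h1.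
by rewrite /alive => ->.
Qed.

(** By [both_once], distinct rounds are charged to distinct crossing bundles. Two rounds escape the
    charge: one hitting [b] while intact, one taking the tail of [b] itself. *)
Lemma Tt_nonanchor b : anc c' (orig b) != b -> #|Tt b| <= k + 2.
Proof.
move=> nb; have [e0 w0] := Tt_whole b; have [e1 s1] := S_self b.
have h : #|Tt b :\ e0 :\ e1| <= k.
  apply: leq_trans (crossk b).
  apply: (card_inj_rel (R := fun e a => [exists n, used e a n && live_suf c' e b n])).
    move=> e; rewrite !inE => /and3P[ne1 ne0 eT].
    have [|||a [n [h1 h2 h3]]] := @Tt_used b e.
    - by rewrite inE.
    - by apply: contra ne0 => /w0 ->; rewrite ?inE.
    - by apply: contra ne1 => /s1 ->.
    by exists a; rewrite ?inE //; apply/existsP; exists n; rewrite h2.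
  move=> e e' a; rewrite !inE => /and3P[_ ne0 eT] /and3P[_ ne0' eT'].
  move=> /existsP[n /andP[u1 sn]] /existsP[n' /andP[u2 sn']].
  apply: (both_once _ _ nb u1 u2) => //.
  - by apply: contra ne0 => /w0 ->; rewrite ?inE.
  - by apply: contra ne0' => /w0 ->; rewrite ?inE.
move: h; have := cardsD1 e0 (Tt b); have := cardsD1 e1 (Tt b :\ e0).
by do 2 case: (_ \in _) => /=; lia.
Qed.

(** For anchors [both_once] does not apply, so a crossing bundle may be charged once for its head
    and once otherwise; the boolean records which. *)
Lemma Tt_any b : #|Tt b| <= 2 * k + 2.
Proof.
have [e0 w0] := Tt_whole b; have [e1 s1] := S_self b.
have h : #|Tt b :\ e0 :\ e1| <= 2 * k.
  apply: leq_trans (_ : #|setX [set b' | crossing b b'] [set: bool]| <= _); last first.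
    by rewrite cardsX cardsT card_bool mulnC leq_mul2l crossk.
  apply: (card_inj_rel (R := fun e ab => if ab.2 then ab.1 \in P e else [exists n, used e ab.1 n] && (ab.1 \notin P e))).
    move=> e; rewrite !inE => /and3P[ne1 ne0 eT].
    have [|||a [n [h1 h2 h3]]] := @Tt_used b e.
    - by rewrite inE.
    - by apply: contra ne0 => /w0 ->; rewrite ?inE.
    - by apply: contra ne1 => /s1 ->.
    exists (a, a \in P e); rewrite ?inE /= ?h1 //; case: ifP => //= ->.
    by rewrite andbT; apply/existsP; exists n.
  move=> e e' [a [] /=] _ _; first exact: PP.
  move=> /andP[/existsP[n u1] p1] /andP[/existsP[n' u2] p2].
  by case: (used_split u1 u2) => // -[h1 h2 h3 h4]; [rewrite h3 in p2 | rewrite h1 in p1].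
move: h; have := cardsD1 e0 (Tt b); have := cardsD1 e1 (Tt b :\ e0).
by do 2 case: (_ \in _) => /=; lia.
Qed.

(** Apart from the round owning [v], the charge is again injective. A bundle shared by two rounds
    would be an anchor giving its tail to one of them, without being a foot there by [us_foot]; then
    [us_conn] puts its head into the same round. *)
Lemma To_anchor v : #|To (anc c' v)| <= k + 1.
Proof.
set g := anc c' v; have [ov [n0 n0g en0]] := ancP c' v; rewrite -/g in ov n0g.
have h : #|To g :\ c n0| <= k.
  apply: leq_trans (crossk g).
  have spec e : e \in To g :\ c n0 -> is_anchor c' e g /\ g \notin P e.
    rewrite !inE => /andP[ne /existsP[n /and3P[pn /eqP cn lt]]]; split; last first.
      by apply/negP => /Phub e1; rewrite e1 ltnn in lt.
    rewrite /is_anchor ov eqxx /= ltn_neqAle -en0.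
    have -> : c' n0 <= e by rewrite en0 -ov -cn; apply: (xs_le c'); apply: star_pb; apply: pre_pb pn.
    by rewrite andbT eq_sym -val_eqE in ne *.
  apply: (card_inj_rel (R := fun e a => [exists n, used e a n && live_pre c' e g n])).
    move=> e eT; have [ia nP] := spec e eT; move: eT; rewrite !inE => /andP[_ /existsP[n /and3P[pn /eqP cn lt]]].
    have [|a ua] := us_hit (us e) (b := g) (n := n) (congr1 val cn); first by rewrite pn ia orbT.
    exists a; last by apply/existsP; exists n; rewrite pn andbT.
    rewrite inE; apply/andP; split; last first.
      apply/existsP; exists n; rewrite (pre_pb pn) (used_pb ua) /=.
      by apply/negP => /andP[_ /eqP e1]; move: lt; rewrite -e1 cn ltnn.
    apply/eqP => ab; subst a; case/or3P: ua => /andP[h1 h2].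
    - by have /allP/(_ _ (hub_pb g))/eqP e1 := usW (us e) h1; rewrite -e1 ltnn in lt.
    - by have [] := usS (us e) h1; rewrite (suf_pre_whole h2 pn).
    - by rewrite h1 in nP.
  move=> e e' a eT eT' /existsP[n /andP[u1 pn]] /existsP[n' /andP[u2 pn']].
  have [ia nP] := spec e eT; have [ia' nP'] := spec e' eT'.
  have key (d : 'I_T.+1) m : is_anchor c' d g -> g \notin P d -> a \in S d -> live_suf c' d a m -> live_pre c' d g m ->
      is_anchor c' d a -> a \in P d.
    move=> iad nPd aS sm pm iaa; case/orP: (us_conn (us d) aS iaa) => // aF.
    by rewrite (us_foot (us d) aF iad sm pm) in nPd.
  case: (used_split u1 u2) => // -[h1 h2 h3 h4].
    by apply: PP (key e n ia nP h1 h2 pn (S_anc h1 h3)) h3.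
  by apply: PP h1 (key e' n' ia' nP' h3 h4 pn' (S_anc h3 h1)).
by move: h; have := cardsD1 (c n0) (To g); case: (_ \in _) => /=; lia.
Qed.

Hypothesis Xconn : forall x x', c x = c x' -> connect (within adj (alive c' (c x))) x x'.
Hypothesis Xsurj : forall j, exists x, c x = j.
Hypothesis adj_conn : forall x y, connect adj x y.

(** By [Xconn] the nodes of round [y] lie in one component of the nodes alive at time [y]; this is
    that component. *)
Definition inC (y : 'I_T.+1) n := [exists x, (c x == y) && connect (within adj (alive c' y)) x n].
Definition hop : rel 'I_T.+1 := fun j y => (y < j) && [exists n, exists n', [&& inC j n, adj n n' & c n' == y]].
Definition xo v := c [arg min_(n < hub v | star v n) c' n].

Lemma inC_U y n : inC y n -> alive c' y n.
Proof. by case/existsP=> x /andP[/eqP cx /within_in]; apply; rewrite /alive /c' cx. Qed.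
Lemma inC_connect y n n' : inC y n -> inC y n' -> connect (within adj (alive c' y)) n n'.
Proof.
case/existsP=> x /andP[/eqP cx xn] /existsP[x' /andP[/eqP cx' xn']].
apply: connect_trans (connect_trans _ xn'); first by rewrite (within_csym adj_sym); exact: xn.
by move: (@Xconn x x'); rewrite cx cx'; apply.
Qed.
Lemma inC_step (y : 'I_T.+1) n n' : inC y n -> adj n n' -> y <= c n' -> inC y n'.
Proof.
move=> h nn' yn'; have Un := inC_U h; case/existsP: h => x /andP[cx xn].
apply/existsP; exists x; rewrite cx; apply: connect_trans xn (connect1 _).
by rewrite /within /= nn' Un.
Qed.
Lemma inC_self n : inC (c n) n.
Proof. by apply/existsP; exists n; rewrite eqxx connect0. Qed.
Lemma inC_mono (y y' : 'I_T.+1) n n' : y <= y' -> inC y n -> connect (within adj (alive c' y')) n n' -> inC y n'.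
Proof.
move=> yy /existsP[x /andP[cx xn]] h; apply/existsP; exists x; rewrite cx; apply: connect_trans xn _.
apply: connect_sub h => a b /and3P[ab Ua Ub]; apply: connect1; rewrite /within /= ab.
by rewrite /alive (leq_trans yy Ua) (leq_trans yy Ub).
Qed.

Lemma hop_lt j y : hop j y -> y < j. Proof. by case/andP. Qed.
(** The component of [j] consists of nodes alive at the earlier time [y] and touches a node of round
    [y], so it lies inside the component of [y], which therefore sees every older round that [j]
    sees. *)
Lemma hop_clique (j y y' : 'I_T.+1) : hop j y -> hop j y' -> y' < y -> hop y y'.
Proof.
case/andP=> yj /existsP[n /existsP[n' /and3P[jn nn' /eqP cn']]] /andP[y'j /existsP[m /existsP[m' /and3P[jm mm' cm']]]] yy'.
rewrite /hop yy'; apply/existsP; exists m; apply/existsP; exists m'; rewrite mm' cm' !andbT.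
apply: inC_mono (ltnW yj) _ (inC_connect jn jm).
have n'y : inC y n' by rewrite -cn' inC_self.
apply: inC_step n'y _ _; first by rewrite adj_sym.
by apply: leq_trans (ltnW yj) (inC_U jn).
Qed.
Lemma hop_ex (j : 'I_T.+1) : 0 < j -> exists y, hop j y.
Proof.
move=> j0; have [z cz] := Xsurj ord0; have [x cx] := Xsurj j.
have /connectP[p] := adj_conn x z.
have : inC j x by rewrite -cx inC_self.
elim: p x {cx} => [|n p IH] x jx /=.
  by move=> _ zx; have := inC_U jx; rewrite -zx /alive /c' cz leqNgt j0.
case/andP=> xn pn ln; case: (leqP j (c n)) => h; first by apply: (IH n) => //; apply: inC_step jx xn h.
exists (c n); rewrite /hop h; apply/existsP; exists x; apply/existsP; exists n.
by rewrite jx xn eqxx.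
Qed.

(* The successive strict minima of [c] along a walk. *)
Fixpoint dv (m : 'I_T.+1) p := if p is n :: p' then if c n < m then c n :: dv (c n) p' else dv m p' else [::].
(** Until a smaller value appears, the walk stays in the component of the current minimum, so each
    new minimum is one hop away. *)
Lemma dv_path m x p : inC m x -> path adj x p -> path hop m (dv m p).
Proof.
elim: p m x => [|n p IH] m x mx //= /andP[xn pn]; case: ltnP => h /=.
  rewrite (IH (c n) n) ?inC_self // andbT /hop h; apply/existsP; exists x; apply/existsP; exists n.
  by rewrite mx xn eqxx.
by apply: IH pn; apply: inC_step mx xn h.
Qed.
Lemma dv_cat (m : 'I_T.+1) p q : dv m (p ++ q) = dv m p ++ dv (last m (dv m p)) q.
Proof. by elim: p m => //= n p IH m; case: ltnP => h /=; rewrite IH. Qed.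
Lemma dv_last (m : 'I_T.+1) p : last m (dv m p) <= m /\ forall n, n \in p -> last m (dv m p) <= c n.
Proof.
elim: p m => [|n p IH] m /=; first by split.
case: ltnP => h /=.
  have [h1 h2] := IH (c n); split; first exact: leq_trans h1 (ltnW h).
  by move=> n'; rewrite inE => /orP[/eqP->|/h2].
have [h1 h2] := IH m; split => // n'; rewrite inE => /orP[/eqP->|/h2 //].
exact: leq_trans h1 h.
Qed.
Lemma dv_mem (m : 'I_T.+1) p : last m (dv m p) = m \/ exists2 n, n \in p & c n = last m (dv m p).
Proof.
elim: p m => [|n p IH] m /=; first by left.
case: ltnP => h /=.
  by right; case: (IH (c n)) => [->|[n' n'p e]]; [exists n; rewrite ?mem_head | exists n'; rewrite // inE n'p orbT].
by case: (IH m) => [->|[n' n'p e]]; [left | right; exists n'; rewrite // inE n'p orbT].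
Qed.
Lemma dv_spec (m : 'I_T.+1) p (e : 'I_T.+1) : e \in dv m p -> exists p1 n p2,
  [/\ p = p1 ++ n :: p2, c n = e, e < m & forall x, x \in p1 -> e < c x].
Proof.
elim: p m => [|n p IH] m //=; case: ltnP => h; last first.
  move/IH => [p1 [n' [p2 [-> cn' em lt]]]]; exists (n :: p1), n', p2; split=> // x.
  by rewrite inE => /orP[/eqP->|/lt //]; apply: leq_trans em h.
rewrite inE => /orP[/eqP->|]; first by exists [::], n, p.
move/IH => [p1 [n' [p2 [-> cn' em lt]]]]; exists (n :: p1), n', p2; split=> //.
  exact: ltn_trans em h.
by move=> x; rewrite inE => /orP[/eqP->|/lt].
Qed.

Lemma hop_uniq m s : path hop m s -> uniq s.
Proof.
have : transitive (fun a b : 'I_T.+1 => b < a) by move=> b a d /= h1 h2; apply: ltn_trans h2 h1.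
move=> tr h; apply: (@sorted_uniq _ (fun a b : 'I_T.+1 => b < a)) => // [a|]; first by rewrite ltnn.
by apply: (path_sorted (x := m)); apply: sub_path h => a b /andP[].
Qed.
Lemma hop_bag m s r : path hop m s -> size s <= r -> last m s \in bag hop r m.
Proof.
elim: s m r => [|y s IH] m r /=; first by case: r => [|r]; rewrite /= !inE eqxx.
case: r => // r /andP[my ps] sr; rewrite inE; apply/orP; right; apply/bigcupP; exists y => //.
exact: IH.
Qed.

(** Reading from the terminal, a node that sets a new minimum has only larger values between itself
    and the terminal; at its own round it therefore lies in the live tail. *)
Lemma dv_Tt (m : 'I_T.+1) b : {subset dv m (rev (bundle_nodes b)) <= Tt b}.
Proof.
move=> e /dv_spec[p1 [n [p2 [ep cn em lt]]]]; rewrite inE; apply/existsP; exists n.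
rewrite cn eqxx andbT.
have eb : bundle_nodes b = rev p2 ++ n :: rev p1 by rewrite -[LHS]revK ep rev_cat rev_cons cat_rcons.
have nn : n \notin rev p2 by have := pb_uniq b; rewrite eb cat_uniq => /and3P[_ /norP[]].
rewrite /live_suf eb mem_cat mem_head orbT /= index_cat (negbTE nn) /= eqxx addn0 drop_size_cat //=.
rewrite /alive /c' cn leqnn /=; apply/allP => x; rewrite mem_rev => /lt; exact: ltnW.
Qed.
Lemma dv_To (m : 'I_T.+1) g : m <= c (hub (orig g)) -> {subset dv m (tl g) <= To g}.
Proof.
move=> mh e /dv_spec[p1 [n [p2 [ep cn em lt]]]]; rewrite inE; apply/existsP; exists n.
have eh : e < c (hub (orig g)) by apply: leq_trans em mh.
rewrite cn eqxx eh !andbT.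
have eb : bundle_nodes g = (hub (orig g) :: p1) ++ n :: p2 by rewrite /bundle_nodes ep.
have nn : n \notin hub (orig g) :: p1 by have := pb_uniq g; rewrite eb cat_uniq => /and3P[_ /norP[]].
rewrite /live_pre eb mem_cat mem_head orbT index_cat (negbTE nn) [index n (n :: _)]/= eqxx addn0 andTb.
rewrite -cat_rcons take_size_cat ?size_rcons // all_rcons; apply/andP; split; first by rewrite /alive /c' cn.
by apply/allP => x; rewrite inE => /orP[/eqP->|/lt]; rewrite /alive; apply: ltnW.
Qed.

Lemma size_sub (s : seq 'I_T.+1) (D : {set 'I_T.+1}) : uniq s -> {subset s <= D} -> size s <= #|D|.
Proof.
by move=> us' sD; rewrite cardE; apply: uniq_leq_size => // x /sD; rewrite mem_enum.
Qed.

Lemma pb_connect Q b n : all Q (bundle_nodes b) -> n \in bundle_nodes b -> connect (within adj Q) (hub (orig b)) n.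
Proof.
rewrite /bundle_nodes; move: (pathP b); move: (hub (orig b)) (tl b) => x p.
elim: p x => [|y p IH] x; first by move=> _ _; rewrite inE => /eqP->; exact: connect0.
move=> /= /andP[xy py] /and3P[Qx Qy Qp]; rewrite inE => /orP[/eqP->|h]; first exact: connect0.
apply: connect_trans (connect1 _) (IH y py _ h); first by rewrite /within /= xy Qx Qy.
by rewrite /= Qy.
Qed.

(** No node of the star is consumed before round [xo v], and all bundles of the star are joined at
    the hub. *)
Lemma inC_star v n : star v n -> inC (xo v) n.
Proof.
have [m sm em] := xs_ex c' v.
have all_in b : orig b = v -> all (alive c' (xo v)) (bundle_nodes b).
  by move=> ob; apply/allP => x xb; apply: (xs_le c'); rewrite -ob; apply: star_pb.
move: sm => /existsP[b /andP[/eqP ob mb]] /existsP[b' /andP[/eqP ob' nb']].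
apply/existsP; exists m; apply/andP; split; first by apply/eqP/val_inj.
have h1 := pb_connect (all_in b ob) mb; have h2 := pb_connect (all_in b' ob') nb'.
by rewrite ob' in h2; rewrite ob in h1; apply: connect_trans h2; rewrite (within_csym adj_sym).
Qed.

(** The walk runs back along [b'] to the hub and then out along the anchor of the same vertex. It
    stays in the star and contains a node of that vertex's round, so the last minimum is that round.
    The two stretches have at most [k + 2] and [k + 1] minima, or [2 * k + 2] in all when [b'] is
    the anchor. *)
Lemma hop_chain b b' : adj (term b) (term b') -> xo (orig b') <= xo (orig b) ->
  xo (orig b') \in bag hop (2 * k + 3) (xo (orig b)).
Proof.
set u := orig b; set v := orig b'; move=> tt le; pose j := xo u.
have in0 : inC j (term b) by apply: inC_star; apply: star_pb; exact: term_pb.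
have revE : rev (bundle_nodes b') = term b' :: rev (belast (hub v) (tl b')) by rewrite /bundle_nodes lastI rev_rcons.
have path1 : path adj (term b) (rev (bundle_nodes b')).
  rewrite revE /= tt /= rev_path; apply: sub_path (pathP b') => x y; by rewrite adj_sym.
have last1 : last (term b) (rev (bundle_nodes b')) = hub v by rewrite -[bundle_nodes b']/(hub v :: tl b') rev_cons last_rcons.
pose g := anc c' v; have [og [n0 n0g en0]] := ancP c' v; rewrite -/g in og n0g.
pose w := rev (bundle_nodes b') ++ (if b' == g then [::] else tl g).
have path2 : path adj (term b) w.
  by rewrite cat_path path1 last1; case: eqP => //= _; rewrite -og; apply: pathP.
have wstar n : n \in w -> star v n.
  rewrite mem_cat mem_rev => /orP[/star_pb //|]; case: eqP => // _ h.
  by rewrite -og; apply: star_pb; rewrite inE h orbT.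
have n0w : n0 \in w.
  rewrite mem_cat mem_rev; case: eqP => [->|_]; first by rewrite n0g.
  by move: n0g; rewrite inE => /orP[/eqP->|->]; rewrite ?orbT // og -[hub v]/(hub (orig b')) hub_pb.
have lastE : last j (dv j w) = xo v.
  have [h1 h2] := dv_last j w; apply: val_inj; apply/eqP; rewrite eqn_leq.
  have -> : last j (dv j w) <= xo v by apply: leq_trans (h2 _ n0w) _; rewrite -[X in _ <= X]en0.
  case: (dv_mem j w) => [->//|[n nw <-]]; exact: (xs_le c' (wstar n nw)).
rewrite -/j -lastE; have dvp := dv_path in0 path2; apply: hop_bag => //.
move: dvp; rewrite /w dv_cat cat_path size_cat => /andP[dv1 dv2].
have s1 : size (dv j (rev (bundle_nodes b'))) <= #|Tt b'| by apply: size_sub (hop_uniq dv1) (@dv_Tt j b').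
case: (eqVneq b' g) dv2 => [_|ne] dv2 /=.
  by rewrite addn0; apply: leq_trans s1 (leq_trans (Tt_any b') _); rewrite leq_add2l.
have s2 : size (dv (last j (dv j (rev (bundle_nodes b')))) (tl g)) <= #|To g|.
  apply: size_sub; first by move: dv2; apply: hop_uniq.
  apply: dv_To; rewrite og; have [_ h] := dv_last j (rev (bundle_nodes b')); apply: h.
  by rewrite mem_rev; apply: hub_pb.
have nb : anc c' (orig b') != b' by rewrite eq_sym.
have t1 := Tt_nonanchor nb; have t2 := To_anchor v.
apply: leq_trans (leq_add (leq_trans s1 t1) (leq_trans s2 t2)) _.
by rewrite mul2n -addnn; clear; lia.
Qed.
End Static.
End System.

Lemma split_first (T : eqType) (e : rel T) (Q : pred T) x p : path e x p -> has (predC Q) p ->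
  exists p1 t p2, [/\ p = p1 ++ t :: p2, all Q p1, path e x p1, e (last x p1) t & ~~ Q t].
Proof.
elim: p x => [|z p IH] x //= /andP[xz pz]; case: (boolP (Q z)) => /= Qz; last first.
  by exists [::], z, p; rewrite /= xz.
move=> /(IH z pz)[p1 [t [p2 [-> /= h1 h2 h3 h4]]]].
by exists (z :: p1), t, p2; rewrite /= Qz xz.
Qed.

Lemma path_suffix (T : eqType) (e : rel T) x p q1 t q2 : path e x p -> x :: p = q1 ++ t :: q2 -> path e t q2.
Proof.
case: q1 => [|z q1] /=; first by move=> pp [<- <-].
by move=> pp [_ ep]; move: pp; rewrite ep cat_path /= => /and3P[].
Qed.

(** * Legs *)

Section Legs.
Variables (N V B : finType) (adj : rel N) (hub : V -> N) (orig : B -> V) (bof : V -> B) (tl : B -> seq N).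
Local Notation pb := (bundle_nodes hub orig tl).
Local Notation star := (star hub orig tl).
Local Notation term := (term hub orig tl).
Variables (r : V) (lev : V -> nat) (c : N -> nat) (e : nat).
Local Notation suf := (live_suf hub orig tl c e).
Local Notation pre := (live_pre hub orig tl c e).
Local Notation whole := (all_live hub orig tl c e).
Local Notation xs := (xs hub orig tl c).
Local Notation anc := (anc hub orig bof tl c).
Local Notation isanc := (is_anchor hub orig bof tl c e).
Local Notation U := (alive c e).
Hypothesis pathP : forall b, path adj (hub (orig b)) (tl b).
Hypothesis pb_uniq : forall b, uniq (pb b).
Hypothesis bofP : forall v, orig (bof v) = v.
Hypothesis adj_sym : symmetric adj.
Hypothesis adj_conn : forall x y, connect adj x y.
Hypothesis lev_step : forall v, v != r -> exists v1 x p, [/\ lev v = (lev v1).+1, star v x, path adj x p,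
  star v1 (last x p) & forall n, n \in p -> n != last x p -> forall w, ~~ star w n].
Hypothesis r_owned : xs r < e.

(** The nodes for which [us_hit] demands an account: a leg may pass them only by taking a recorded
    piece of a bundle there. *)
Definition act n := [exists b, (suf b n && (xs (orig b) < e)) || (pre b n && isanc b)].
Definition cov (W S P : {set B}) n := [exists a, [|| (a \in W) && (n \in pb a), (a \in S) && suf a n | (a \in P) && pre a n]].

(* A leg from [t] with nodes [K] lands next to a node of round [y]; [K] is empty
   when [t] is itself consumed.  [W] are its whole bundles, of which [Fr] belong to
   untouched vertices; [FS] and [PF] are the tail and head it ends with; [SG]
   records bundles of which it only crosses a middle part. *)
Record ldata (t : N) (y : nat) (K : {set N}) (W FS PF SG Fr : {set B}) (L : nat) : Prop := LData {
  ld_t : (t \in K) || (K == set0) && (c t == y);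
  ld_y : y < e;
  ld_land : K = set0 \/ exists m m', [/\ m \in K, adj m m' & c m' = y];
  ld_conn : conn adj K;
  ld_U : forall n, n \in K -> U n;
  ld_W : forall b n, b \in W -> n \in pb b -> n \in K;
  ld_FS : forall b, b \in FS -> [/\ ~~ whole b, U (term b) & forall n, suf b n -> n \in K];
  ld_PF : forall b, b \in PF -> [/\ isanc b, U (hub (orig b)) & forall n, pre b n -> n \in K];
  ld_act : forall n, n \in K -> act n -> cov W FS PF n;
  ld_unt : forall n v, n \in K -> e <= xs v -> star v n -> exists2 a, a \in W :|: FS :|: PF :|: SG & n \in pb a;
  ld_lev : forall b, b \in Fr -> lev (orig b) <= L;
  ld_fr : forall l, #|[set b in Fr | lev (orig b) == l]| <= 2;
  ld_ft : #|(W :\: Fr) :|: FS :|: PF :|: SG| <= 3;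
  ld_FS1 : #|FS| <= 1;
  ld_PF1 : #|PF| <= 1 }.

(** Prolongs a leg at its start by a connected piece whose active nodes all lie on newly added whole
    bundles. *)
Lemma leg_add t y K W FS PF SG Fr L q (K' : {set N}) (SG' Fr' : {set B}) L' a :
  ldata t y K W FS PF SG Fr L -> conn adj K' -> q \in K' -> a \in K' -> (a == t) || adj a t ->
  (forall n, n \in K' -> U n) -> (forall b n, b \in Fr' -> n \in pb b -> n \in K') ->
  (forall n, n \in K' -> act n -> exists2 b, b \in Fr' & n \in pb b) ->
  (forall n v, n \in K' -> e <= xs v -> star v n -> exists2 b, b \in Fr' :|: SG' & n \in pb b) ->
  (forall b, b \in Fr :|: Fr' -> lev (orig b) <= L') ->
  (forall l, #|[set b in Fr :|: Fr' | lev (orig b) == l]| <= 2) ->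
  #|(W :\: Fr) :|: FS :|: PF :|: (SG :|: SG')| <= 3 ->
  ldata q y (K' :|: K) (W :|: Fr') FS PF (SG :|: SG') (Fr :|: Fr') L'.
Proof.
move=> ld cK' qK' aK' at' UK' FK' actK' untK' levL frL ftL; case: (ld) => h1 h2 h3 h4 h5 h6 h7 h8 h9 h10 h11 h12 h13 h14 h15.
have UU n : n \in K' :|: K -> U n by rewrite inE => /orP[/UK'|/h5].
split=> //.
- by rewrite inE qK'.
- right; case: h3 => [K0|[m [m' [mK mm' cm]]]]; last by exists m, m'; rewrite inE mK orbT.
  have ct : c t = y by case/orP: h1 => [|/andP[_ /eqP->]] //; rewrite K0 inE.
  exists a, t; rewrite inE aK' ct; split=> //; case/orP: at' => // /eqP ea.
  by have := UK' _ aK'; rewrite /alive ea ct leqNgt h2.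
- case: (boolP (t \in K)) => tK; first exact: connU cK' h4 aK' tK at'.
  by move: h1; rewrite (negbTE tK) /= => /andP[/eqP -> _]; rewrite setU0.
- by move=> b n; rewrite inE => /orP[/h6 H|/FK' H] /H nK; rewrite inE nK ?orbT.
- by move=> b /h7[u1 u2 u3]; split=> // n /u3 nK; rewrite inE nK orbT.
- by move=> b /h8[u1 u2 u3]; split=> // n /u3 nK; rewrite inE nK orbT.
- move=> n; rewrite inE => /orP[nK|nK] an.
    by have [b bF nb] := actK' _ nK an; apply/existsP; exists b; rewrite in_setU bF nb orbT.
  by have /existsP[b hb] := h9 _ nK an; apply/existsP; exists b; case/or3P: hb => /andP[u1 u2]; rewrite ?in_setU u1 u2 ?orbT.
- move=> n v; rewrite inE => /orP[nK|nK] uv sv.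
    have [b bF nb] := untK' _ _ nK uv sv; exists b => //.
    by move: bF; rewrite !inE => /orP[] ->; rewrite ?orbT.
  have [b bF nb] := h10 _ _ nK uv sv; exists b => //.
  by move: bF; rewrite !inE => /orP[/orP[/orP[]|]|] ->; rewrite ?orbT.
- apply: leq_trans ftL; apply/subset_leq_card/subsetP => b; rewrite !inE negb_or.
  by do 7 case: (b \in _).
Qed.

Lemma leg_consumed t : c t < e -> ldata t (c t) set0 set0 set0 set0 set0 set0 0.
Proof.
move=> ct; have n0 l : [set b in set0 | lev (orig b) == l] = set0 by apply/setP => b; rewrite !inE.
split=> //; rewrite ?cards0 ?inE ?eqxx //=; try (by move=> x; rewrite inE); try (by move=> x y; rewrite inE).
- by left.
- by move=> l; rewrite n0 cards0.
- by rewrite !setU0 setD0 cards0.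
Qed.

Lemma conn_pb b : conn adj [set n in pb b].
Proof. exact: conn_path. Qed.

Lemma leg_sets (K : {set N}) (W FS PF : {set B}) y t : t \in K -> (exists m m', [/\ m \in K, adj m m' & c m' = y]) ->
  y < e -> conn adj K -> (forall b n, b \in W -> n \in pb b -> U n) ->
  (forall b, b \in FS -> ~~ whole b /\ exists n, suf b n) ->
  (forall b, b \in PF -> isanc b /\ exists n, pre b n) ->
  (forall n, (n \in K) = cov W FS PF n) -> #|W :|: FS :|: PF| <= 2 -> #|FS| <= 1 -> #|PF| <= 1 ->
  ldata t y K W FS PF set0 set0 0.
Proof.
move=> tK ld ye cK WU FSo PFo KE card c1 c2.
have n0 l : [set b in set0 | lev (orig b) == l] = set0 by apply/setP => b; rewrite !inE.
split=> //; rewrite ?tK //; try (by move=> x; rewrite inE).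
- by right.
- move=> n; rewrite KE => /existsP[a /or3P[] /andP[]].
  + exact: WU.
  + by move=> _; apply: suf_U.
  + by move=> _; apply: pre_U.
- by move=> b n bW nb; rewrite KE; apply/existsP; exists b; rewrite bW nb.
- move=> b bF; have [cut [n sn]] := FSo _ bF; split=> //; first exact: suf_U (suf_term pb_uniq sn).
  by move=> m sm; rewrite KE; apply/existsP; exists b; rewrite bF sm orbT.
- move=> b bF; have [ia [n pn]] := PFo _ bF; split=> //; first exact: pre_U (pre_hub pn).
  by move=> m sm; rewrite KE; apply/existsP; exists b; rewrite bF sm !orbT.
- by move=> n; rewrite KE.
- move=> n v; rewrite KE => /existsP[a ha] _ _; exists a; last first.
    by case/or3P: ha => /andP[_] //; [exact: suf_pb | exact: pre_pb].
  by rewrite !inE; case/or3P: ha => /andP[-> _]; rewrite ?orbT.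
- by move=> l; rewrite n0 cards0.
- by rewrite setU0 setD0; lia.
Qed.

Lemma suf_conn b : conn adj [set n | suf b n].
Proof.
case: (set_0Vmem [set n | suf b n]) => [->|[n0 n0s]]; first exact: conn0.
have key s x p : path adj x p -> uniq (x :: p) -> x :: p = s ->
    conn adj [set n | (n \in s) && all U (drop (index n s) s)].
  elim: p x s => [|z p IH] x s /= pp un es; subst s.
    move=> u v; rewrite !inE => /andP[/eqP -> _] /andP[/eqP -> _]; exact: connect0.
  case/andP: pp => xz pz; case/andP: un => xN un.
  set K := [set n | _]; pose K2 := [set n | (n \in z :: p) && all U (drop (index n (z :: p)) (z :: p))].
  have cK2 : conn adj K2 by apply: (IH z).
  case: (boolP (all U [:: x, z & p])) => aU; last first.
    rewrite (_ : K = K2) //; apply/setP => n; rewrite !inE.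
    case: (eqVneq n x) => [->|nx] /=.
      by rewrite eqxx; move: aU xN; rewrite /= inE => /negbTE -> /negbTE ->.
    by rewrite ?(eq_sym x n) ?(negbTE nx).
  rewrite (_ : K = x |: K2).
    by apply: (connU1 adj_sym cK2 _ xz); rewrite /K2 !inE /= eqxx /=; case/andP: aU.
  apply/setP => n; rewrite !inE; case: (eqVneq n x) => [->|nx] /=; first by rewrite eqxx.
  by rewrite ?(eq_sym x n) ?(negbTE nx).
exact: key (pathP b) (pb_uniq b) erefl.
Qed.
Lemma pre_conn b : conn adj [set n | pre b n].
Proof.
have key s x p : path adj x p -> uniq (x :: p) -> x :: p = s ->
    conn adj [set n | (n \in s) && all U (take (index n s).+1 s)].
  elim: p x s => [|z p IH] x s /= pp un es; subst s.
    move=> u v; rewrite !inE => /andP[/eqP -> _] /andP[/eqP -> _]; exact: connect0.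
  case/andP: pp => xz pz; case/andP: un => xN un.
  set K := [set n | _]; pose K2 := [set n | (n \in z :: p) && all U (take (index n (z :: p)).+1 (z :: p))].
  have cK2 : conn adj K2 by apply: (IH z).
  case: (boolP (U x)) => Ux; last first.
    rewrite (_ : K = set0); first exact: conn0.
    by apply/setP => n; rewrite !inE /= (negbTE Ux) /= andbF.
  have KE : K = x |: K2.
    apply/setP => n; rewrite !inE; case: (eqVneq n x) => [->|nx] /=; first by rewrite eqxx take0 /= Ux.
    by rewrite ?(eq_sym x n) ?(negbTE nx) /= Ux.
  rewrite KE; case: (boolP (U z)) => Uz.
    by apply: (connU1 adj_sym cK2 _ xz); rewrite // /K2 !inE /= eqxx take0 /= Uz.
  rewrite (_ : K2 = set0) ?setU0; first by move=> u v /set1P-> /set1P->; exact: connect0.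
  by apply/setP => n; rewrite !inE /= (negbTE Uz) /= andbF.
exact: key (pathP b) (pb_uniq b) erefl.
Qed.

(** The consumed node nearest to the terminal is next to the live tail; a leg ending with this tail
    lands there. *)
Lemma suf_land b n : suf b n -> ~~ whole b -> exists m m', [/\ suf b m, adj m m' & ~~ U m'].
Proof.
case/andP; move: (pathP b) (pb_uniq b); rewrite /live_suf /all_live /bundle_nodes.
move: (hub (orig b)) (tl b) => x p; elim: p x => [|z p IH] x /=.
  by move=> _ _; rewrite inE => /eqP->; rewrite eqxx /= !andbT => h /negP[].
move=> /andP[xz pz] /andP[xN un]; rewrite inE; case: (eqVneq n x) => [->|nx] /=.
  by move=> _ h /negP[].
move=> nzp; rewrite ?(eq_sym x n) ?(negbTE nx) => sn nw.
case: (boolP (all U (z :: p))) => aU.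
  exists z, x; rewrite adj_sym xz; split=> //; last first.
    by apply: contra nw => Ux'; apply/andP; split; [exact: Ux' | exact: aU].
  rewrite inE mem_head orbT /=; move: xN; rewrite inE negb_or => /andP[xz' _].
  by rewrite (negbTE xz') eqxx /=; exact: aU.
have [m [m' [h1 h2 h3]]] := IH z pz un nzp sn aU.
exists m, m'; split=> //; case/andP: h1 => mzp am; rewrite inE mzp orbT /=.
by rewrite ifN //; apply: contraNneq xN => ->.
Qed.
Lemma pre_land b n : pre b n -> ~~ whole b -> exists m m', [/\ pre b m, adj m m' & ~~ U m'].
Proof.
move/pre_hub; rewrite /live_pre hub_pb /= eqxx take0 /= andbT => Uh; move: (pathP b) (pb_uniq b) Uh; rewrite /all_live /bundle_nodes.
move: (hub (orig b)) (tl b) => x p; elim: p x => [|z p IH] x /=; first by move=> _ _ ->.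
move=> /andP[xz pz] /andP[xN un] Ux; rewrite Ux /= => nw.
case: (boolP (U z)) => Uz; last by exists x, z; split=> //; rewrite inE eqxx /= ?eqxx ?take0.
have nw' : ~~ all U (z :: p) by [].
have [m [m' [/andP[h0 h1] h2 h3]]] := IH z pz un Uz nw'.
exists m, m'; split=> //; rewrite inE h0 orbT /= ifN ?Ux //.
by apply: contraNneq xN => ->.
Qed.

Lemma anc_cut v : xs v < e -> isanc (anc v) /\ ~~ whole (anc v).
Proof.
move=> ow; have [ov [n nb en]] := ancP hub tl bofP c v.
split; first by rewrite /is_anchor ov eqxx.
by apply/allPn; exists n => //; rewrite /alive en -ltnNge.
Qed.
Lemma isanc_cut b : isanc b -> ~~ whole b.
Proof. by case/andP => /eqP h /anc_cut[_]; rewrite h. Qed.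

(** Three endings are possible. On the live head of an anchor, take that head; on the live tail of a
    cut bundle, take that tail. On an intact bundle of an owned vertex, take the whole bundle and
    the live head of the anchor, which is cut and starts at the same hub. *)
Lemma leg_foot t : act t -> exists y K W FS PF, ldata t y K W FS PF set0 set0 0 /\ #|W :|: FS :|: PF| <= 2.
Proof.
have ltU m : ~~ U m -> c m < e by rewrite /alive -ltnNge.
have one (b a : B) : a \in [set b] -> a = b by move/set1P.
case/existsP=> b; case: (boolP (pre b t && isanc b)) => [/andP[pt ia] _|_].
  have [m [m' [h1 h2 h3]]] := pre_land pt (isanc_cut ia).
  exists (c m'), [set n | pre b n], set0, set0, [set b]; split; last by rewrite !set0U cards1.
  apply: leg_sets; rewrite ?inE ?cards0 ?cards1 ?set0U ?cards1 //; first by exists m, m'; rewrite inE.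
  - exact: ltU.
  - exact: pre_conn.
  - by move=> a n; rewrite inE.
  - by move=> a; rewrite inE.
  - by move=> a /one ->; split=> //; exists t.
  - move=> n; rewrite inE; apply/idP/existsP; first by move=> pn; exists b; rewrite !inE eqxx pn.
    by case=> a; rewrite !inE /= => /andP[/eqP->].
rewrite orbF => /andP[st ow]; case: (boolP (whole b)) => wb; last first.
  have [m [m' [h1 h2 h3]]] := suf_land st wb.
  exists (c m'), [set n | suf b n], set0, [set b], set0; split; last by rewrite set0U setU0 cards1.
  apply: leg_sets; rewrite ?inE ?cards0 ?cards1 ?set0U ?setU0 ?cards1 //; first by exists m, m'; rewrite inE.
  - exact: ltU.
  - exact: suf_conn.
  - by move=> a n; rewrite inE.
  - by move=> a /one ->; split=> //; exists t.
  - by move=> a; rewrite inE.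
  - move=> n; rewrite inE; apply/idP/existsP; first by move=> pn; exists b; rewrite !inE eqxx pn.
    by case=> a; rewrite !inE /= orbF => /andP[/eqP->].
pose g := anc (orig b); have [ia gc] := anc_cut ow.
have og : orig g = orig b by case: (ancP hub tl bofP c (orig b)).
have ph : pre g (hub (orig g)).
  rewrite /live_pre hub_pb /= eqxx take0 /= andbT og.
  by move: wb => /allP/(_ (hub (orig b))); apply; rewrite hub_pb.
have [m [m' [h1 h2 h3]]] := pre_land ph gc.
exists (c m'), ([set n in pb b] :|: [set n | pre g n]), [set b], set0, [set g]; split; last first.
  by rewrite setU0 cardsU1 cards1; case: (_ \notin _).
apply: leg_sets; rewrite ?cards0 ?cards1 //.
- by rewrite in_setU in_set (suf_pb st).
- by exists m, m'; rewrite in_setU !in_set h1 orbT.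
- exact: ltU.
- apply: (connU adj_sym (@conn_pb b) (@pre_conn g) (a := hub (orig b)) (b := hub (orig g))); rewrite ?in_set ?ph ?hub_pb //.
  by rewrite og eqxx.
- by move=> a n /one -> nb; move/allP: wb; apply.
- by move=> a; rewrite inE.
- by move=> a /one ->; split=> //; exists (hub (orig g)).
- move=> n; rewrite in_setU !in_set; apply/orP/existsP.
    by case=> h; [exists b | exists g]; rewrite !in_set1 !eqxx h ?orbT.
  by case=> a; rewrite !in_set1 in_set0 /= => /orP[] /andP[/eqP-> ->]; [left|right].
- by rewrite setU0 cardsU1 cards1; case: (_ \notin _).
Qed.

Lemma unowned_whole v b : e <= xs v -> orig b = v -> forall n, n \in pb b -> U n.
Proof. by move=> ev ob n nb; apply: leq_trans ev (xs_le bofP c _); rewrite -ob; apply: star_pb. Qed.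

Lemma act_star n : act n -> exists b, n \in pb b.
Proof. by case/existsP=> b /orP[/andP[/suf_pb]|/andP[/pre_pb]]; exists b. Qed.

Lemma lev0 (l : nat) : #|[set b in set0 | lev (orig b) == l]| <= 2.
Proof. by rewrite (_ : [set b in set0 | _] = set0) ?cards0 //; apply/setP => b; rewrite !inE. Qed.

(* A node that is inside a gap of [b2]: walk along [b2] to its next node that
   is consumed or active. *)
Lemma leg_dropped b2 t : t \in pb b2 -> xs (orig b2) < e -> U t -> ~~ act t ->
  exists y K W FS PF SG, ldata t y K W FS PF SG set0 0.
Proof.
move=> tb ow Ut nt; pose Q n := U n && ~~ act n.
have [q1 [q2 eb]] : exists q1 q2, pb b2 = q1 ++ t :: q2 by case/splitPr: tb => q1 q2; exists q1, q2.
have pq : path adj t q2 := path_suffix (pathP b2) eb.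
have nq1 : t \notin q1 by have := pb_uniq b2; rewrite eb cat_uniq /= => /and3P[_ /norP[]].
(* If all later nodes of [b2] were alive, [t] would lie in its live tail and be active. *)
have hq : has (predC Q) q2.
  rewrite -[has _ _]negbK -all_predC; apply: contra nt => /allP al.
  apply/existsP; exists b2; rewrite ow andbT /live_suf tb eb index_cat (negbTE nq1) /= eqxx addn0 drop_size_cat //=.
  rewrite Ut /=; apply/orP; left; apply/allP => z /al /=; by rewrite negbK => /andP[].
have [p1 [t' [p2 [e2 al pp at' nQ]]]] := split_first pq hq.
have subb n : n \in t :: p1 -> n \in pb b2.
  by rewrite eb mem_cat e2 inE => /orP[/eqP->|h]; rewrite ?mem_head ?orbT // inE mem_cat h !orbT.
have QK n : n \in [set n in t :: p1] -> Q n by rewrite in_set inE => /orP[/eqP->|h]; [rewrite /Q Ut | exact: (allP al)].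
have go y K W FS PF : ldata t' y K W FS PF set0 set0 0 -> #|W :|: FS :|: PF| <= 2 ->
    exists y K W FS PF SG, ldata t y K W FS PF SG set0 0.
  move=> ld card; exists y, ([set n in t :: p1] :|: K), (W :|: set0), FS, PF, (set0 :|: [set b2]).
  have := @leg_add t' y K W FS PF set0 set0 0 t [set n in t :: p1] [set b2] set0 0 (last t p1) ld.
  rewrite setU0; apply.
  - exact: conn_path.
  - by rewrite in_set mem_head.
  - by rewrite in_set mem_last.
  - by rewrite at' orbT.
  - by move=> n /QK/andP[].
  - by move=> b n; rewrite inE.
  - by move=> n /QK/andP[_ /negP].
  - by move=> n v nK _ _; exists b2; [rewrite !inE eqxx | apply: subb; rewrite in_set in nK].
  - by move=> b; rewrite !inE.
  - exact: lev0.
  - rewrite setD0 set0U; apply: leq_trans (leq_card_setU _ _) _; rewrite cards1; move: card; clear; lia.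
case: (boolP (U t')) => Ut'; last first.
  have ct : c t' < e by rewrite ltnNge.
  by apply: go (leg_consumed ct) _; rewrite !setU0 cards0.
have : act t' by move: nQ; rewrite /Q Ut' negbK.
by case/leg_foot => y [K [W [FS [PF [ld card]]]]]; apply: go ld card.
Qed.

Lemma leg_owned t v : xs v < e -> star v t -> exists y K W FS PF SG, ldata t y K W FS PF SG set0 0.
Proof.
move=> ow /existsP[b /andP[/eqP ob tb]].
case: (boolP (U t)) => Ut; last first.
  have ct : c t < e by rewrite ltnNge.
  by exists (c t), set0, set0, set0, set0, set0; apply: leg_consumed.
case: (boolP (act t)) => at'.
  by have [y [K [W [FS [PF [ld _]]]]]] := leg_foot at'; exists y, K, W, FS, PF, set0.
by apply: (@leg_dropped b); rewrite ?ob.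
Qed.

(** Every bundle at [v] is intact. One leads from [t] to the hub and one from the hub to the start
    of a walk towards a vertex one level lower, whose inner nodes belong to no star. This costs two
    bundles per level and stops at a consumed node or an owned vertex, at the latest at the root. *)
Lemma leg_fresh v t : e <= xs v -> star v t -> exists y K W FS PF SG Fr, ldata t y K W FS PF SG Fr (lev v).
Proof.
have [l] := ubnP (lev v); elim: l v t => // l IH v t lvl ev st.
have vr : v != r by apply: contraTneq ev => ->; rewrite -ltnNge.
have [v1 [x [p [elev sx px sy fr]]]] := lev_step vr.
have [b0 /andP[/eqP ob0 tb0]] := existsP st; have [b1 /andP[/eqP ob1 xb1]] := existsP sx.
have [p1 [t' [pp1 at' fr1 te]]] : exists p1 t', [/\ path adj x p1, (last x p1 == t') || adj (last x p1) t',
    (forall n, n \in p1 -> U n /\ forall w, ~~ star w n) & c t' < e \/ star v1 t'].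
  case: p px sy fr => [|z p] px sy fr.
    by exists [::], x; split=> //; [rewrite eqxx | right].
  pose Q n := U n && (n != last x (z :: p)).
  have hq : has (predC Q) (z :: p).
    by apply/hasP; exists (last x (z :: p)); [rewrite /= mem_last | rewrite /= /Q eqxx andbF].
  have [p1 [t' [p2 [e2 al pp a' nQ]]]] := split_first px hq.
  exists p1, t'; rewrite a' orbT; split=> // [n np1|].
    have /andP[Un nl] := allP al n np1; split=> // w; apply: (fr n) => //.
    by rewrite e2 mem_cat np1.
  case: (boolP (U t')) => Ut'; last by left; rewrite ltnNge.
  by right; move: nQ; rewrite /Q Ut' negbK => /eqP->.
have [y [K [W [FS [PF [SG [Fr [ld levF]]]]]]]] : exists y K W FS PF SG Fr, ldata t' y K W FS PF SG Fr (lev v1) /\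
    (forall b, b \in Fr -> lev (orig b) < lev v).
  have S0 y K W FS PF SG L : ldata t' y K W FS PF SG set0 L -> ldata t' y K W FS PF SG set0 (lev v1).
    by case=> *; split=> // b; rewrite inE.
  case: te => [ct|st'].
    exists (c t'), set0, set0, set0, set0, set0, set0; split; last by move=> b; rewrite inE.
    exact: S0 (leg_consumed ct).
  case: (ltnP (xs v1) e) => ow.
    have [y [K [W [FS [PF [SG ld]]]]]] := leg_owned ow st'.
    by exists y, K, W, FS, PF, SG, set0; split; [exact: S0 ld | move=> b; rewrite inE].
  have [|y [K [W [FS [PF [SG [Fr ld]]]]]]] := IH v1 t' _ ow st'; first by rewrite elev in lvl.
  exists y, K, W, FS, PF, SG, Fr; split=> // b bF; rewrite elev ltnS; exact: (ld_lev ld bF).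
pose K' := [set n in pb b0] :|: [set n in pb b1] :|: [set n in x :: p1].
have inK' n : n \in K' -> [\/ n \in pb b0, n \in pb b1 | n \in p1].
  rewrite !in_setU !in_set => /orP[/orP[h|h]|]; [by constructor 1 | by constructor 2|].
  by rewrite inE => /orP[/eqP->|h]; [constructor 2 | constructor 3].
have U0 : forall n, n \in pb b0 -> U n by apply: (unowned_whole ev ob0).
have U1 : forall n, n \in pb b1 -> U n by apply: (unowned_whole ev ob1).
exists y, (K' :|: K), (W :|: [set b0; b1]), FS, PF, (SG :|: set0), (Fr :|: [set b0; b1]).
apply: (leg_add (a := last x p1) ld _ _ _ at').
- have c01 : conn adj ([set n in pb b0] :|: [set n in pb b1]).
    apply: (connU adj_sym (@conn_pb b0) (@conn_pb b1) (a := hub v) (b := hub v)); rewrite ?in_set ?eqxx //.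
      by rewrite -ob0 hub_pb.
    by rewrite -ob1 hub_pb.
  apply: (connU adj_sym c01 (conn_path adj_sym pp1) (a := x) (b := x)); rewrite ?eqxx //.
    by rewrite in_setU !in_set xb1 orbT.
  by rewrite in_set mem_head.
- by rewrite !in_setU in_set tb0.
- by rewrite !in_setU !in_set mem_last !orbT.
- by move=> n /inK'[/U0|/U1|/fr1[]].
- by move=> b n; rewrite in_set2 !in_setU !in_set => /orP[] /eqP-> ->; rewrite ?orbT.
- move=> n /inK'[nb|nb|/fr1[_ ns]] an; [by exists b0; rewrite ?set21 | by exists b1; rewrite ?set22|].
  by have [b /star_pb sb] := act_star an; have := ns (orig b); rewrite sb.
- move=> n w /inK'[nb|nb|/fr1[_ ns]] _ sw; [by exists b0; rewrite ?inE ?eqxx | by exists b1; rewrite ?inE ?eqxx ?orbT|].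
  by rewrite (negbTE (ns w)) in sw.
- move=> b; rewrite in_setU in_set2 => /orP[/levF/ltnW //|/orP[]/eqP->]; by rewrite ?ob0 ?ob1.
- move=> l'; case: (eqVneq l' (lev v)) => [->|nl].
    apply: leq_trans (_ : #|[set b0; b1]| <= 2); last by rewrite cards2; case: (_ != _).
    apply/subset_leq_card/subsetP => b; rewrite in_set in_setU => /andP[/orP[/levF lb|//]].
    by rewrite (ltn_eqF lb).
  apply: leq_trans (ld_fr ld l'); apply/subset_leq_card/subsetP => b.
  rewrite in_set in_setU in_set2 (in_set (fun b => (b \in Fr) && (lev (orig b) == l'))) => /andP[/orP[->//|/orP[]/eqP->]]; rewrite ?ob0 ?ob1 => /eqP el.
    by rewrite el eqxx in nl.
  by rewrite el eqxx in nl.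
- apply: leq_trans (ld_ft ld); apply/subset_leq_card/subsetP => b; rewrite setU0 !inE.
  by case: (b \in Fr); case: (b \in W); case: (b \in FS); case: (b \in PF); case: (b \in SG); case: (b == b0); case: (b == b1).
Qed.

(** Live nodes that are inactive and on no untouched star cost nothing, so a walk towards a consumed
    node passes through them freely until one of the previous cases applies. *)
Lemma leg_all t : (exists n0, c n0 < e) -> exists y K W FS PF SG Fr L, ldata t y K W FS PF SG Fr L.
Proof.
case=> n0 c0; pose Q n := [&& U n, ~~ act n & [forall v, (e <= xs v) ==> ~~ star v n]].
have nQ t' : ~~ Q t' -> exists y K W FS PF SG Fr L, ldata t' y K W FS PF SG Fr L.
  case: (boolP (U t')) => [Ut|Ut _]; last first.
    have ct : c t' < e by rewrite ltnNge.
    by exists (c t'), set0, set0, set0, set0, set0, set0, 0; apply: leg_consumed.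
  rewrite /Q Ut /=; case: (boolP (act t')) => [/leg_foot[y [K [W [FS [PF [ld _]]]]]] _|_ /=].
    by exists y, K, W, FS, PF, set0, set0, 0.
  case/forallPn => v; rewrite negb_imply negbK => /andP[ev sv].
  have [y [K [W [FS [PF [SG [Fr ld]]]]]]] := leg_fresh ev sv.
  by exists y, K, W, FS, PF, SG, Fr, (lev v).
case: (boolP (Q t)) => [Qt|/nQ //].
have /connectP[p pp ln] := adj_conn t n0.
have hq : has (predC Q) p.
  case: p pp ln => [|z p] pp ln; first by have et : t = n0; [rewrite ln | move: Qt; rewrite et /Q /alive leqNgt c0].
  by apply/hasP; exists n0; [rewrite ln /= mem_last | rewrite /= /Q /alive leqNgt c0].
have [p1 [t' [p2 [_ al pp1 at' /nQ[y [K [W [FS [PF [SG [Fr [L ld]]]]]]]]]]]] := split_first pp hq.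
have QK n : n \in [set n in t :: p1] -> Q n by rewrite in_set inE => /orP[/eqP->|h] //; exact: (allP al).
exists y, ([set n in t :: p1] :|: K), (W :|: set0), FS, PF, (SG :|: set0), (Fr :|: set0), L.
apply: (leg_add (a := last t p1) ld).
- exact: conn_path.
- by rewrite in_set mem_head.
- by rewrite in_set mem_last.
- by rewrite at' orbT.
- by move=> n /QK/and3P[].
- by move=> b n; rewrite inE.
- by move=> n /QK/and3P[_ /negP].
- by move=> n v /QK/and3P[_ _ /forallP/(_ v)/implyP h] /h /negP.
- by move=> b; rewrite setU0; exact: (ld_lev ld).
- by move=> l; rewrite setU0; exact: (ld_fr ld l).
- by rewrite !setU0; exact: (ld_ft ld).
Qed.
End Legs.

Lemma card_bigU_seq (I T : finType) (s : seq I) (F : I -> {set T}) m :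
  (forall i, i \in s -> #|F i| <= m) -> #|\bigcup_(i <- s) F i| <= size s * m.
Proof.
elim: s => [|i s IH] H; first by rewrite big_nil cards0.
rewrite big_cons mulSn; apply: leq_trans (leq_card_setU _ _) (leq_add _ _).
  by apply: H; rewrite mem_head.
by apply: IH => j js; apply: H; rewrite inE js orbT.
Qed.
Lemma card_bigU (I T : finType) (A : {set I}) (F : I -> {set T}) m :
  (forall i, i \in A -> #|F i| <= m) -> #|\bigcup_(i in A) F i| <= #|A| * m.
Proof.
have -> : \bigcup_(i in A) F i = \bigcup_(i <- enum A) F i by rewrite big_enum.
move=> H; rewrite (cardE A); apply: card_bigU_seq => i; rewrite mem_enum; exact: H.
Qed.
Lemma mem_bigU_seq (I T : finType) (s : seq I) (F : I -> {set T}) x :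
  reflect (exists2 i, i \in s & x \in F i) (x \in \bigcup_(i <- s) F i).
Proof.
elim: s => [|i s IH].
  by rewrite big_nil inE; constructor; case.
rewrite big_cons inE; apply: (iffP orP).
  by case=> [h|/IH[j js h]]; [exists i; rewrite ?mem_head | exists j; rewrite // inE js orbT].
by case=> j; rewrite inE => /orP[/eqP->|js] h; [left | right; apply/IH; exists j].
Qed.

(** * One round of consumption *)

Section Core.
Variables (N : finType) (adj : rel N) (f g : N -> nat) (C : {set N}) (e : nat) (x0 : N).
Hypothesis adj_sym : symmetric adj.
Hypothesis pl : planar_like adj.
Hypothesis mf : minor_model adj f.
Hypothesis fC : forall n, (n \in C) = (f n == e).
Hypothesis x0C : x0 \in C.
Hypothesis cC : conn adj C.
Definition lab y := [exists n, exists n', [&& n \in C, n' \notin C, adj n n' & f n' == y]].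
Hypothesis gL : forall n, n \in C -> lab (g n).

Lemma f_lab n : n \notin C -> lab (f n).
Proof.
move=> nC; have [_ fa] := mf; have [|a [b [fn fx ab]]] := fa n x0.
  by move: x0C nC; rewrite !fC => /eqP->.
apply/existsP; exists b; apply/existsP; exists a.
by rewrite !fC fn fx adj_sym ab eqxx -!fC x0C nC.
Qed.

Definition labs := undup [seq f n | n <- enum N & n \notin C].
Lemma labsP y : (y \in labs) = lab y.
Proof.
rewrite mem_undup; apply/mapP/idP.
  by case=> n; rewrite mem_filter => /andP[nC _] ->; apply: f_lab.
case/existsP=> n /existsP[n' /and4P[_ n'C _ /eqP <-]]; exists n' => //.
by rewrite mem_filter n'C mem_enum.
Qed.
Lemma lab_node y : lab y -> exists2 n, n \notin C & f n = y.
Proof. by case/existsP=> n /existsP[n' /and4P[_ n'C _ /eqP <-]]; exists n'. Qed.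
Lemma lab_ne y : lab y -> y != e.
Proof. by case/lab_node=> n; rewrite fC => h <-. Qed.
Definition rep y := odflt x0 [pick n | f n == y].
Lemma repP y : lab y -> f (rep y) = y.
Proof. by case/lab_node=> n _ fn; rewrite /rep; case: pickP => [m /eqP//|/(_ n)]; rewrite fn eqxx. Qed.

Lemma labs_size : size labs <= 3.
Proof.
have := pl.1 f (x0 :: map rep labs) mf; rewrite /= size_map => H; apply: H.
have -> : map f (map rep labs) = labs.
  rewrite -map_comp -[RHS]map_id; apply/eq_in_map => y; rewrite labsP; exact: repP.
rewrite undup_uniq andbT labsP; apply/negP => /lab_ne; by rewrite -fC x0C.
Qed.

(** A discrete Sperner argument, with [g] telling where the leg of each node lands. With three
    labels, [C] is recoloured by [g] and [planar_like] gives a three-coloured triangle touching [C];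
    with two, a walk in [C] replaces the triangle. *)
Lemma core : exists qs : seq N, [/\ 0 < size qs <= 3, (forall q, q \in qs -> q \in C),
  (forall q q', q \in qs -> q' \in qs -> (q == q') || adj q q') &
  forall y, lab y -> (exists2 q, q \in qs & g q = y) \/
     (exists q m', [/\ q \in qs, m' \notin C, adj q m' & f m' = y])].
Proof.
have sing q : q \in C -> (forall y, lab y -> g q = y \/ exists m', [/\ m' \notin C, adj q m' & f m' = y]) ->
   exists qs : seq N, [/\ 0 < size qs <= 3, (forall q, q \in qs -> q \in C),
  (forall q q', q \in qs -> q' \in qs -> (q == q') || adj q q') &
  forall y, lab y -> (exists2 q, q \in qs & g q = y) \/
     (exists q m', [/\ q \in qs, m' \notin C, adj q m' & f m' = y])].
  move=> qC H; exists [:: q]; split=> //.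
  - by move=> q'; rewrite inE => /eqP->.
  - by move=> q1 q2; rewrite !inE => /eqP-> /eqP->; rewrite eqxx.
  - by move=> y /H[<-|[m' [h1 h2 h3]]]; [left; exists q; rewrite ?mem_head | right; exists q, m'; rewrite mem_head].
have := labs_size; have := undup_uniq [seq f n | n <- enum N & n \notin C]; rewrite -/labs.
case E: labs => [|a [|b [|d [|? ?]]]] // un _.
- by apply: (sing x0) => // y; rewrite -labsP E in_nil.
- apply: (sing x0) => // y; rewrite -labsP E inE => /eqP->; left.
  by have := gL x0C; rewrite -labsP E inE => /eqP.
- have la : lab a by rewrite -labsP E mem_head.
  have lb : lab b by rewrite -labsP E !inE eqxx orbT.
  have g2 q : q \in C -> g q = a \/ g q = b.
    by move/gL; rewrite -labsP E !inE => /orP[]/eqP; [left|right].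
  have l2 y : lab y -> y = a \/ y = b by rewrite -labsP E !inE => /orP[]/eqP; [left|right].
  case/existsP: (la) => n1 /existsP[m1 /and4P[n1C m1C a1 /eqP f1]].
  case/existsP: (lb) => n2 /existsP[m2 /and4P[n2C m2C a2 /eqP f2]].
  case: (g2 _ n1C) => g1; last first.
    by apply: (sing n1) => // y /l2[->|->]; [right; exists m1 | left].
  case: (g2 _ n2C) => g2'.
    by apply: (sing n2) => // y /l2[->|->]; [left | right; exists m2].
  suff [x [y [xC yC xy gx gy]]] : exists x y, [/\ x \in C, y \in C, adj x y, g x = a & g y = b].
    exists [:: x; y]; split=> //.
    + by move=> q; rewrite !inE => /orP[]/eqP->.
    + by move=> q q'; rewrite !inE => /orP[]/eqP-> /orP[]/eqP->; rewrite ?eqxx // ?xy ?orbT // adj_sym xy orbT.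
    + by move=> z /l2[->|->]; left; [exists x | exists y]; rewrite ?inE ?eqxx ?orbT.
  (* The label is [a] at one end of this walk and [b] at the other, so it changes across some
     edge. *)
  have /connectP[p] := cC n1C n2C.
  elim: p n1 {m1C a1} n1C g1 => [|z p IH] n1 n1C g1 /=.
    by move=> _ en; move: g2' un; rewrite en g1 /= inE => ->; rewrite eqxx.
  case/andP=> /and3P[nz _ zC] pz lz; case: (g2 _ zC) => gz; first by apply: (IH z).
  by exists n1, z.
- have [la lb ld] : [/\ lab a, lab b & lab d] by rewrite -!labsP E !inE !eqxx !orbT.
  pose h n := if n \in C then g n else f n.
  have ex : f x0 = e by apply/eqP; rewrite -fC.
  have all4 n : f n \in [:: e; a; b; d].
    case: (boolP (n \in C)); first by rewrite fC inE => ->.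
    by move/f_lab; rewrite -labsP E => h1; rewrite in_cons h1 orbT.
  have [||n|n|x [y [z [[hx hy hz] xy yz xz some]]]] := pl.2 f h x0 (rep a) (rep b) (rep d) mf.
  - rewrite !repP // ex /= -/(uniq [:: a; b; d]) un andbT.
    by rewrite !inE !negb_or !(eq_sym e) !lab_ne.
  - by rewrite !repP // ex.
  - by rewrite ex -fC /h => /negbTE->.
  - by rewrite ex !repP // /h => /eqP; rewrite -fC => nC; rewrite nC -E labsP; apply: gL.
  rewrite ex -!fC in some; rewrite !repP // in hx hy hz.
  exists [seq q <- [:: x; y; z] | q \in C]; split.
  - rewrite size_filter (leq_trans (count_size _ _)) // andbT -has_count.
    by rewrite /= orbF.
  - by move=> q; rewrite mem_filter => /andP[].
  - move=> q q'; rewrite !mem_filter => /andP[_ hq] /andP[_ hq']; move: hq hq'; rewrite !inE.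
    by case/or3P => /eqP-> /or3P[]/eqP->; rewrite ?eqxx // ?xy ?yz ?xz ?orbT // adj_sym ?xy ?yz ?xz orbT.
  (* A corner of the triangle outside [C] is dropped: it belongs to the required class itself and is
     adjacent to a corner that is kept. *)
  - have cov u v w y0 : h u = y0 -> adj u v -> adj u w -> u \in [:: x; y; z] -> v \in [:: x; y; z] -> w \in [:: x; y; z] ->
        [|| u \in C, v \in C | w \in C] ->
        (exists2 q, q \in [seq q <- [:: x; y; z] | q \in C] & g q = y0) \/
        (exists q m', [/\ q \in [seq q <- [:: x; y; z] | q \in C], m' \notin C, adj q m' & f m' = y0]).
      rewrite /h => hu uv uw iu iv iw; case: (boolP (u \in C)) hu => uC hu.
        by left; exists u; rewrite // mem_filter uC iu.
      rewrite orFb => /orP[vC|wC]; right; [exists v, u | exists w, u]; (split; [by rewrite mem_filter ?vC ?wC ?iv ?iw | by [] | by rewrite adj_sym | by []]).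
    move=> y0; rewrite -labsP E !inE => /or3P[]/eqP->.
    + by apply: (cov x y z); rewrite ?inE ?eqxx ?orbT.
    + by apply: (cov y x z); rewrite ?inE ?eqxx ?orbT // 1?adj_sym // orbCA.
    + apply: (cov z x y); rewrite ?inE ?eqxx ?orbT // 1?adj_sym //.
      by move: some; case: (z \in C); rewrite ?orbT ?orbF.
Qed.
End Core.

Lemma cardU_le (T : finType) (X Y : {set T}) : #|X :|: Y| <= #|X| + #|Y|.
Proof. by have [] := leq_card_setU X Y. Qed.

(** * Independence of the state at time [e] from the later rounds *)

Section Agree.
Variables (N V B : finType) (hub : V -> N) (orig : B -> V) (bof : V -> B) (tl : B -> seq N).
Hypothesis bofP : forall v, orig (bof v) = v.
Variables (c1 c2 : N -> nat) (e : nat).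
Hypothesis ag : forall n, c1 n = c2 n \/ e <= c1 n /\ e <= c2 n.

Lemma ag_U n : alive c1 e n = alive c2 e n.
Proof. by rewrite /alive; case: (ag n) => [->|[-> ->]]. Qed.
Lemma ag_suf b n : live_suf hub orig tl c1 e b n = live_suf hub orig tl c2 e b n.
Proof. by rewrite /live_suf; congr (_ && _); apply: eq_all => m; rewrite ag_U. Qed.
Lemma ag_pre b n : live_pre hub orig tl c1 e b n = live_pre hub orig tl c2 e b n.
Proof. by rewrite /live_pre; congr (_ && _); apply: eq_all => m; rewrite ag_U. Qed.
Lemma ag_whole b : all_live hub orig tl c1 e b = all_live hub orig tl c2 e b.
Proof. by apply: eq_all => m; rewrite ag_U. Qed.
Lemma ag_xs v : xs hub orig tl c1 v = xs hub orig tl c2 v \/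
  e <= xs hub orig tl c1 v /\ e <= xs hub orig tl c2 v.
Proof.
have [n1 s1 e1] := xs_ex hub tl bofP c1 v.
have [n2 s2 e2] := xs_ex hub tl bofP c2 v.
have h1 := xs_le bofP c1 s2; have h2 := xs_le bofP c2 s1.
by case: (ag n1) (ag n2) => [a1|[a1 a1']] [a2|[a2 a2']]; lia.
Qed.
Lemma ag_own v : (xs hub orig tl c1 v < e) = (xs hub orig tl c2 v < e).
Proof. by case: (ag_xs v) => [->|[]]; rewrite // !ltnNge => -> ->. Qed.
(** Whether a bundle is an anchor matters only for owned vertices, whose round is below [e], where
    the two assignments agree. *)
Lemma ag_isanc b : is_anchor hub orig bof tl c1 e b = is_anchor hub orig bof tl c2 e b.
Proof.
rewrite /is_anchor ag_own; case: ltnP => ow; rewrite ?andbF // !andbT; congr (_ == _).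
rewrite /anc; congr odflt; apply: eq_pick => b'; congr (_ && _); apply: eq_has => n.
case: (ag_xs (orig b)) => [->|[_ h]]; last by rewrite ltnNge h in ow.
by case: (ag n) => [->//|[h1 h2]]; apply/eqP/eqP => h; move: ow h1 h2; rewrite -h; lia.
Qed.
End Agree.

Section Step.
Variables (N V B : finType) (adj : rel N) (hub : V -> N) (orig : B -> V) (bof : V -> B) (tl : B -> seq N).
Local Notation pb := (bundle_nodes hub orig tl).
Local Notation star := (star hub orig tl).
Local Notation term := (term hub orig tl).
Local Notation cross := (crossing hub orig tl).
Variables (r : V) (lev : V -> nat) (k : nat) (c : N -> nat) (e : nat).
Local Notation suf := (live_suf hub orig tl c e).
Local Notation pre := (live_pre hub orig tl c e).
Local Notation whole := (all_live hub orig tl c e).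
Local Notation xs := (xs hub orig tl c).
Local Notation isanc := (is_anchor hub orig bof tl c e).
Local Notation act := (act hub orig bof tl c e).
Local Notation cov := (cov hub orig tl c e).
Local Notation U := (alive c e).
Hypothesis pathP : forall b, path adj (hub (orig b)) (tl b).
Hypothesis pb_uniq : forall b, uniq (pb b).
Hypothesis bofP : forall v, orig (bof v) = v.
Hypothesis adj_sym : symmetric adj.
Hypothesis adj_conn : forall x y, connect adj x y.
Hypothesis pl : planar_like adj.
Hypothesis crossk : forall b, #|[set b' | cross b b']| <= k.
Hypothesis lev_step : forall v, v != r -> exists v1 x p, [/\ lev v = (lev v1).+1, star v x, path adj x p,
  star v1 (last x p) & forall n, n \in p -> n != last x p -> forall w, ~~ star w n].
Hypothesis r_owned : xs r < e.
Hypothesis cle : forall n, c n <= e.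
Hypothesis some_c : exists n0, c n0 < e.
Variables (x0 : N) (C : {set N}) (f : N -> nat).
Hypothesis x0C : x0 \in C.
Hypothesis cC : conn adj C.
Hypothesis CU : forall n, n \in C -> c n = e.
Hypothesis Cmax : forall n n', n \in C -> adj n n' -> c n' = e -> n' \in C.
Hypothesis mf : minor_model adj f.
Hypothesis fC : forall n, (n \in C) = (f n == e).
Hypothesis fc : forall n n', n \in C -> n' \notin C -> adj n n' -> f n' = c n'.

Definition near l v := (lev v <= l.+1) && (l <= (lev v).+1).
Lemma stayC (K : pred N) a b : (forall n, K n -> U n) -> connect (within adj K) a b -> a \in C -> b \in C.
Proof.
move=> KU /connectP[p]; elim: p a => [|z p IH] u /=; first by move=> _ ->.
case/andP=> /and3P[uz _ zK] pz ln uC; apply: (IH z pz ln).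
by apply: Cmax uC uz _; apply/eqP; rewrite eqn_leq cle; apply: KU.
Qed.

(* [X] is the union of at most three legs and the completions of their anchors. *)
Lemma step : exists (X : {set N}) (W S P FS Q : {set B}),
  [/\ X != set0, X \subset C, conn adj X &
    (forall n n', n \in C -> n' \notin C -> adj n n' -> exists m m', [/\ m \in X, m' \notin C, adj m m' & f m' = f n'])] /\
  [/\ (forall b n, b \in W -> n \in pb b -> n \in X),
    (forall b, b \in S -> [/\ ~~ whole b, U (term b) & forall n, suf b n -> n \in X]),
    (forall b, b \in P -> [/\ isanc b, U (hub (orig b)) & forall n, pre b n -> n \in X]) &
    (forall n, n \in X -> act n -> cov W S P n)] /\
  [/\ (forall a g n, a \in FS -> isanc g -> suf a n -> pre g n -> g \in P),
    (forall a, a \in S -> isanc a -> (a \in FS) || (a \in P)),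
    (forall a b m n, isanc a -> a \in S :|: P -> ~~ whole b -> ~~ isanc b ->
      suf a m -> suf b m -> pre a n -> suf b n -> (a \in S) && (a \in P)),
    (forall n v, n \in X -> e <= xs v -> star v n -> exists2 a, a \in Q & n \in pb a) &
    (forall l, #|[set b in Q | near l (orig b)]| <= 39 + 9 * k)].
Proof.
have UC n : n \in C -> U n by move/CU; rewrite /alive => ->.
(* A leg is fixed for every node at once, so that its landing round can serve as the colouring [g]
   in [core]. *)
pose D := (nat * {set N} * ({set B} * {set B} * {set B} * {set B} * {set B}) * nat)%type.
pose LD t (d : D) := let: (y, K, (W, FS, PF, SG, Fr), L) := d in
  ldata adj hub orig bof tl lev c e t y K W FS PF SG Fr L.
have [d dP] : exists d : N -> D, forall t, LD t (d t).
  apply: (fin_all_exists (P := LD)) => t.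
  have [y [K [W [FS [PF [SG [Fr [L h]]]]]]]] := leg_all pathP pb_uniq bofP adj_sym adj_conn lev_step r_owned t some_c.
  by exists (y, K, (W, FS, PF, SG, Fr), L).
pose yd t := (d t).1.1.1; pose Kd t := (d t).1.1.2.
pose Wd t := (d t).1.2.1.1.1.1; pose FSd t := (d t).1.2.1.1.1.2; pose PFd t := (d t).1.2.1.1.2.
pose SGd t := (d t).1.2.1.2; pose Frd t := (d t).1.2.2; pose Ld t := (d t).2.
have {}dP t : ldata adj hub orig bof tl lev c e t (yd t) (Kd t) (Wd t) (FSd t) (PFd t) (SGd t) (Frd t) (Ld t).
  by have := dP t; rewrite /LD /yd /Kd /Wd /FSd /PFd /SGd /Frd /Ld; case: (d t) => [[[y K] [[[[W FS] PF] SG] Fr]] L].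
have tK t : t \in C -> t \in Kd t.
  move=> tC; case/orP: (ld_t (dP t)) => // /andP[_ /eqP ct].
  by have := ld_y (dP t); rewrite -ct CU // ltnn.
have KC t n : t \in C -> n \in Kd t -> n \in C.
  by move=> tC nK; apply: stayC (ld_conn (dP t) (tK _ tC) nK) tC; exact: (ld_U (dP t)).
have gL n : n \in C -> lab adj f C (yd n).
  move=> nC; case: (ld_land (dP n)) => [K0|[m [m' [mK mm' cm']]]].
    by have := tK _ nC; rewrite K0 inE.
  have mC := KC _ _ nC mK; have m'C : m' \notin C.
    by apply/negP => /CU; rewrite cm' => ey; have := ld_y (dP n); rewrite ey ltnn.
  by apply/existsP; exists m; apply/existsP; exists m'; rewrite mC m'C mm' (fc mC m'C mm') cm' eqxx.
have [qs [szq qC qadj qlab]] := core adj_sym pl mf fC x0C cC gL.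
have [q0 q0s] : exists q0, q0 \in qs by case: (qs) szq => // a s; exists a; rewrite mem_head.
pose K0 := \bigcup_(q <- qs) Kd q; pose W := \bigcup_(q <- qs) Wd q.
pose FS := \bigcup_(q <- qs) FSd q; pose PF := \bigcup_(q <- qs) PFd q.
pose SG := \bigcup_(q <- qs) SGd q.
(* A connector of the anchor [g]: a cut non-anchor whose live tail meets both live ends of [g].
   Taking this tail keeps the round connected when both ends of [g] are taken. *)
pose con g := odflt g [pick b | [&& ~~ whole b, ~~ isanc b, [exists m, suf g m && suf b m] & [exists n, pre g n && suf b n]]].
pose hascon g := [exists b, [&& ~~ whole b, ~~ isanc b, [exists m, suf g m && suf b m] & [exists n, pre g n && suf b n]]].
have conP g : hascon g -> [/\ ~~ whole (con g), ~~ isanc (con g), exists2 m, suf g m & suf (con g) m & exists2 n, pre g n & suf (con g) n].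
  move=> /existsP[b hb]; rewrite /con; case: pickP => [b' /and4P[h1 h2 /existsP[m /andP[m1 m2]] /existsP[n /andP[n1 n2]]]|/(_ b)].
    by split=> //; [exists m | exists n].
  by rewrite hb.
(* [Ab] holds the anchors whose heads are forced by feet; [Db] holds the anchors in use that have a
   connector and hence give up both ends. The tails of connectors enter [S] but not [FS], and
   connectors are not anchors, so no rule has to be applied again. *)
pose Ab := [set g | isanc g && [exists a, exists n, [&& a \in FS, suf a n & pre g n]]].
pose HA := [set g | isanc g && (g \in FS :|: Ab :|: PF)].
pose Db := [set g in HA | hascon g].
pose CN := con @: Db.
pose S := FS :|: Db :|: CN; pose P := Ab :|: PF :|: Db.
pose sset b := [set n | suf b n]; pose pset b := [set n | pre b n].
pose K1 := K0 :|: \bigcup_(g in Ab) pset g.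
pose X := K1 :|: \bigcup_(g in Db) (sset g :|: sset (con g) :|: pset g).
pose Q := W :|: FS :|: PF :|: SG :|: (S :|: P).
have isanc_c g : isanc g -> ~~ whole g by apply: isanc_cut.
have inqs (F : N -> {set B}) b : b \in \bigcup_(q <- qs) F q -> exists2 q, q \in qs & b \in F q.
  by move/mem_bigU_seq.
have qsin (T : finType) (F : N -> {set T}) b q : q \in qs -> b \in F q -> b \in \bigcup_(q <- qs) F q.
  by move=> h1 h2; apply/mem_bigU_seq; exists q.
have K0C n : n \in K0 -> n \in C by case/mem_bigU_seq => q /qC qC' /KC; apply.
have FSP b : b \in FS -> [/\ ~~ whole b, U (term b) & forall n, suf b n -> n \in K0].
  case/inqs => q qq /(ld_FS (dP q))[h1 h2 h3]; split=> // n /h3; exact: qsin.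
have PFP b : b \in PF -> [/\ isanc b, U (hub (orig b)) & forall n, pre b n -> n \in K0].
  case/inqs => q qq /(ld_PF (dP q))[h1 h2 h3]; split=> // n /h3; exact: qsin.
have AbP b : b \in Ab -> [/\ isanc b, U (hub (orig b)) & exists2 n, pre b n & n \in K0].
  rewrite inE => /andP[ia /existsP[a /existsP[n /and3P[aF sn pn]]]]; split=> //.
    exact: pre_U (pre_hub pn).
  by exists n => //; have [_ _] := FSP _ aF; apply.
have preh b n : pre b n -> pre b (hub (orig b)) by apply: pre_hub.
have cK0 : conn adj K0.
  have -> : K0 = Kd q0 :|: \bigcup_(q | q \in qs) Kd q.
    apply/setP => n; rewrite inE; apply/mem_bigU_seq/orP.
      by case=> q qq nq; right; apply/bigcupP; exists q.
    by case=> [nq|/bigcupP[q qq nq]]; [exists q0 | exists q].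
  apply: conn_bigU => // [|q qq]; first exact: ld_conn (dP q0).
  split; first exact: ld_conn (dP q).
  by exists q0, q; split; [exact/tK/qC | exact/tK/qC | exact: qadj].
have cK1 : conn adj K1.
  apply: conn_bigU => // g /AbP[_ _ [n pn nK]]; split; first exact: pre_conn.
  by exists n, n; rewrite inE pn eqxx.
have DbP b : b \in Db -> [/\ isanc b, U (hub (orig b)) & U (term b)] /\ [/\ hascon b, ~~ whole (con b), ~~ isanc (con b) & U (term (con b))].
  rewrite inE => /andP[]; rewrite inE => /andP[ia _] hc.
  have [h1 h2 [m m1 m2] [n n1 n2]] := conP _ hc.
  by split; split=> //; [exact: pre_U (pre_hub n1) | exact: suf_U (suf_term pb_uniq m1) | exact: suf_U (suf_term pb_uniq m2)].
have cX : conn adj X.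
  apply: conn_bigU => // g gD; have [[ia _ _] [hc h1 h2 _]] := DbP _ gD.
  have [_ _ [m m1 m2] [n n1 n2]] := conP _ hc.
  split.
    apply: (connU adj_sym (a := n) (b := n)); rewrite ?inE ?n1 ?n2 ?orbT ?eqxx //; last exact: pre_conn.
    by apply: (connU adj_sym (a := m) (b := m)); rewrite ?inE ?m1 ?m2 ?eqxx //; apply: suf_conn.
  move: gD; rewrite inE => /andP[]; rewrite inE => /andP[_]; rewrite !in_setU => /orP[/orP[gF|gA]|gP] _.
  - exists m, m; rewrite eqxx; split=> //; last by rewrite !inE m1.
    by have [_ _ h] := FSP _ gF; rewrite in_setU (h _ m1).
  - exists n, n; rewrite eqxx; split=> //; last by rewrite !inE n1 orbT.
    by rewrite in_setU; apply/orP; right; apply/bigcupP; exists g; rewrite // inE.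
  - exists n, n; rewrite eqxx; split=> //; last by rewrite !inE n1 orbT.
    by have [_ _ h] := PFP _ gP; rewrite in_setU (h _ n1).
have XU n : n \in X -> U n.
  rewrite !in_setU => /orP[/orP[/K0C/UC //|]|] /bigcupP[g gA]; first by rewrite inE => /pre_U.
  by rewrite !inE => /orP[/orP[]|]; [apply: suf_U | apply: suf_U | apply: pre_U].
have K0X n : n \in K0 -> n \in X by move=> h; rewrite !in_setU h.
have q0X : q0 \in X by apply/K0X/mem_bigU_seq; exists q0 => //; exact/tK/qC.
have XC n : n \in X -> n \in C.
  by move=> nX; apply: stayC (cX _ _ q0X nX) (qC _ q0s).
have SX b : b \in S -> [/\ ~~ whole b, U (term b) & forall n, suf b n -> n \in X].
  rewrite !in_setU => /orP[/orP[/FSP[h1 h2 h3]|bD]|/imsetP[g gD ->]].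
  - by split=> // n /h3/K0X.
  - have [[ia _ h2] _] := DbP _ bD; split; rewrite ?isanc_c // => n sn.
    by rewrite in_setU; apply/orP; right; apply/bigcupP; exists b; rewrite // !inE sn.
  - have [_ [_ h1 _ h2]] := DbP _ gD; split=> // n sn.
    by rewrite in_setU; apply/orP; right; apply/bigcupP; exists g; rewrite // !inE sn orbT.
have PX b : b \in P -> [/\ isanc b, U (hub (orig b)) & forall n, pre b n -> n \in X].
  rewrite !in_setU => /orP[/orP[bA|/PFP[h1 h2 h3]]|bD].
  - have [h1 h2 _] := AbP _ bA; split=> // n sn.
    by rewrite !in_setU; apply/orP; left; apply/orP; right; apply/bigcupP; exists b; rewrite // !inE.
  - by split=> // n /h3/K0X.
  - have [[ia h2 _] _] := DbP _ bD; split=> // n sn.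
    by rewrite in_setU; apply/orP; right; apply/bigcupP; exists b; rewrite // !inE sn !orbT.
exists X, W, S, P, FS, Q; split; [|split].
- split=> //.
  + by apply/set0Pn; exists q0.
  + by apply/subsetP.
  + move=> n n' nC n'C nn'; have ln' : lab adj f C (f n').
      by apply/existsP; exists n; apply/existsP; exists n'; rewrite nC n'C nn' eqxx.
    case: (qlab _ ln') => [[q qq <-]|[q [m' [qq m'C qm' <-]]]]; last first.
      by exists q, m'; split=> //; apply/K0X/mem_bigU_seq; exists q => //; exact/tK/qC.
    case: (ld_land (dP q)) => [Ke|[m [m' [mK mm' cm']]]].
      by have := tK _ (qC _ qq); rewrite Ke inE.
    have mC := KC _ _ (qC _ qq) mK; have m'C : m' \notin C.
      by apply/negP => /CU; rewrite cm' => ey; have := ld_y (dP q); rewrite ey ltnn.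
    by exists m, m'; split=> //; [apply/K0X/mem_bigU_seq; exists q | rewrite (fc mC m'C mm')].
- split=> //.
  + by move=> b n /inqs[q qq bW] nb; apply: K0X; apply: qsin qq _; exact: (ld_W (dP q) bW nb).
  + move=> n; rewrite !in_setU => /orP[/orP[/mem_bigU_seq[q qq nq] an|/bigcupP[g gA]]|/bigcupP[g gD]].
    * have /existsP[a ha] := ld_act (dP q) nq an; apply/existsP; exists a.
      case/or3P: ha => /andP[h1 h2].
      - by rewrite (qsin _ _ _ _ qq h1) h2.
      - by rewrite !in_setU (qsin _ _ _ _ qq h1) h2 /= orbT.
      - by rewrite !in_setU (qsin _ _ _ _ qq h1) h2 !orbT.
    * by rewrite in_set => pn _; apply/existsP; exists g; rewrite pn !in_setU gA !orbT.
    * rewrite !in_setU !in_set => /orP[/orP[]|] sn _; apply/existsP.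
      - by exists g; rewrite sn !in_setU gD !orbT.
      - by exists (con g); rewrite sn !in_setU imset_f // !orbT.
      - by exists g; rewrite sn !in_setU gD !orbT.
- split.
  + move=> a g n aF ia sn pn; rewrite !in_setU; apply/orP; left; apply/orP; left.
    by rewrite in_set ia; apply/existsP; exists a; apply/existsP; exists n; rewrite aF sn pn.
  + move=> a; rewrite !in_setU => /orP[/orP[->//|->]|/imsetP[g gD ->]]; rewrite ?orbT //.
    by have [_ [_ _ /negbTE-> _]] := DbP _ gD.
  + move=> a b m n ia aSP cb nb sm bm pn bn.
    have hc : hascon a.
      by apply/existsP; exists b; rewrite cb nb /=; apply/andP; split; apply/existsP; [exists m; rewrite sm | exists n; rewrite pn].
    suff aD : a \in Db by rewrite !in_setU aD !orbT.
    have HD : a \in FS :|: Ab :|: PF -> a \in Db by move=> h; rewrite in_set hc in_set ia h.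
    case: (boolP (a \in Db)) => // aD; suff : a \in FS :|: Ab :|: PF by move/HD; rewrite (negbTE aD).
    move: aSP; rewrite !in_setU (negbTE aD) !orbF => /orP[/orP[aF|/imsetP[g gD ea]]|aP].
    * by rewrite aF.
    * by have [_ [_ _ nc _]] := DbP _ gD; rewrite -ea ia in nc.
    * by rewrite -orbA aP orbT.
  + move=> n v; rewrite !in_setU => /orP[/orP[/mem_bigU_seq[q qq nq] ev sv|/bigcupP[g gA]]|/bigcupP[g gD]].
    * have [a aQ na] := ld_unt (dP q) nq ev sv; exists a => //; move: aQ.
      by rewrite !in_setU => /orP[/orP[/orP[]|]|] h; rewrite (qsin _ _ _ _ qq h) ?orbT.
    * by rewrite in_set => pn _ _; exists g; [rewrite !in_setU gA !orbT | exact: pre_pb pn].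
    * rewrite !in_setU !in_set => /orP[/orP[]|] sn _ _.
      - by exists g; [rewrite !in_setU gD !orbT | exact: suf_pb sn].
      - by exists (con g); [rewrite !in_setU imset_f // !orbT | exact: suf_pb sn].
      - by exists g; [rewrite !in_setU gD !orbT | exact: pre_pb sn].
  (* The bound is 27 + 3k + 2(6 + 3k): three legs with nine bundles each near a level, the forced
     anchors [Ab], the anchors [Db] and their connectors. *)
  + move=> l; pose R q := Wd q :|: FSd q :|: PFd q :|: SGd q.
    have q3 : size qs <= 3 by case/andP: szq.
    (* Per leg: two fresh bundles on each of three consecutive levels, and three other bundles. *)
    have cR : #|\bigcup_(q <- qs) [set b in R q | near l (orig b)]| <= size qs * 9.
      apply: card_bigU_seq => q _.
      pose Fl l' := [set b in Frd q | lev (orig b) == l'].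
      have sub : [set b in R q | near l (orig b)] \subset Fl l.-1 :|: Fl l :|: Fl l.+1 :|: ((Wd q :\: Frd q) :|: FSd q :|: PFd q :|: SGd q).
        apply/subsetP => b; rewrite !in_set /near => /andP[bR /andP[l1 l2]].
        case: (boolP (b \in Frd q)) => bF /=; last by move: bR; rewrite ?in_setU => ->; rewrite ?orbT.
        apply/orP; left; move: (lev (orig b)) l1 l2 => i; clear; lia.
      apply: leq_trans (subset_leq_card sub) _.
      have := ld_ft (dP q); have := ld_fr (dP q) l.-1; have := ld_fr (dP q) l; have := ld_fr (dP q) l.+1.
      rewrite -/(Fl l.-1) -/(Fl l) -/(Fl l.+1).
      have := cardU_le (Fl l.-1 :|: Fl l :|: Fl l.+1) ((Wd q :\: Frd q) :|: FSd q :|: PFd q :|: SGd q).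
      have := cardU_le (Fl l.-1 :|: Fl l) (Fl l.+1); have := cardU_le (Fl l.-1) (Fl l).
      lia.
    have cFS : #|FS| <= 3.
      by apply: leq_trans (card_bigU_seq (m := 1) _) _ => [q _|]; [exact: ld_FS1 (dP q) | rewrite muln1].
    have cPF : #|PF| <= 3.
      by apply: leq_trans (card_bigU_seq (m := 1) _) _ => [q _|]; [exact: ld_PF1 (dP q) | rewrite muln1].
    (* A head forced by a foot crosses that foot, and there are at most three feet. *)
    have cAb : #|Ab| <= 3 * k.
      apply: leq_trans (_ : #|\bigcup_(a in FS) [set g | cross a g]| <= _).
        apply/subset_leq_card/subsetP => g; rewrite in_set => /andP[ia /existsP[a /existsP[n /and3P[aF sn pn]]]].
        apply/bigcupP; exists a => //; have [ca _ _] := FSP _ aF.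
        rewrite in_set /crossing; apply/andP; split.
          by apply: contraNneq ca => ga; rewrite ga in pn; apply: suf_pre_whole sn pn.
        apply/existsP; exists n; rewrite (suf_pb sn) (pre_pb pn) /=.
        by apply: contra ca => /andP[_ /eqP en]; apply: suf_hub_whole; rewrite -en.
      apply: leq_trans (card_bigU (m := k) _) _ => [a _|]; first exact: crossk.
      by rewrite leq_mul2r cFS orbT.
    have cHA : #|HA| <= 6 + 3 * k.
      apply: leq_trans (_ : #|FS :|: Ab :|: PF| <= _).
        by apply/subset_leq_card/subsetP => g; rewrite in_set => /andP[].
      have := cardU_le (FS :|: Ab) PF; have := cardU_le FS Ab; lia.
    have cDb : #|Db| <= 6 + 3 * k.
      by apply: leq_trans cHA; apply/subset_leq_card/subsetP => g; rewrite in_set => /andP[].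
    have cCN : #|CN| <= 6 + 3 * k by apply: leq_trans (leq_imset_card _ _) cDb.
    have sub : [set b in Q | near l (orig b)] \subset \bigcup_(q <- qs) [set b in R q | near l (orig b)] :|: Ab :|: Db :|: CN.
      apply/subsetP => b; rewrite in_set => /andP[bQ nl].
      have inR q : q \in qs -> b \in R q -> b \in \bigcup_(q <- qs) [set b in R q | near l (orig b)].
        by move=> qq bR; apply: qsin qq _; rewrite in_set bR nl.
      rewrite !in_setU.
      suff : [|| b \in \bigcup_(q <- qs) [set b in R q | near l (orig b)], b \in Ab, b \in Db | b \in CN].
        by case/or4P => ->; rewrite ?orbT.
      move: bQ; rewrite /Q !in_setU => /orP[/orP[/orP[/orP[]|]|]|/orP[/orP[/orP[]|]|/orP[/orP[]|]]].
      * by case/inqs=> q qq h; rewrite (inR q) // !in_setU h.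
      * by case/inqs=> q qq h; rewrite (inR q) // !in_setU h ?orbT.
      * by case/inqs=> q qq h; rewrite (inR q) // !in_setU h ?orbT.
      * by case/inqs=> q qq h; rewrite (inR q) // !in_setU h ?orbT.
      * by case/inqs=> q qq h; rewrite (inR q) // !in_setU h ?orbT.
      * by move=> ->; rewrite ?orbT.
      * by move=> ->; rewrite ?orbT.
      * by move=> ->; rewrite ?orbT.
      * by case/inqs=> q qq h; rewrite (inR q) // !in_setU h ?orbT.
      * by move=> ->; rewrite ?orbT.
    apply: leq_trans (subset_leq_card sub) _.
    set Rq := \bigcup_(q <- qs) _ in cR *.
    have := cardU_le (Rq :|: Ab :|: Db) CN; have := cardU_le (Rq :|: Ab) Db; have := cardU_le Rq Ab.
    move: cR cAb cDb cCN q3; clear; lia.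
Qed.
End Step.

(** * Iterating the rounds *)

Section Process.
Variables (N V B : finType) (adj : rel N) (hub : V -> N) (orig : B -> V) (bof : V -> B) (tl : B -> seq N).
Local Notation pb := (bundle_nodes hub orig tl).
Local Notation star := (star hub orig tl).
Local Notation term := (term hub orig tl).
Local Notation cross := (crossing hub orig tl).
Variables (r : V) (lev : V -> nat) (k : nat).
Local Notation xs := (xs hub orig tl).
Local Notation uses := (uses hub orig bof tl).
Hypothesis pathP : forall b, path adj (hub (orig b)) (tl b).
Hypothesis pb_uniq : forall b, uniq (pb b).
Hypothesis bofP : forall v, orig (bof v) = v.
Hypothesis adj_sym : symmetric adj.
Hypothesis adj_conn : forall x y, connect adj x y.
Hypothesis pl : planar_like adj.
Hypothesis crossk : forall b, #|[set b' | cross b b']| <= k.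
Hypothesis lev_step : forall v, v != r -> exists v1 x p, [/\ lev v = (lev v1).+1, star v x, path adj x p,
  star v1 (last x p) & forall n, n \in p -> n != last x p -> forall w, ~~ star w n].
Hypothesis lev_near : forall a b n, n \in pb a -> n \in pb b -> lev (orig a) <= (lev (orig b)).+1.

Definition comp (c : N -> nat) e x := [set n | connect (within adj (alive c e)) x n].
(** What the final argument needs of round [e]. It depends on [c] only through values up to [e], so
    later rounds preserve it. *)
Definition Good e c := [/\ exists W S P FS, uses c e W S P FS,
  exists x, c x = e,
  forall x y, c x = e -> c y = e -> connect (within adj (alive c e)) x y,
  forall s : seq nat, uniq s -> (forall y, y \in s -> y < e /\ exists x n n',
    [/\ c x = e, connect (within adj (alive c e)) x n, adj n n' & c n' = y]) -> size s <= 3 &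
  forall l, #|[set v | (xs c v == e) && (lev v == l)]| <= 6 * (2 * k + 3) ^ 2].
(** Every remaining component is a class of a complete minor model in which the nodes next to it are
    labelled by their rounds. *)
Definition Inv e c := forall x, c x = e -> exists f, [/\ minor_model adj f,
  forall n, (n \in comp c e x) = (f n == e) &
  forall n n', n \in comp c e x -> n' \notin comp c e x -> adj n n' -> f n' = c n'].
Definition Run e c := [/\ forall n, c n <= e, Inv e c, forall e', e' < e -> Good e' c & 0 < e -> xs c r = 0].

Lemma uses_ext e c1 c2 W S P FS : (forall n, c1 n = c2 n \/ e < c1 n /\ e < c2 n) ->
  uses c1 e W S P FS -> uses c2 e W S P FS.
Proof.
move=> ag1; have ag n : c1 n = c2 n \/ e <= c1 n /\ e <= c2 n.
  by case: (ag1 n) => [->|[h1 h2]]; [left | right; split; apply: ltnW].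
have ce n : (c1 n == e) = (c2 n == e) by case: (ag1 n) => [->//|[h1 h2]]; rewrite !gtn_eqF.
have ceP n : c1 n = e <-> c2 n = e by split=> /eqP h; apply/eqP; move: h; rewrite ce.
case=> u1 u2 u3 u4 u5 u6 u7; split.
- by move=> b /u1; apply: sub_all => n; rewrite ce.
- move=> b /u2[h1 h2 h3]; rewrite -(ag_whole _ _ _ ag) -(ag_U ag); split=> // n.
  by rewrite -(ag_suf _ _ _ ag) => /h3/ceP.
- move=> b /u3[h1 h2 h3]; rewrite -(ag_isanc _ _ bofP ag) -(ag_U ag); split=> // n.
  by rewrite -(ag_pre _ _ _ ag) => /h3/ceP.
- move=> b n /ceP cn; rewrite -(ag_suf _ _ _ ag) -(ag_pre _ _ _ ag) -(ag_isanc _ _ bofP ag) -(ag_own _ _ bofP ag) => /(u4 _ _ cn)[a ha].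
  by exists a; rewrite -(ag_suf _ _ _ ag) -(ag_pre _ _ _ ag).
- move=> a g n; rewrite -(ag_isanc _ _ bofP ag) -(ag_suf _ _ _ ag) -(ag_pre _ _ _ ag); exact: u5.
- move=> a; rewrite -(ag_isanc _ _ bofP ag); exact: u6.
- move=> a b m n; rewrite -!(ag_isanc _ _ bofP ag) -!(ag_suf _ _ _ ag) -!(ag_pre _ _ _ ag) -(ag_whole _ _ _ ag); exact: u7.
Qed.

Lemma Good_ext e c1 c2 : (forall n, c1 n = c2 n \/ e < c1 n /\ e < c2 n) -> Good e c1 -> Good e c2.
Proof.
move=> ag1; have ag n : c1 n = c2 n \/ e <= c1 n /\ e <= c2 n.
  by case: (ag1 n) => [->|[h1 h2]]; [left | right; split; apply: ltnW].
have ce n : (c1 n == e) = (c2 n == e) by case: (ag1 n) => [->//|[h1 h2]]; rewrite !gtn_eqF.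
have ceP n : c1 n = e <-> c2 n = e by split=> /eqP h; apply/eqP; move: h; rewrite ce.
have cn x n : connect (within adj (alive c1 e)) x n -> connect (within adj (alive c2 e)) x n.
  by apply: within_sub => m; rewrite (ag_U ag).
case=> [[W [S [P [FS us]]]] [x cx] h3 h4 h5]; split.
- by exists W, S, P, FS; apply: uses_ext us.
- by exists x; apply/ceP.
- by move=> a b /ceP ca /ceP cb; apply/cn/h3.
- move=> s us' H; apply: h4 us' _ => y /H[ye [a [n [n' [ca an nn' cy]]]]]; split=> //.
  exists a, n, n'; split=> //; first exact/ceP.
    by apply: within_sub an => m; rewrite -(ag_U ag).
  by case: (ag n') => [->//|[_ h]]; move: h; rewrite cy leqNgt ye.
- move=> l; rewrite (_ : [set v | _] = [set v | (xs c1 v == e) && (lev v == l)]) //.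
  apply/setP => v; rewrite !inE; congr (_ && _).
  have ag' n : c1 n = c2 n \/ e.+1 <= c1 n /\ e.+1 <= c2 n := ag1 n.
  by case: (ag_xs hub tl bofP ag' v) => [->//|[a1 a2]]; rewrite !gtn_eqF.
Qed.

(** Unconsumed nodes always carry the current time as provisional round, so the survivors of round
    [e] move to [e.+1]. *)
Definition upd c (X : {set N}) e n := if n \in X then e else if c n == e then e.+1 else c n.

Section Upd.
Variables (c : N -> nat) (e : nat) (X : {set N}) (x0 : N) (f : N -> nat).
Hypothesis rn : Run e c.
Hypothesis cx0 : c x0 = e.
Let C := comp c e x0.
Hypothesis mf : minor_model adj f.
Hypothesis fC : forall n, (n \in C) = (f n == e).
Hypothesis fc : forall n n', n \in C -> n' \notin C -> adj n n' -> f n' = c n'.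
Hypothesis X0 : X != set0.
Hypothesis XC : X \subset C.
Hypothesis cX : conn adj X.
Hypothesis touch : forall n n', n \in C -> n' \notin C -> adj n n' -> exists m m', [/\ m \in X, m' \notin C, adj m m' & f m' = f n'].
Let c' := upd c X e.

Lemma cle n : c n <= e. Proof. by case: rn. Qed.
Lemma UE n : alive c e n = (c n == e). Proof. by rewrite /alive eqn_leq cle. Qed.
Lemma compC x n : c x = e -> n \in comp c e x -> c n = e.
Proof. by move=> cx; rewrite inE => /within_in; rewrite !UE cx eqxx => /(_ isT)/eqP. Qed.
Lemma comp_conn c0 e0 x : conn adj (comp c0 e0 x).
Proof.
apply: (@conn_star _ _ adj_sym _ x) => n; rewrite inE => /connectP[p pp ->].
elim/last_ind: p pp => [|p z IH]; first by move=> _; exact: connect0.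
rewrite rcons_path last_rcons => /andP[pp /= /and3P[lz h1 h2]].
apply: connect_trans (IH pp) (connect1 _); rewrite /within /= lz !inE.
have cl : connect (within adj (alive c0 e0)) x (last x p) by apply/connectP; exists p.
by rewrite cl; apply: connect_trans cl (connect1 _); rewrite /within /= lz h1.
Qed.
Lemma comp_max x n n' : c x = e -> n \in comp c e x -> adj n n' -> c n' = e -> n' \in comp c e x.
Proof.
move=> cx nC nn' cn'; move: (nC); rewrite !inE => h; apply: connect_trans h (connect1 _).
by rewrite /within /= nn' !UE cn' (compC cx nC) eqxx.
Qed.
Lemma XU n : n \in X -> c n = e. Proof. by move/(subsetP XC)/(compC cx0). Qed.
Lemma c'E n : (c' n == e) = (n \in X).
Proof.
rewrite /c' /upd; case: ifP => nX; first by rewrite eqxx.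
by case: (eqVneq (c n) e) => [_|/negbTE //]; rewrite gtn_eqF.
Qed.
Lemma ag_e n : c n = c' n \/ e <= c n /\ e <= c' n.
Proof.
rewrite /c' /upd; case: ifP => nX; first by right; rewrite (XU nX).
by case: (eqVneq (c n) e) => [->|_]; [right | left].
Qed.
Lemma c'le n : c' n <= e.+1.
Proof. by rewrite /c' /upd; case: ifP => _ //; case: eqP => // _; apply: leqW (cle n). Qed.
Lemma c'U n : alive c' e.+1 n = (c n == e) && (n \notin X).
Proof.
rewrite /alive /c' /upd; case: ifP => nX /=; first by rewrite ltnn andbF.
by rewrite andbT; case: eqP => [_|/eqP h]; rewrite ?leqnn // ltnNge cle.
Qed.
Lemma comp_out_lt n n' : n \in C -> n' \notin C -> adj n n' -> c n' < e.
Proof.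
move=> nC n'C nn'; rewrite ltn_neqAle cle andbT; apply: contra n'C => /eqP.
exact: comp_max cx0 nC nn'.
Qed.
Lemma c'lt n : c n < e -> c' n = c n.
Proof.
move=> h; rewrite /c' /upd; case: ifP => [/XU e1|_]; first by rewrite e1 ltnn in h.
by rewrite ltn_eqF.
Qed.

(** A new component inside [C] gets its model from [model_step]; any other component is unchanged
    and only needs its label shifted. *)
Lemma Inv_upd : Inv e.+1 c'.
Proof.
have [cl IV gd _] := rn.
move=> x cx'; have /andP[/eqP cx xX] : (c x == e) && (x \notin X) by rewrite -c'U /alive cx'.
set C1 := comp c' e.+1 x.
have xC1 : x \in C1 by rewrite inE connect0.
have C1U n : n \in C1 -> c n = e /\ n \notin X.
  by rewrite inE => /within_in; rewrite !c'U cx eqxx xX => /(_ isT)/andP[/eqP].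
have C1max n n' : n \in C1 -> adj n n' -> c n' = e -> n' \notin X -> n' \in C1.
  move=> nC nn' cn' n'X; move: (nC); rewrite !inE => h; apply: connect_trans h (connect1 _).
  have [cn nX] := C1U n nC.
  by rewrite /within /= nn' !c'U cn' cn nX n'X eqxx.
have C1sub n : n \in C1 -> n \in comp c e x.
  by rewrite !inE; apply: within_sub => m; rewrite c'U UE => /andP[].
case: (boolP (x \in C)) => xC; last first.
  have [g [mg gC gc]] := IV x cx.
  have sep n : n \in comp c e x -> n \notin C.
    rewrite in_set => nx; apply: contra xC; rewrite /C !in_set => nC.
    by apply: connect_trans nC _; rewrite (within_csym adj_sym).
  have E : C1 =i comp c e x.
    move=> n; apply/idP/idP; first exact: C1sub.
    move=> nx; rewrite inE; apply: within_sub (comp_conn (_ : x \in comp c e x) nx) => [m mx|]; last first.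
      by rewrite inE connect0.
    rewrite c'U (compC cx mx) eqxx /=; apply: contra (sep m mx); exact: (subsetP XC).
  (* Larger labels are sent to [e], which reserves [e.+1] for the component itself. *)
  pose h y := if y == e then e.+1 else if y < e then y else e.
  exists (h \o g); split; first exact: minor_merge.
    move=> n; rewrite E gC /h /=; case: (ltngtP (g n) e) => h1; rewrite ?eqxx //.
      by rewrite ltn_eqF // ltnW.
    by rewrite ltn_eqF.
  move=> n n'; rewrite !E => nC n'C nn'; rewrite /= (gc n) //.
  have cn' : c n' < e.
    by rewrite ltn_neqAle cle andbT; apply: contra n'C => /eqP; apply: comp_max nn'.
  by rewrite /h (ltn_eqF cn') cn' c'lt.
have C1C n : n \in C1 -> n \in C.
  by move/C1sub; rewrite /C !in_set in xC * => h; apply: connect_trans xC h.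
exists (fun n => if n \in C1 then e.+1 else if n \in C then e else
   if [exists m, exists m', [&& m \in C1, m' \notin C, adj m m' & f m' == f n]] then f n else e); split.
- apply: (@model_step _ _ adj_sym f C C1 X e) => //.
  + by apply/subsetP => n nC1; rewrite inE (C1C n nC1) andbT; case: (C1U n nC1).
  + by apply/set0Pn; exists x.
  + exact: comp_conn.
  + exact: comp_conn.
  + by move=> n n' nC1 nn' n'C; apply: C1max nC1 nn' _; apply: compC n'C.
  + by move=> n n' nC n'C nn'; rewrite (fc nC n'C nn'); exact: (comp_out_lt nC n'C nn').
- move=> n; case: ifP => nC1; first by rewrite eqxx.
  case: ifP => nC; first by rewrite ltn_eqF.
  case: ifP => [/existsP[m /existsP[m' /and4P[mC1 m'C mm' /eqP <-]]]|_]; last by rewrite ltn_eqF.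
  have mC := C1C _ mC1; rewrite (fc mC m'C mm') ltn_eqF //; apply: ltnW; rewrite ltnS.
  exact: comp_out_lt mC m'C mm'.
- move=> n n' nC1 n'C1 nn'; rewrite (negbTE n'C1); have nC := C1C _ nC1.
  case: ifP => n'C.
    case: (boolP (n' \in X)) => n'X; first by rewrite /c' /upd n'X.
    by have := C1max n n' nC1 nn' (compC cx0 n'C) n'X; rewrite (negbTE n'C1).
  rewrite ifT; last by apply/existsP; exists n; apply/existsP; exists n'; rewrite nC1 n'C nn' eqxx.
  by move/negbT: n'C => n'C; rewrite (fc nC n'C nn') c'lt //; apply: (comp_out_lt nC n'C nn').
Qed.

(** The earlier rounds seen from [X] are classes of the model, different from [C]; four of them
    would give a K5 model. *)
Lemma hop3 (s : seq nat) : uniq s -> (forall y, y \in s -> y < e /\ exists x n n',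
    [/\ c' x = e, connect (within adj (alive c' e)) x n, adj n n' & c' n' = y]) -> size s <= 3.
Proof.
move=> us H; pose rep y := odflt x0 [pick n | f n == y].
have fy y : y \in s -> exists n, f n = y.
  case/H => ye [x [n [n' [cx xn nn' cy]]]]; exists n'.
  have xC : x \in C by apply: (subsetP XC); rewrite -c'E cx.
  have nC : n \in C.
    rewrite /C !in_set in xC *; apply: connect_trans xC _; apply: within_sub xn => m.
    by rewrite (ag_U ag_e).
  have cn' : c n' < e.
    by case: (ag_e n') => [->|[_ h]]; [rewrite cy | move: h; rewrite cy leqNgt ye].
  have n'C : n' \notin C by apply/negP => /(compC cx0) e1; rewrite e1 ltnn in cn'.
  by rewrite (fc nC n'C nn') -(c'lt cn').
have := pl.1 f (x0 :: map rep s) mf; rewrite /= size_map => K; apply: K.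
have repf : map f (map rep s) = s.
  rewrite -map_comp -[RHS]map_id; apply/eq_in_map => y /fy[n fn] /=.
  by rewrite /rep; case: pickP => [m /eqP//|/(_ n)]; rewrite fn eqxx.
rewrite repf us andbT; apply/negP => /H[]; have := fC x0; rewrite /C inE connect0 => /esym/eqP->.
by rewrite ltnn.
Qed.

Lemma Run_upd : Good e c' -> xs c' r = 0 ->
  Run e.+1 c' /\ #|[set n | c' n == e.+1]| < #|[set n | c n == e]|.
Proof.
move=> gd xr; have [cl IV gds _] := rn; split.
  split=> //; [exact: c'le | exact: Inv_upd |].
  move=> e'; rewrite ltnS leq_eqVlt => /orP[/eqP->//|ee].
  apply: Good_ext (gds _ ee) => n; case: (ag_e n) => [->|[h1 h2]]; first by left.
  by right; split; apply: leq_trans ee _.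
apply: proper_card; apply/properP; split.
  by apply/subsetP => n; rewrite !inE => /eqP cn; have := c'U n; rewrite /alive cn leqnn => /esym/andP[].
have [n nX] := set0Pn _ X0; exists n; first by rewrite inE (XU nX).
by rewrite inE /c' /upd nX ltn_eqF.
Qed.

(** A vertex first hit in this round has a bundle through a node of some [a] in [Q], so it is the
    origin of [a] or of a bundle crossing [a], and sharing a node keeps its level within one of that
    of [a]. *)
Lemma width_le (Q : {set B}) l : (forall v, xs c' v = e -> exists n a, [/\ star v n, a \in Q & n \in pb a]) ->
  #|[set v | (xs c' v == e) && (lev v == l)]| <= #|[set b in Q | near lev l (orig b)]| * (k + 1).
Proof.
move=> H; apply: leq_trans (_ : #|\bigcup_(a in [set b in Q | near lev l (orig b)]) (orig a |: orig @: [set b | cross a b])| <= _).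
  apply/subset_leq_card/subsetP => v; rewrite inE => /andP[/eqP/H[n [a [/existsP[b /andP[/eqP ob nb]] aQ na]]] /eqP lv].
  apply/bigcupP; exists a.
    by rewrite inE aQ /near -lv -ob (lev_near na nb) (lev_near nb na).
  rewrite !inE; case: (eqVneq v (orig a)) => //= va; apply/imsetP; exists b => //.
  rewrite inE /crossing; apply/andP; split; first by apply: contraNneq va => e1; rewrite -ob e1.
  by apply/existsP; exists n; rewrite na nb ob eq_sym (negbTE va).
apply: card_bigU => a _; rewrite cardsU1; apply: leq_trans (leq_add (leq_b1 _) (leq_imset_card _ _)) _.
by rewrite addnC leq_add2r crossk.
Qed.
End Upd.

Lemma Run_step e c x0 : Run e c -> c x0 = e -> exists c',
  Run e.+1 c' /\ #|[set n | c' n == e.+1]| < #|[set n | c n == e]|.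
Proof.
case: (posnP e) => [->|e0] rn cx0; have [cl IV gd xr] := rn; have [f [mf fC fc]] := IV x0 cx0;
  [set C := comp c 0 x0 in fC fc | set C := comp c e x0 in fC fc].
  (* Round 0 consumes one whole bundle of the root, which is owned from then on; this is what stops
     the descent of later legs. *)
  pose b := bof r; pose X := [set n in pb b].
  have c0 n : c n = 0 by have := cl n; rewrite leqn0 => /eqP.
  have CT n : n \in C.
    by rewrite inE; apply: connect_sub (adj_conn x0 n) => a a' aa; apply: connect1; rewrite /within /= aa.
  have X0 : X != set0 by apply/set0Pn; exists (hub (orig b)); rewrite inE hub_pb.
  have XC : X \subset C by apply/subsetP.
  have cX : conn adj X by apply: conn_path.
  have tc n n' : n \in C -> n' \notin C -> adj n n' -> exists m m', [/\ m \in X, m' \notin C, adj m m' & f m' = f n'] by move=> _; rewrite CT.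
  have hX : hub r \in X by rewrite inE -(bofP r) hub_pb.
  have nX n : upd c X 0 n = 0 -> n \in pb b by move/eqP; rewrite c'E inE.
  have xr' : xs (upd c X 0) r = 0.
    apply/eqP; rewrite -leqn0; apply: leq_trans (xs_le bofP _ (star_hub hub tl bofP r)) _.
    by rewrite leqn0 c'E.
  exists (upd c X 0); apply: (Run_upd rn cx0 mf fC fc X0 XC cX tc) => //.
  split.
  - exists [set b], set0, set0, set0; split.
    + by move=> a /set1P->; apply/allP => n nb; rewrite c'E inE.
    + by move=> a; rewrite inE.
    + by move=> a; rewrite inE.
    + by move=> b' n _; rewrite /is_anchor !ltn0 !andbF.
    + by move=> a g n; rewrite inE.
    + by move=> a; rewrite inE.
    + by move=> a b' m n; rewrite /is_anchor ltn0 andbF.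
  - by exists (hub r); apply/eqP; rewrite c'E.
  - move=> x y /nX nx /nX ny; have := cX x y; rewrite !inE => /(_ nx ny); apply: within_sub => m _.
    by rewrite /alive.
  - by move=> s us H; apply: (hop3 rn cx0 mf fC fc XC us H).
  - move=> l; have H := @width_le c 0 X [set b] l.
    apply: leq_trans (H _) _ => [v xv|].
      have [n sn cn] := xs_ex hub tl bofP (upd c X 0) v.
      by exists n, b; rewrite set11; split=> //; apply: nX; rewrite cn.
    have c1 : #|[set b0 in [set b] | near lev l (orig b0)]| <= 1.
      by rewrite -(cards1 b); apply/subset_leq_card/subsetP => b0; rewrite inE => /andP[].
    by apply: leq_trans (leq_mul c1 (leqnn _)) _; nia.
have some : exists n0, c n0 < e.
  have [n _ en] := xs_ex hub tl bofP c r; exists n; by rewrite en xr.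
have ro : xs c r < e by rewrite xr.
have x0C : x0 \in C by rewrite inE connect0.
have cC : conn adj C by apply: comp_conn.
have [X [W [S [P [FS [Q [[X0 XC cX tc] [[hW hS hP hA] [h1 h2 h3 h4 h5]]]]]]]]] :=
  step pathP pb_uniq bofP adj_sym adj_conn pl crossk lev_step ro cl some x0C cC (fun n => @compC c e rn x0 n cx0) (fun n n' => @comp_max c e rn x0 n n' cx0) mf fC fc.
have ag := ag_e rn cx0 XC.
have Xe n : n \in X -> upd c X e n = e by move=> nX; apply/eqP; rewrite c'E.
have eX n : upd c X e n = e -> n \in X by move/eqP; rewrite c'E.
have xr' : xs (upd c X e) r = 0.
  by case: (ag_xs hub tl bofP ag r) => [<-|[]]; [exact: xr | rewrite leqNgt ro].
exists (upd c X e); apply: (Run_upd rn cx0 mf fC fc X0 XC cX tc) => //.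
split.
- exists W, S, P, FS; split.
  + by move=> b bW; apply/allP => n nb; apply/eqP/Xe/(hW b).
  + move=> b /hS[a1 a2 a3]; rewrite -(ag_whole _ _ _ ag) -(ag_U ag); split=> // n.
    by rewrite -(ag_suf _ _ _ ag) => /a3/Xe.
  + move=> b /hP[a1 a2 a3]; rewrite -(ag_isanc _ _ bofP ag) -(ag_U ag); split=> // n.
    by rewrite -(ag_pre _ _ _ ag) => /a3/Xe.
  + move=> b n /eX nX; rewrite -(ag_suf _ _ _ ag) -(ag_pre _ _ _ ag) -(ag_isanc _ _ bofP ag) -(ag_own _ _ bofP ag) => hb.
    have /existsP[a ha] : cov hub orig tl c e W S P n by apply: (hA n nX); apply/existsP; exists b.
    by exists a; rewrite -(ag_suf _ _ _ ag) -(ag_pre _ _ _ ag).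
  + move=> a g n; rewrite -(ag_isanc _ _ bofP ag) -(ag_suf _ _ _ ag) -(ag_pre _ _ _ ag); exact: h1.
  + move=> a; rewrite -(ag_isanc _ _ bofP ag); exact: h2.
  + move=> a b m n; rewrite -!(ag_isanc _ _ bofP ag) -!(ag_suf _ _ _ ag) -!(ag_pre _ _ _ ag) -(ag_whole _ _ _ ag); exact: h3.
- by have [n nX] := set0Pn _ X0; exists n; apply: Xe.
- move=> x y /eX nx /eX ny; apply: within_sub (cX x y nx ny) => m mX.
  by rewrite /alive Xe.
- by move=> s us H; apply: (hop3 rn cx0 mf fC fc XC us H).
- move=> l; have H := @width_le c e X Q l.
  apply: leq_trans (H _) _ => [v xv|].
    have [n sn cn] := xs_ex hub tl bofP (upd c X e) v.
    have nX : n \in X by apply: eX; rewrite cn.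
    have ev : e <= xs c v by case: (ag_xs hub tl bofP ag v) => [->|[]//]; rewrite xv.
    by have [a aQ na] := h4 n v nX ev sn; exists n, a.
  (* This is (39 + 9k)(k + 1) = 9k^2 + 48k + 39, at most 24k^2 + 72k + 54. *)
  by apply: leq_trans (leq_mul (h5 l) (leqnn _)) _; nia.
Qed.

Lemma Run0 : Run 0 (fun _ => 0).
Proof.
split=> // x _; exists (fun _ => 0); split.
- split=> a b //; move=> _; apply: connect_sub (adj_conn a b) => u v uv.
  by apply: connect1; rewrite /within /= uv.
- move=> n; rewrite inE; apply: connect_sub (adj_conn x n) => u v uv.
  by apply: connect1; rewrite /within /= uv.
- by [].
Qed.

Lemma Run_end e c : Run e c -> exists e' c', Run e' c' /\ forall n, c' n < e'.
Proof.
have [m] := ubnP #|[set n | c n == e]|; elim: m e c => // m IH e c cm rn.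
case: (pickP (fun n => c n == e)) => [x /eqP cx|no].
  have [c' [rn' lt]] := Run_step rn cx; apply: IH rn'.
  by move: cm; rewrite ltnS; apply: leq_trans.
exists e, c; split=> // n; have [cl _ _ _] := rn; by rewrite ltn_neqAle no cl.
Qed.

Theorem layered : exists (T : nat) (A : rel 'I_T.+1) (x : V -> 'I_T.+1),
  [/\ forall j y, A j y -> y < j, forall j, #|[set y | A j y]| <= 3,
    forall j y y', A j y -> A j y' -> y' < y -> A y y' &
    forall j : 'I_T.+1, 0 < j -> exists y, A j y] /\
  (forall b b', adj (term b) (term b') -> x (orig b') <= x (orig b) ->
     x (orig b') \in bag A (2 * k + 3) (x (orig b))) /\
  (forall i l, #|[set v | (x v == i) && (lev v == l)]| <= 6 * (2 * k + 3) ^ 2).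
Proof.
have [e [c [[cl IV gd _] ce]]] := Run_end Run0.
have e0 : 0 < e by apply: leq_ltn_trans (ce (hub r)).
case: e e0 cl IV gd ce => // T _ cl IV gd ce.
pose d n : 'I_T.+1 := Ordinal (ce n).
have gd' (e : 'I_T.+1) : Good e c := gd e (ltn_ord e).
have usx (e : 'I_T.+1) : exists u : {set B} * {set B} * {set B} * {set B}, uses c e u.1.1.1 u.1.1.2 u.1.2 u.2.
  by have [[W [S [P [FS us]]]] _ _ _ _] := gd' e; exists (W, S, P, FS).
have [u us] := fin_all_exists usx.
have Xc x x' : d x = d x' -> connect (within adj (alive (fun n => val (d n)) (d x))) x x'.
  by move=> dd; have [_ _ h _ _] := gd' (d x); apply: h => //; move/(congr1 val): dd.
have Xs j : exists x, d x = j.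
  by have [_ [x cx] _ _ _] := gd' j; exists x; apply: val_inj.
exists T, (hop adj d), (xo hub orig tl d); split; [split|split].
- by move=> j y; apply: hop_lt.
- move=> j; have [_ _ _ h _] := gd' j.
  have := h (map val (enum [set y | hop adj d j y])); rewrite size_map -cardE; apply.
    by rewrite map_inj_uniq ?enum_uniq //; exact: val_inj.
  move=> _ /mapP[y + ->]; rewrite mem_enum inE => /andP[yj /existsP[n /existsP[n' /and3P[/existsP[x /andP[/eqP dx xn]] nn' /eqP dn']]]].
  by split=> //; exists x, n, n'; split=> //; [rewrite -dx | rewrite -dn'].
- exact: (@hop_clique _ _ adj_sym _ _ Xc).
- exact: (@hop_ex _ _ _ _ Xs adj_conn).
- move=> b b'; apply: (hop_chain pathP pb_uniq bofP adj_sym (c := d) us crossk).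
- move=> i l; have [_ _ _ _ h] := gd' i; exact: h l.
Qed.
End Process.

Lemma bfs (V : finType) (R : rel V) r : (forall v, connect R r v) -> exists lev : V -> nat,
  (forall v, v != r -> exists2 u, R u v & lev v = (lev u).+1) /\ (forall u v, R u v -> lev v <= (lev u).+1).
Proof.
move=> cn; pose P v n := [exists t : n.-tuple V, path R r t && (last r t == v)].
have ex v : exists n, P v n.
  have /connectP[p pp ->] := cn v; exists (size p); apply/existsP; exists (in_tuple p).
  by rewrite /= pp eqxx.
have st u v n : P u n -> R u v -> P v n.+1.
  case/existsP=> t /andP[pt /eqP lt] uv; apply/existsP; exists [tuple of rcons t v].
  by rewrite /= rcons_path last_rcons eqxx pt lt uv.
exists (fun v => ex_minn (ex v)); split=> [v vr|u v uv]; last first.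
  by case: ex_minnP => n _ nm; case: ex_minnP => m Pm _; apply: nm; apply: st Pm uv.
case: ex_minnP => n /existsP[[p /= /eqP sp] /andP[pp /eqP lp]] nm.
case/lastP: p => [|p z] in sp pp lp *; first by rewrite -lp eqxx in vr.
move: sp pp lp; rewrite size_rcons rcons_path last_rcons => sp /andP[pp lz] ez; subst z.
exists (last r p) => //; case: ex_minnP => m Pm mm; apply/eqP; rewrite eqn_leq nm; last exact: st Pm lz.
rewrite -sp ltnS; apply: mm; apply/existsP; exists (in_tuple p); by rewrite /= pp eqxx.
Qed.

(** * Layering and embedding *)

Section Embedding.
Variables (N V B : finType) (adj : rel N) (hub : V -> N) (orig : B -> V) (bof : V -> B) (tl : B -> seq N).
Local Notation pb := (bundle_nodes hub orig tl).
Local Notation star := (star hub orig tl).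
Local Notation term := (term hub orig tl).
Local Notation cross := (crossing hub orig tl).
Variables (r : V) (k : nat) (E : rel V).
Hypothesis pathP : forall b, path adj (hub (orig b)) (tl b).
Hypothesis pb_uniq : forall b, uniq (pb b).
Hypothesis bofP : forall v, orig (bof v) = v.
Hypothesis adj_sym : symmetric adj.
Hypothesis adj_conn : forall x y, connect adj x y.
Hypothesis pl : planar_like adj.
Hypothesis crossk : forall b, #|[set b' | cross b b']| <= k.
Hypothesis E_graph : is_graph E.
Hypothesis E_term : forall u v, E u v -> exists b b', [/\ orig b = u, orig b' = v & adj (term b) (term b')].

Definition free n := ~~ [exists w, star w n].
(** Stars also count as neighbours when joined through nodes of no star. This makes the vertices
    connected even if the graph is not, so a single search from [r] levels all of them. *)
Definition nb v w := [exists x, exists y, [&& star v x, star w y & [|| x == y, adj x y |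
  [exists a, exists b, [&& adj x a, free a, connect (within adj free) a b & adj b y]]]]].
Definition reach v n := star v n || [exists x, exists a, [&& star v x, adj x a, free a & connect (within adj free) a n]].

Lemma reach_nb v n w n' : reach v n -> adj n n' -> star w n' -> nb v w.
Proof.
case/orP=> [sn|/existsP[x /existsP[a /and4P[h1 h2 h3 h4]]]] nn' sw; apply/existsP.
  by exists n; apply/existsP; exists n'; rewrite sn sw nn' orbT.
exists x; apply/existsP; exists n'; rewrite h1 sw; apply/or3P; constructor 3.
by apply/existsP; exists a; apply/existsP; exists n; rewrite h2 h3 h4.
Qed.
Lemma reach_free v n n' : reach v n -> free n || star v n -> adj n n' -> free n' -> reach v n'.
Proof.
move=> rn fs nn' fn'; case: (boolP (star v n)) fs => [sn _|ns /orP[fn|//]].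
  apply/orP; right; apply/existsP; exists n; apply/existsP; exists n'.
  by rewrite sn nn' fn' connect0.
move: rn; rewrite /reach (negbTE ns) => /existsP[x /existsP[a /and4P[h1 h2 h3 h4]]].
apply/orP; right; apply/existsP; exists x; apply/existsP; exists a; rewrite h1 h2 h3.
by apply: connect_trans h4 (connect1 _); rewrite /within /= nn' fn.
Qed.
Lemma nb_self_node v w n : star v n -> star w n -> nb v w.
Proof. by move=> sv sw; apply/existsP; exists n; apply/existsP; exists n; rewrite sv sw eqxx. Qed.
Lemma nb_connect v : connect nb v r.
Proof.
have /connectP[p] := adj_conn (hub v) (hub r).
have r0 : reach v (hub v) by rewrite /reach (star_hub hub tl bofP).
have f0 : free (hub v) || star v (hub v) by rewrite (star_hub hub tl bofP) orbT.
elim: p v (hub v) r0 f0 => [|z p IH] v n rn fn /=.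
  move=> _ e; have sr : star r n by rewrite -e (star_hub hub tl bofP).
  case/orP: fn => [/negP[]|sn]; first by apply/existsP; exists r.
  exact: connect1 (nb_self_node sn sr).
case/andP=> nz pz lz; case: (boolP (free z)) => fz.
  by apply: (IH v z) => //; [apply: reach_free rn fn nz fz | rewrite fz].
have /existsP[w sw] : [exists w, star w z] by rewrite -[X in is_true X]negbK.
apply: connect_trans (connect1 (reach_nb rn nz sw)) (IH w z _ _ pz lz); first by rewrite /reach sw.
by rewrite sw orbT.
Qed.

Lemma nb_walk v w : nb v w -> exists x p, [/\ star v x, path adj x p,
  star w (last x p) & forall n, n \in p -> n != last x p -> forall w, ~~ star w n].
Proof.
have fr n : free n -> forall w, ~~ star w n by move/existsPn.
case/existsP=> x /existsP[y /and3P[sx sy /or3P[/eqP e|xy|/existsP[a /existsP[b /and4P[xa fa ab by']]]]]].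
- by exists x, [::]; rewrite /= {2}e.
- by exists x, [:: y]; rewrite /= xy; split=> // n; rewrite inE => ->.
case/connectP: ab => p pp eb; exists x, (a :: rcons p y).
have all_free : forall n, n \in a :: p -> free n.
  elim: p a pp fa {xa eb} => [|z p IH] a /=; first by move=> _ fa n; rewrite inE => /eqP->.
  case/andP=> /and3P[_ _ fz] pz fa n; rewrite inE => /orP[/eqP->//|]; exact: IH pz fz n.
split=> //=.
- rewrite xa rcons_path -eb by' andbT; apply: sub_path pp => u w' /andP[]; done.
- by rewrite last_rcons.
- rewrite last_rcons => n; rewrite -rcons_cons mem_rcons inE => /orP[->//|h _]; exact: fr (all_free _ h).
Qed.

(** The three coordinates of a vertex are its round, its level, and its rank among the vertices
    sharing both. Rounds within [2 * k + 3] hops meet in a common bag, whence 'C(2k + 6, 3). *)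
Theorem system_embedding : exists (T : nat) (EW : rel 'I_T.+1) (p : nat),
  is_graph EW /\ tw_le EW ('C(2 * k + 6, 3) - 1) /\
  contained E (strong (strong EW (path_rel p)) (complete_rel (6 * (2 * k + 3) ^ 2))).
Proof.
have [lev [l1 l2]] := @bfs V (fun u v => nb v u) r (fun v => etrans (connect_rev _ _ _) (nb_connect v)).
have lev_step v : v != r -> exists v1 x p, [/\ lev v = (lev v1).+1, star v x, path adj x p,
    star v1 (last x p) & forall n, n \in p -> n != last x p -> forall w, ~~ star w n].
  by case/l1 => u /nb_walk[x [p [h1 h2 h3 h4]]] e; exists u, x, p.
have lev_near a b n : n \in pb a -> n \in pb b -> lev (orig a) <= (lev (orig b)).+1.
  by move=> na nb'; apply: l2; apply: (@nb_self_node _ _ n); apply: star_pb.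
have [T [A [x [[h1 h2 h3 h4] [ch wd]]]]] :=
  layered pathP pb_uniq bofP adj_sym adj_conn pl crossk lev_step lev_near.
exists T, (bag_rel A (2 * k + 3)), (\max_v lev v).+1.
set m := 6 * (2 * k + 3) ^ 2; have [Es Ei] := E_graph.
split; first exact: bag_rel_graph.
split; first by have := bag_tw (2 * k + 3) h1 h2 h3 h4; rewrite -addnA.
pose cl v := [set w | (x w == x v) && (lev w == lev v)].
have rk v : index v (enum (cl v)) < m.
  by apply: leq_trans (wd (x v) (lev v)); rewrite cardE index_mem mem_enum inE !eqxx.
have lp v : lev v < (\max_v lev v).+1 by rewrite ltnS leq_bigmax.
exists (fun v => (x v, Ordinal (lp v), Ordinal (rk v))).
have inj : injective (fun v => (x v, Ordinal (lp v), Ordinal (rk v))).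
  move=> u v [ex el er].
  have ec : cl u = cl v by apply/setP => w; rewrite !inE ex el.
  rewrite ec in er; have iu : u \in enum (cl v) by rewrite mem_enum inE ex el !eqxx.
  have iv : v \in enum (cl v) by rewrite mem_enum inE !eqxx.
  by rewrite -(nth_index u iu) er nth_index.
split=> // u v uv; have uNv : u != v by apply: contraTneq uv => ->; rewrite Ei.
have [b [b' [ob ob' tt]]] := E_term uv.
have su : star u (term b) by rewrite -ob; apply: star_pb; apply: term_pb.
have sv : star v (term b') by rewrite -ob'; apply: star_pb; apply: term_pb.
have nuv : nb u v by apply/existsP; exists (term b); apply/existsP; exists (term b'); rewrite su sv tt orbT.
have nvu : nb v u by apply/existsP; exists (term b'); apply/existsP; exists (term b); rewrite su sv adj_sym tt orbT.
have := l2 _ _ nuv; have := l2 _ _ nvu => d1 d2.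
rewrite /strong /=; apply/and3P; split; last by rewrite /complete_rel orbN.
  by apply: contra uNv => /eqP/inj->.
case: (eqVneq (x u, Ordinal (lp u)) (x v, Ordinal (lp v))) => //= ne; apply/andP; split.
  case: eqVneq => //= xuv; rewrite /bag_rel xuv /=; apply/existsP.
  have self i : i \in bag A (2 * k + 3) i by rewrite addn3 /= !inE eqxx.
  case/orP: (leq_total (x v) (x u)) => le.
    by exists (x u); rewrite self; have := ch b b'; rewrite ob ob'; apply.
  by exists (x v); rewrite self andbT; have := ch b' b; rewrite ob ob'; apply=> //; rewrite adj_sym.
rewrite -val_eqE /= /path_rel /=.
move: (lev u) (lev v) d1 d2 => i j d1 d2; case: (ltngtP i j) => //= h; apply/orP.
  by left; rewrite eqn_leq h.
by right; rewrite eqn_leq h.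
Qed.
End Embedding.

(** Isolated vertices receive private positions on an extension of the path, where they have no
    adjacency to respect. *)
Lemma contained_isolated (V : finType) (E : rel V) (W : finType) (EW : rel W) p m (w0 : W) :
  0 < m -> is_graph E -> contained (fun u v : {v | [exists u, E v u]} => E (val u) (val v)) (strong (strong EW (path_rel p)) (complete_rel m)) ->
  contained E (strong (strong EW (path_rel (p + #|V|))) (complete_rel m)).
Proof.
move=> m0 [Es Ei] [f [fi fe]].
pose iso (v : V) := (w0, rshift p (enum_rank v), Ordinal m0).
pose g (v : V) := if insub v is Some s then let: (w, l, i) := f s in (w, lshift #|V| l, i) else iso v.
exists g; split.
  move=> u v; rewrite /g; case: insubP => [s _ <-|_]; case: insubP => [t _ <-|_].
  - case Es' : (f s) => [[w l] i]; case Et : (f t) => [[w' l'] i'] e.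
    have e1 := congr1 (fun t => t.1.1) e; have e2 := congr1 (fun t => t.1.2) e; have e3 := congr1 snd e.
    rewrite /= in e1 e2 e3; move/eqP: e2; rewrite eq_lshift => /eqP e2.
    by congr val; apply: fi; rewrite Es' Et e1 e2 e3.
  - case: (f s) => [[w l] i] e; have /eqP := congr1 (fun t => t.1.2) e; by rewrite /= eq_lrshift.
  - case: (f t) => [[w l] i] e; have /eqP := congr1 (fun t => t.1.2) e; by rewrite /= eq_rlshift.
  - move=> e; have /eqP := congr1 (fun t => t.1.2) e; by rewrite /= eq_rshift => /eqP/enum_rank_inj.
move=> u v uv; have hu : [exists w, E u w] by apply/existsP; exists v.
have hv : [exists w, E v w] by apply/existsP; exists u; rewrite Es.
rewrite /g !insubT; have := fe (exist _ u hu) (exist _ v hv) uv.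
case: (f _) => [[w l] i]; case: (f _) => [[w' l'] i'].
rewrite /strong /= /path_rel /= !xpair_eqE /= !eq_lshift; exact.
Qed.

(** * From lattice walks to the abstract system *)

Definition interior M (x : pt) := (1 < x.1 < M.-1) && (1 < x.2 < M.-1).
Definition lat_conn (P : pred pt) := forall x y, P x -> P y -> exists p, [/\ path lat x p, last x p = y & all P p].

Lemma interior_real M x : interior M x -> real M x.
Proof. rewrite /interior /real; case: x => a b /=; case: M => [|M] /=; lia. Qed.

Lemma rev_walk (P : pred pt) x p : path lat x p -> all P (x :: p) ->
  exists q, [/\ path lat (last x p) q, last (last x p) q = x & all P q].
Proof.
move=> xp /allP aP; exists (rev (belast x p)); split.
- by rewrite rev_path; apply: sub_path xp => u v; rewrite lat_sym.
- by case: (p) => [|a q] //=; rewrite rev_cons last_rcons.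
- by rewrite all_rev; apply/allP => u /mem_belast; exact: aP.
Qed.

Lemma lat_conn_center (P : pred pt) z : (forall x, P x -> exists p, [/\ path lat x p, last x p = z & all P p]) -> P z -> lat_conn P.
Proof.
move=> H Pz x y Px Py; have [p [p1 p2 p3]] := H x Px; have [q [q1 q2 q3]] := H y Py.
have [|q' [r1 r2 r3]] := rev_walk (P := P) q1; first by rewrite /= Py.
by exists (p ++ q'); rewrite cat_path last_cat p1 p2 -q2 r1 r2 all_cat p3 r3.
Qed.

Lemma vline (P : pred pt) a i j : (forall m, minn i j <= m <= maxn i j -> P (a, m)) ->
  exists p, [/\ path lat (a, i) p, last (a, i) p = (a, j) & all P p].
Proof.
wlog ij : i j / i <= j => [W H|].
  case/orP: (leq_total i j) => ij; first exact: W.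
  have [|p [p1 p2 p3]] := W j i ij; first by move=> m; rewrite minnC maxnC; exact: H.
  have [|q] := rev_walk (P := P) p1; last by rewrite p2; exists q.
  by rewrite /= p3 andbT; apply: H; rewrite (minn_idPr ij) (maxn_idPl ij) leqnn.
rewrite (minn_idPl ij) (maxn_idPr ij); move: ij => /subnKC <-; move: (j - i) => d.
elim: d i => [|d IH] i H; first by exists [::]; rewrite addn0.
have [|p [p1 p2 p3]] := IH i.+1; first by move=> m /andP[h1 h2]; apply: H; rewrite (ltnW h1) addnS -addSn.
exists ((a, i.+1) :: p); rewrite /= p1 p2 p3 addnS addSn; split=> //.
  by rewrite /lat /lat1 /= !eqxx ?orbT.
by rewrite andbT; apply: H; rewrite leqnSn addnS ltnS leq_addr.
Qed.
Lemma hline (P : pred pt) a i j : (forall m, minn i j <= m <= maxn i j -> P (m, a)) ->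
  exists p, [/\ path lat (i, a) p, last (i, a) p = (j, a) & all P p].
Proof.
pose sw (x : pt) : pt := (x.2, x.1) => H.
have sl x y : lat (sw x) (sw y) = lat x y.
  by case: x y => x1 x2 [y1 y2]; rewrite /lat /lat1 /sw /= -!pair_eqE /pair_eq /=; lia.
have [p [p1 p2 p3]] := @vline (fun x => P (sw x)) a i j H.
exists (map sw p); rewrite -[(i, a)]/(sw (a, i)) last_map p2 all_map; split=> //.
by rewrite path_map; apply: sub_path p1 => x y; rewrite /relpre /= sl.
Qed.

Lemma box_conn (P1 P2 : pred nat) : (forall i j m, P1 i -> P1 j -> i <= m <= j -> P1 m) ->
  (forall i j m, P2 i -> P2 j -> i <= m <= j -> P2 m) -> lat_conn (fun x => P1 x.1 && P2 x.2).
Proof.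
move=> c1 c2 [a b] [a' b'] /= /andP[h1 h2] /andP[h1' h2'].
have mm (P : pred nat) i j m : (forall i j m, P i -> P j -> i <= m <= j -> P m) -> P i -> P j -> minn i j <= m <= maxn i j -> P m.
  move=> c Pi Pj hm; case/orP: (leq_total i j) => ij.
    by apply: (c i j) => //; move: hm; rewrite (minn_idPl ij) (maxn_idPr ij).
  by apply: (c j i) => //; move: hm; rewrite (minn_idPr ij) (maxn_idPl ij).
have [|p [p1 p2 p3]] := @hline (fun x => P1 x.1 && P2 x.2) b a a'.
  by move=> m hm /=; rewrite h2 andbT; apply: mm hm.
have [|q [q1 q2 q3]] := @vline (fun x => P1 x.1 && P2 x.2) a' b b'.
  by move=> m hm /=; rewrite h1' /=; apply: mm hm.
by exists (p ++ q); rewrite cat_path last_cat p2 p1 q1 q2 all_cat p3 q3.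
Qed.

Lemma ring_conn M : 1 < M -> lat_conn (fun x => real M x && ~~ interior M x).
Proof.
move=> M1; pose P x := real M x && ~~ interior M x; rewrite -/P.
have PE a b : P (a, b) = [&& 0 < a < M, 0 < b < M & [|| a == 1, b == 1, a == M.-1 | b == M.-1]].
  rewrite /P /real /interior /=; case: M M1 @P => // M _ _ /=; lia.
have P11 : P (1, 1) by rewrite PE M1.
have h1 b : P (1, b) -> exists p, [/\ path lat (1, b) p, last (1, b) p = (1, 1) & all P p].
  rewrite PE => hb; apply: vline => m hm; rewrite PE M1 /=; lia.
have h2 a : P (a, 1) -> exists p, [/\ path lat (a, 1) p, last (a, 1) p = (1, 1) & all P p].
  rewrite PE => hb; apply: hline => m hm; rewrite PE M1 /= orbT andbT; move: hb hm; clear -M1; lia.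
apply: (lat_conn_center _ P11) => -[a b] Pab; move: (Pab); rewrite PE => /and3P[ha hb /or4P[]/eqP e].
- by rewrite e in Pab *; apply: h1.
- by rewrite e in Pab *; apply: h2.
- have [|p [p1 p2 p3]] := @vline P a b 1; first by move=> m hm; rewrite PE e eqxx !orbT andbT; lia.
  have [|q [q1 q2 q3]] := h2 a; first by rewrite PE e eqxx !orbT andbT; lia.
  by exists (p ++ q); rewrite cat_path last_cat p1 p2 q1 q2 all_cat p3 q3.
- have [|p [p1 p2 p3]] := @hline P b a 1; first by move=> m hm; rewrite PE e eqxx !orbT andbT; lia.
  have [|q [q1 q2 q3]] := h1 b; first by rewrite PE M1 hb.
  by exists (p ++ q); rewrite cat_path last_cat p1 p2 q1 q2 all_cat p3 q3.
Qed.

Section Lattice.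
Variables (V B : finType) (orig : B -> V) (bof : V -> B) (k M : nat) (E : rel V) (r : V).
Variables (H : V -> pred pt) (Z : B -> pred pt) (cw : B -> seq pt) (cx zx : B -> pt) (Xr : rel B).
Hypothesis M1 : 1 < M.
Hypothesis bofP : forall v, orig (bof v) = v.
Hypothesis E_graph : is_graph E.
Hypothesis H_int : forall v x, H v x -> interior M x.
Hypothesis Z_int : forall b x, Z b x -> interior M x.
Hypothesis cw_int : forall b x, x \in cx b :: cw b -> interior M x.
Hypothesis H_disj : forall v w x, H v x -> H w x -> v = w.
Hypothesis Z_disj : forall b d x, Z b x -> Z d x -> b = d.
Hypothesis HZ_disj : forall v b x, H v x -> ~~ Z b x.
Hypothesis H_conn : forall v, lat_conn (H v).
Hypothesis Z_conn : forall b, lat_conn (Z b).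
Hypothesis cw_path : forall b, path lat (cx b) (cw b).
Hypothesis cx_H : forall b, H (orig b) (cx b).
Hypothesis cw_Z : forall b, Z b (last (cx b) (cw b)).
Hypothesis E_lat : forall u v, E u v -> exists b b' z z', [/\ orig b = u, orig b' = v, Z b z, Z b' z' & lat z z'].
Hypothesis Xk : forall b, #|[set b' | (b' != b) && Xr b b']| <= k.
Hypothesis cr_pix : forall b b' x, b' != b -> x \in cx b :: cw b -> x \in cx b' :: cw b' ->
  Xr b b' || (orig b == orig b') && H (orig b) x.
Hypothesis cr_H : forall b b' x x' w, b' != b -> x \in cx b :: cw b -> x' \in cx b' :: cw b' -> H w x -> H w x' ->
  Xr b b' || (orig b == orig b') && (w == orig b).
Hypothesis cr_Z : forall b b' x x' d, b' != b -> x \in cx b :: cw b -> x' \in cx b' :: cw b' -> Z d x -> Z d x' -> Xr b b'.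

(** The four kinds of contracted nodes: the ring, a hub box, a terminal region, and a single
    remaining pixel. *)
Definition label := (option V + (B + pt))%type.
Definition lbl (x : pt) : label :=
  if ~~ interior M x then inl None else
  if [pick v | H v x] is Some v then inl (Some v) else
  if [pick b | Z b x] is Some b then inr (inl b) else inr (inr x).

Lemma lbl_H v x : H v x -> lbl x = inl (Some v).
Proof.
move=> h; rewrite /lbl (H_int h) /=; case: pickP => [w /H_disj/(_ h) -> //|/(_ v)].
by rewrite h.
Qed.
Lemma lbl_Z b x : Z b x -> lbl x = inr (inl b).
Proof.
move=> h; rewrite /lbl (Z_int h) /=; case: pickP => [w hw|_]; first by have := HZ_disj b hw; rewrite h.
by case: pickP => [d hd|/(_ b)]; [rewrite (Z_disj hd h) | rewrite h].
Qed.
Lemma lbl_eq x y : lbl x = lbl y -> [\/ ~~ interior M x && ~~ interior M y, exists2 v, H v x & H v y,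
  exists2 b, Z b x & Z b y | x = y].
Proof.
rewrite /lbl; case: (boolP (interior M x)) => /= ix; case: (boolP (interior M y)) => /= iy;
  do ?[by constructor 1]; (do 4 ?case: pickP => [? ?|?]) => // -[] *; subst;
  by [constructor 4 | constructor 2; eexists; eassumption | constructor 3; eexists; eassumption].
Qed.

Definition cells : seq pt := [seq x <- [seq (nat_of_ord p.1, nat_of_ord p.2) | p : 'I_M * 'I_M] | real M x].
Lemma cellsP x : (x \in cells) = real M x.
Proof.
rewrite mem_filter andb_idr // => /andP[/andP[_ h1] /andP[_ h2]].
by apply/mapP; exists (Ordinal h1, Ordinal h2); rewrite ?mem_enum //; case: x h1 h2.
Qed.
Definition labels := [seq lbl x | x <- cells].
Definition node := seq_sub labels.
Lemma lbl_labels x : real M x -> lbl x \in labels.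
Proof. by rewrite -cellsP => h; apply: map_f. Qed.
Lemma real11 : real M (1, 1). Proof. by rewrite /real M1. Qed.
Definition ring0 : node := SeqSub (lbl_labels real11).
Definition cell_node (x : pt) : node := insubd ring0 (lbl x).
Lemma cell_nodeE x : real M x -> val (cell_node x) = lbl x.
Proof. by move=> h; rewrite /cell_node val_insubd lbl_labels. Qed.
Lemma cell_node_eq x y : real M x -> real M y -> (cell_node x = cell_node y) <-> (lbl x = lbl y).
Proof. by move=> hx hy; rewrite -(cell_nodeE hx) -(cell_nodeE hy); split=> [->|/val_inj]. Qed.
Definition node_adj : rel node := fun a b => (a != b) &&
  has (fun x => has (fun y => [&& lat x y, cell_node x == a & cell_node y == b]) cells) cells.
Lemma node_adjP a b : node_adj a b <->
  a != b /\ exists x y, [/\ real M x, real M y, lat x y, cell_node x = a & cell_node y = b].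
Proof.
split.
  case/andP=> ab /hasP[x hx /hasP[y hy /and3P[xy /eqP ea /eqP eb]]]; split=> //.
  by exists x, y; rewrite -!cellsP.
case=> ab [x [y [hx hy xy ea eb]]]; rewrite /node_adj ab; apply/hasP; exists x; rewrite ?cellsP //.
by apply/hasP; exists y; rewrite ?cellsP // xy ea eb !eqxx.
Qed.
Lemma node_adj_sym : symmetric node_adj.
Proof.
suff h a b : node_adj a b -> node_adj b a by move=> a b; apply/idP/idP; apply: h.
move/node_adjP=> [ab [x [y [hx hy xy ea eb]]]]; apply/node_adjP; rewrite eq_sym; split=> //.
by exists y, x; rewrite lat_sym.
Qed.
Lemma node_surj n : exists2 x, real M x & cell_node x = n.
Proof.
have /mapP[x hx e] := valP n; rewrite cellsP in hx; exists x => //.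
by apply: val_inj; rewrite cell_nodeE.
Qed.
Lemma node_walk (Q : pred node) x p : path lat x p -> all (real M) (x :: p) ->
  (forall y, y \in x :: p -> Q (cell_node y)) -> connect (within node_adj Q) (cell_node x) (cell_node (last x p)).
Proof.
elim: p x => [|y p IH] x /=; first by move=> _ _ _; exact: connect0.
case/andP=> xy py /and3P[rx ry rp] HQ; apply: connect_trans (IH y py _ _); last first.
- by move=> z zp; apply: HQ; rewrite inE zp orbT.
- by rewrite /= ry.
case: (eqVneq (cell_node x) (cell_node y)) => [->|ne]; first exact: connect0.
apply: connect1; rewrite /within /=; apply/and3P; split; last 2 first.
- by apply: HQ; rewrite mem_head.
- by apply: HQ; rewrite !inE eqxx orbT.
by apply/node_adjP; split=> //; exists x, y.
Qed.
Lemma node_conn x y : connect node_adj x y.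
Proof.
have [a ra <-] := node_surj x; have [b rb <-] := node_surj y.
have iv (i j m : nat) : 0 < i < M -> 0 < j < M -> i <= m <= j -> 0 < m < M.
  by move=> /andP[i0 _] /andP[_ jM] /andP[im mj]; rewrite (leq_trans i0 im) (leq_ltn_trans mj jM).
have [p [p1 p2 p3]] := box_conn iv iv ra rb.
rewrite -p2; apply: connect_sub (@node_walk predT a p p1 _ _) => //; last by rewrite /= ra.
by move=> u v /and3P[uv _ _]; exact: connect1.
Qed.
Lemma node_fibre x y : real M x -> real M y -> cell_node x = cell_node y ->
  exists p, [/\ path lat x p, last x p = y & all (fun v => real M v && (cell_node v == cell_node x)) p].
Proof.
move=> rx ry /(cell_node_eq rx ry) e.
have fin (P : pred pt) : lat_conn P -> P x -> P y -> (forall z, P z -> real M z && (lbl z == lbl x)) ->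
    exists p, [/\ path lat x p, last x p = y & all (fun v => real M v && (cell_node v == cell_node x)) p].
  move=> cP Px Py HP; have [p [p1 p2 p3]] := cP x y Px Py; exists p; split=> //.
  apply: sub_all p3 => z /HP/andP[rz /eqP lz]; rewrite rz; apply/eqP.
  by apply/(cell_node_eq rz rx).
case: (lbl_eq e) => [/andP[ix iy]|[v hx hy]|[b hx hy]|->].
- apply: (fin _ (ring_conn M1)); rewrite ?rx ?ry ?ix ?iy // => z /andP[-> iz].
  by rewrite /lbl iz ix eqxx.
- by apply: (fin _ (@H_conn v)) => // z hz; rewrite (interior_real (H_int hz)) (lbl_H hz) (lbl_H hx) eqxx.
- by apply: (fin _ (@Z_conn b)) => // z hz; rewrite (interior_real (Z_int hz)) (lbl_Z hz) (lbl_Z hx) eqxx.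
- by exists [::].
Qed.
Lemma node_planar : planar_like node_adj.
Proof.
apply: (@board_planar _ _ M cell_node ring0 M1) => //.
- move=> x ix; rewrite /cell_node; apply: val_inj; rewrite val_insubd /=.
  have -> : lbl (1, 1) = lbl x by rewrite /lbl /interior /= ix.
  by case: ifP => //; rewrite /lbl /interior /= ix.
- exact: node_adjP.
- exact: node_fibre.
Qed.

Definition hubn v := cell_node (cx (bof v)).
Definition Sb b := [seq cell_node x | x <- cx b :: cw b].
Lemma cw_real b x : x \in cx b :: cw b -> real M x.
Proof. by move/cw_int/interior_real. Qed.
Lemma hubnE b : hubn (orig b) = cell_node (cx b).
Proof.
apply/cell_node_eq; try by apply: (cw_real (b := _)); exact: mem_head.
by rewrite (lbl_H (cx_H b)) (@lbl_H (orig b)) // -{1}(bofP (orig b)) cx_H.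
Qed.
Lemma H_node v x : H v x -> cell_node x = hubn v.
Proof.
move=> h; rewrite -(bofP v) hubnE; apply/cell_node_eq; first exact: interior_real (H_int h).
  by apply: cw_real (mem_head _ _).
by rewrite (lbl_H h) (lbl_H (cx_H _)) bofP.
Qed.

(** Contracting the pixel walk may repeat nodes. Shortening removes repetitions and only uses nodes
    already visited, so it creates no new crossing. *)
Lemma bundle_path b : exists tl : seq node, [/\ path node_adj (hubn (orig b)) tl, uniq (hubn (orig b) :: tl),
  last (hubn (orig b)) tl = cell_node (last (cx b) (cw b)) & {subset hubn (orig b) :: tl <= Sb b}].
Proof.
have : connect (within node_adj (fun n => n \in Sb b)) (cell_node (cx b)) (cell_node (last (cx b) (cw b))).
  apply: node_walk; [exact: cw_path | by apply/allP => x /cw_real | by move=> y yc; apply: map_f].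
rewrite hubnE; case/connectP=> p0 p0p ->.
have [p pp up _] := shortenP p0p; exists p; split=> //.
  by apply: sub_path pp => u v /and3P[].
move=> n; rewrite inE => /orP[/eqP->|]; first by apply: map_f; rewrite mem_head.
elim: p (cell_node (cx b)) pp {up} => [|z p IH] u //= /andP[/and3P[_ _ hz] pz].
by rewrite inE => /orP[/eqP->//|]; exact: IH pz.
Qed.

Theorem lattice_embedding : exists (T : nat) (EW : rel 'I_T.+1) (p : nat),
  is_graph EW /\ tw_le EW ('C(2 * k + 6, 3) - 1) /\
  contained E (strong (strong EW (path_rel p)) (complete_rel (6 * (2 * k + 3) ^ 2))).
Proof.
have [tl tlP] := fin_all_exists bundle_path.
have lastE b z : Z b z -> term hubn orig tl b = cell_node z.
  move=> hz; have [_ _ e _] := tlP b; rewrite /term e; apply/cell_node_eq.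
  - by apply: cw_real (mem_last _ _).
  - exact: interior_real (Z_int hz).
  - by rewrite (lbl_Z hz) (lbl_Z (cw_Z b)).
apply: (@system_embedding _ V B node_adj hubn orig bof tl r k E) => //.
- by move=> b; have [] := tlP b.
- by move=> b; have [] := tlP b.
- exact: node_adj_sym.
- exact: node_conn.
- exact: node_planar.
- move=> b; apply: leq_trans (Xk b); apply/subset_leq_card/subsetP => b'; rewrite !inE /crossing.
  case/andP=> bb' /existsP[n /and3P[nb nb' hn]]; rewrite bb' /=.
  have [_ _ _ sub] := tlP b; have [_ _ _ sub'] := tlP b'.
  have /mapP[x xc ex] := sub _ nb; have /mapP[x' xc' ex'] := sub' _ nb'.
  have rx := cw_real xc; have rx' := cw_real xc'.
  have e : lbl x = lbl x' by apply/cell_node_eq => //; rewrite -ex -ex'.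
  case: (lbl_eq e) => [/andP[ix _]|[w h1 h2]|[d h1 h2]|xx].
  + by rewrite (cw_int xc) in ix.
  + case/orP: (cr_H bb' xc xc' h1 h2) => // /andP[oo /eqP wo].
    by case/negP: hn; rewrite oo ex (H_node h1) wo eqxx.
  + exact: (cr_Z bb' xc xc' h1 h2).
  + rewrite -xx in xc'; case/orP: (cr_pix bb' xc xc') => // /andP[oo h1].
    by case/negP: hn; rewrite oo ex (H_node h1) eqxx.
- move=> u v uv; have [b [b' [z [z' [ob ob' hz hz' zz]]]]] := E_lat uv; exists b, b'; split=> //.
  rewrite (lastE _ _ hz) (lastE _ _ hz'); apply/node_adjP; split; last first.
    by exists z, z'; split=> //; apply: interior_real; [exact: Z_int hz | exact: Z_int hz'].
  apply/eqP => /(cell_node_eq (interior_real (Z_int hz)) (interior_real (Z_int hz'))).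
  rewrite (lbl_Z hz) (lbl_Z hz') => -[bb]; have [_ Ei] := E_graph.
  by move: uv; rewrite -ob -ob' bb Ei.
Qed.
End Lattice.

Local Open Scope R_scope.

(** * From the drawing to lattice walks *)

(** The maximum norm, for which neighbourhoods are squares of pixels. *)
Definition close (d : R) (p q : point) := Rabs (p.1 - q.1) < d /\ Rabs (p.2 - q.2) < d.

Lemma close_sym d p q : close d p q -> close d q p.
Proof. by move=> [h1 h2]; split; rewrite Rabs_minus_sym. Qed.
Lemma close_trans d d' p q s : close d p q -> close d' q s -> close (d + d') p s.
Proof.
have tri a b c e e' : Rabs (a - b) < e -> Rabs (b - c) < e' -> Rabs (a - c) < e + e'.
  by move=> h h'; have := Rabs_triang (a - b) (b - c); rewrite (_ : a - b + (b - c) = a - c); [lra | ring].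
by move=> [h1 h2] [h1' h2']; split; [apply: tri h1 h1' | apply: tri h2 h2'].
Qed.
Lemma close_le d d' p q : d <= d' -> close d p q -> close d' p q.
Proof. by move=> dd [h1 h2]; split; lra. Qed.
Lemma close_refl d p : 0 < d -> close d p p.
Proof. by move=> d0; split; rewrite Rminus_diag Rabs_R0. Qed.

Lemma continuity_near f u eps : continuity f -> 0 < eps ->
  exists2 d, 0 < d & forall x, Rabs (x - u) < d -> Rabs (f x - f u) < eps.
Proof.
move=> cf e0; have [d [d0 H]] := cf u eps e0; exists d => // x xu.
case: (Req_dec x u) => [->|ne]; first by rewrite Rminus_diag Rabs_R0.
apply: (H x); split=> //; split=> //; exact: not_eq_sym.
Qed.
Lemma curve_near c u eps : is_curve c -> 0 < eps ->
  exists2 d, 0 < d & forall x, Rabs (x - u) < d -> close eps (c x) (c u).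
Proof.
move=> [c1 c2] e0; have [d1 p1 H1] := continuity_near u c1 e0; have [d2 p2 H2] := continuity_near u c2 e0.
exists (Rmin d1 d2); first exact: Rmin_pos.
move=> x xu; have := Rmin_l d1 d2; have := Rmin_r d1 d2 => m1 m2.
by split; [apply: H1 | apply: H2]; lra.
Qed.

Lemma point_sep (p q : point) : p <> q -> exists2 e, 0 < e & ~ close e p q.
Proof.
case: p q => [a b] [a' b'] ne; case: (Req_dec a a') => [e1|n1].
  have n2 : b <> b' by move=> e2; apply: ne; rewrite e1 e2.
  exists (Rabs (b - b')); first by apply: Rabs_pos_lt; lra.
  by move=> [_] /=; lra.
exists (Rabs (a - a')); first by apply: Rabs_pos_lt; lra.
by move=> [] /=; lra.
Qed.

(** Each pair of parameters has a good radius: at a coincidence by continuity of [c], elsewhere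
    because the two points are a positive distance apart. Compactness of the parameter square makes
    it uniform. *)
Lemma curves_sep (c c' : curve) (Z : point -> Prop) r : is_curve c -> is_curve c' -> 0 < r ->
  (forall s t, on01 s -> on01 t -> c s = c' t -> Z (c s)) ->
  exists2 e, 0 < e & forall s t, on01 s -> on01 t -> close e (c s) (c' t) -> exists2 z, Z z & close r (c s) z.
Proof.
move=> cc cc' r0 H.
have loc u v : exists d : posreal, on01 u -> on01 v -> forall s t, Rabs (s - u) < d -> Rabs (t - v) < d ->
    close d (c s) (c' t) -> exists2 z, Z z & close r (c s) z.
  case: (classic (c u = c' v)) => [e|ne].
    have [d d0 hd] := curve_near u cc r0; exists (mkposreal d d0) => u0 v0 s t su _ _.
    by exists (c u); [apply: (H u v) | apply: hd].
  have [e e0 he] := point_sep ne.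
  have e3 : 0 < e / 3 by lra.
  have [d1 p1 h1] := curve_near u cc e3; have [d2 p2 h2] := curve_near v cc' e3.
  have d0 : 0 < Rmin (e / 3) (Rmin d1 d2) by do 2 apply: Rmin_pos => //.
  exists (mkposreal _ d0) => _ _ s t /= su tv st.
  have m1 := Rmin_l (e / 3) (Rmin d1 d2); have m2 := Rmin_r (e / 3) (Rmin d1 d2).
  have m3 := Rmin_l d1 d2; have m4 := Rmin_r d1 d2.
  case: he; rewrite (_ : e = e / 3 + (e / 3 + e / 3)); last by field.
  apply: close_trans (close_sym (h1 s _)) _; first lra.
  apply: close_trans (close_le _ st) (h2 t _); lra.
pose dl u v := proj1_sig (constructive_indefinite_description _ (loc u v)).
have dlP u v := proj2_sig (constructive_indefinite_description _ (loc u v)).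
have [d hd] := compactness_value_2d 0 1 0 1 dl.
exists d; first exact: cond_pos.
move=> s t s0 t0 st; apply: NNPP => no; apply: (hd s t s0 t0) => -[u [v [u0 [v0 [su [tv dd]]]]]].
by apply: no; apply: (dlP u v u0 v0 s t su tv); apply: close_le st.
Qed.

Lemma fin_min (I : finType) (P : I -> R -> Prop) : (forall i e e', P i e -> 0 < e' <= e -> P i e') ->
  (forall i, exists2 e, 0 < e & P i e) -> exists2 e, 0 < e & forall i, P i e.
Proof.
move=> dn ex; suff [e e0 h] : exists2 e, 0 < e & forall i, i \in enum I -> P i e.
  by exists e => // i; apply: h; rewrite mem_enum.
elim: (enum I) => [|i s [e e0 h]]; first by exists 1 => //; lra.
have [e' e0' h'] := ex i; exists (Rmin e e'); first exact: Rmin_pos.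
have m1 := Rmin_l e e'; have m2 := Rmin_r e e'; have m0 := Rmin_pos _ _ e0 e0'.
by move=> j; rewrite inE => /orP[/eqP->|/h hj]; [apply: dn h' _ | apply: dn hj _].
Qed.
Lemma fin_max (I : finType) (P : I -> R -> Prop) : (forall i e e', P i e -> e <= e' -> P i e') ->
  (forall i, exists e, P i e) -> exists e, forall i, P i e.
Proof.
move=> dn ex; suff [e h] : exists e, forall i, i \in enum I -> P i e.
  by exists e => i; apply: h; rewrite mem_enum.
elim: (enum I) => [|i s [e h]]; first by exists 1.
have [e' h'] := ex i; exists (Rmax e e').
have m1 := Rmax_l e e'; have m2 := Rmax_r e e'.
by move=> j; rewrite inE => /orP[/eqP->|/h hj]; [apply: dn h' _ | apply: dn hj _].
Qed.

Lemma curve_bound c : is_curve c -> exists L, forall s, on01 s -> Rabs (c s).1 < L /\ Rabs (c s).2 < L.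
Proof.
have b f : continuity f -> exists L, forall s, on01 s -> Rabs (f s) < L.
  move=> cf; have cf' : forall s, 0 <= s <= 1 -> continuity_pt f s by move=> s _; apply: cf.
  have [M [hM _]] := continuity_ab_maj f 0 1 Rle_0_1 cf'.
  have [m [hm _]] := continuity_ab_min f 0 1 Rle_0_1 cf'.
  exists (Rabs (f M) + Rabs (f m) + 1) => s s0; have h1 := hM s s0; have h2 := hm s s0.
  move: h1 h2; have := Rle_abs (f M); have := Rle_abs (- f m); rewrite Rabs_Ropp.
  by have := Rabs_pos (f M); have := Rabs_pos (f m); move=> *; apply: Rabs_def1; lra.
move=> [c1 c2]; have [L1 h1] := b _ c1; have [L2 h2] := b _ c2.
exists (Rmax L1 L2) => s s0; have := h1 s s0; have := h2 s s0.
by have := Rmax_l L1 L2; have := Rmax_r L1 L2; move=> *; split; lra.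
Qed.

Definition nfloor (x : R) := Z.to_nat (Int_part x).
Lemma nfloorP x : 0 <= x -> INR (nfloor x) <= x < INR (nfloor x) + 1.
Proof.
move=> x0; have [h1 h2] := base_Int_part x.
have p : (0 <= Int_part x)%Z.
  have : (-1 < Int_part x)%Z by apply: lt_IZR; lra.
  by lia.
by rewrite /nfloor INR_IZR_INZ Z2Nat.id //; lra.
Qed.

Section Grid.
Variables (L h : R).
Hypothesis h0 : 0 < h.
Definition loc (x : pt) : point := (INR x.1 * h - L, INR x.2 * h - L).
Definition pix (p : point) : pt := (nfloor ((p.1 + L) / h), nfloor ((p.2 + L) / h)).
Definition inside (p : point) := Rabs p.1 < L /\ Rabs p.2 < L.

Lemma floor_loc a : Rabs a < L -> 0 <= a - (INR (nfloor ((a + L) / h)) * h - L) < h.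
Proof.
move=> /Rabs_def2[h1 h2]; have [|h3 h4] := @nfloorP ((a + L) / h).
  by apply: Rdiv_le_0_compat => //; lra.
have e : (a + L) / h * h = a + L by field; lra.
have := Rmult_le_compat_r h _ _ (Rlt_le _ _ h0) h3; have := Rmult_lt_compat_r h _ _ h0 h4.
by rewrite e; lra.
Qed.
Lemma pix_close p : inside p -> close h (loc (pix p)) p.
Proof.
move=> [h1 h2]; have := floor_loc h1; have := floor_loc h2 => f2 f1.
by split; rewrite Rabs_minus_sym; apply: Rabs_def1 => /=; lra.
Qed.

Lemma floor_step a b : Rabs a < L -> Rabs b < L -> Rabs (a - b) < h -> 
  (nfloor ((a + L) / h) <= (nfloor ((b + L) / h)).+1)%N.
Proof.
move=> ha hb /Rabs_def2[ab1 ab2]; have := floor_loc ha; have := floor_loc hb.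
set j := nfloor ((b + L) / h); set i := nfloor ((a + L) / h) => f1 f2.
have : INR i * h < (INR j + 2) * h by lra.
move/(Rmult_lt_reg_r _ _ _ h0) => lt; have : (i < j.+2)%coq_nat by apply: INR_lt; rewrite !S_INR; lra.
by move=> ji; apply/leP; lia.
Qed.

Lemma near_coord a b i : Rabs a < L -> Rabs b < L -> Rabs (a - b) < h ->
  (i == nfloor ((a + L) / h)) || (i == nfloor ((b + L) / h)) -> Rabs (INR i * h - L - b) < 2 * h.
Proof.
move=> ha hb /Rabs_def2[ab1 ab2]; have := floor_loc ha; have := floor_loc hb => f1 f2.
by case/orP=> /eqP->; apply: Rabs_def1; lra.
Qed.

(** Moving along the row and then the column uses only coordinates of the two end pixels, which
    keeps the error at [2 * h]. *)
Lemma pix_step p q : inside p -> inside q -> close h p q ->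
  exists w, [/\ path lat (pix p) w, last (pix p) w = pix q & forall x, x \in w -> close (2 * h) (loc x) q].
Proof.
move=> [p1 p2] [q1 q2] [d1 d2].
set a := nfloor ((p.1 + L) / h); set b := nfloor ((p.2 + L) / h).
set a' := nfloor ((q.1 + L) / h); set b' := nfloor ((q.2 + L) / h).
have s1 : (a <= a'.+1)%N by apply: floor_step.
have s2 : (a' <= a.+1)%N by apply: floor_step => //; rewrite Rabs_minus_sym.
have s3 : (b <= b'.+1)%N by apply: floor_step.
have s4 : (b' <= b.+1)%N by apply: floor_step => //; rewrite Rabs_minus_sym.
pose P (x : pt) := ((x.1 == a) || (x.1 == a')) && ((x.2 == b) || (x.2 == b')).
have [|w [w1 w2 w3]] := @hline P b a a'.
  by move=> m hm; rewrite /P /= eqxx /= andbT; move: hm s1 s2; clear; lia.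
have [|w' [w1' w2' w3']] := @vline P a' b b'.
  by move=> m hm; rewrite /P /= eqxx orbT /=; move: hm s3 s4; clear; lia.
exists (w ++ w'); rewrite cat_path last_cat /= w1 w2 w1' w2'; split=> // x.
rewrite mem_cat => hx; have /andP[x1 x2] : P x by case/orP: hx => hx; [exact: (allP w3) | exact: (allP w3')].
by split=> /=; [apply: (near_coord p1 q1 d1 x1) | apply: (near_coord p2 q2 d2 x2)].
Qed.

(** Uniform continuity allows equally spaced sample times at which successive points are [h]-close,
    and [pix_step] joins their pixels. *)
Lemma curve_walk c : is_curve c -> (forall s, on01 s -> inside (c s)) ->
  exists w, [/\ path lat (pix (c 0)) w, last (pix (c 0)) w = pix (c 1) &
    forall x, x \in pix (c 0) :: w -> exists2 s, on01 s & close (2 * h) (loc x) (c s)].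
Proof.
move=> cc ins.
have [d d0 hd] : exists2 d, 0 < d & forall s t, on01 s -> on01 t -> Rabs (s - t) < d -> close h (c s) (c t).
  have [c1 c2] := cc.
  have H1 := Heine (fst \o c) (fun x => 0 <= x <= 1) (compact_P3 0 1) (fun x _ => c1 x) (mkposreal h h0).
  have H2 := Heine (snd \o c) (fun x => 0 <= x <= 1) (compact_P3 0 1) (fun x _ => c2 x) (mkposreal h h0).
  case: H1 => e1 H1; case: H2 => e2 H2; exists (Rmin e1 e2); first by apply: Rmin_pos; apply: cond_pos.
  move=> s t s0 t0 st; have := Rmin_l e1 e2; have := Rmin_r e1 e2 => m1 m2.
  by split; [apply: (H1 s t s0 t0) | apply: (H2 s t s0 t0)]; lra.
have [n hn] : exists n : nat, / INR n.+1 < d.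
  by have [n [hn n0]] := archimed_cor1 d d0; exists n.-1; rewrite prednK //; apply/ltP.
pose t i := INR i / INR n.+1.
have n0 : 0 < INR n.+1 by apply: lt_0_INR; lia.
have t01 i : (i <= n.+1)%N -> on01 (t i).
  move=> /leP/le_INR le; split; first by apply: Rdiv_le_0_compat => //; exact: pos_INR.
  by apply: (Rmult_le_reg_r _ _ _ n0); rewrite /t /Rdiv Rmult_assoc Rinv_l; lra.
have key i : (i <= n.+1)%N -> exists w, [/\ path lat (pix (c 0)) w, last (pix (c 0)) w = pix (c (t i)) &
    forall x, x \in pix (c 0) :: w -> exists2 s, on01 s & close (2 * h) (loc x) (c s)].
  elim: i => [|i IH] hi.
    have e : t 0%N = 0 by rewrite /t /= /Rdiv Rmult_0_l.
    exists [::]; rewrite e; split=> // x; rewrite inE => /eqP->; exists 0; first by split; lra.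
    by apply: close_le (pix_close (ins _ _)); [lra | split; lra].
  have [w [w1 w2 w3]] := IH (ltnW hi).
  have i0 := t01 _ (ltnW hi); have i1 := t01 _ hi.
  have [|w' [v1 v2 v3]] := pix_step (ins _ i0) (ins _ i1).
    apply: hd => //; rewrite /t (S_INR i) (_ : _ - _ = - / INR n.+1); last by field; lra.
    by rewrite Rabs_Ropp Rabs_pos_eq //; apply/Rlt_le/Rinv_0_lt_compat.
  exists (w ++ w'); rewrite cat_path last_cat w1 w2 v1 v2; split=> // x.
  rewrite inE mem_cat orbA => /orP[xw|/v3 hx]; first by apply: w3; rewrite inE.
  by exists (t i.+1).
have [w hw] := key n.+1 (leqnn _); exists w.
by rewrite (_ : t n.+1 = 1) // in hw; rewrite /t; field; lra.
Qed.
End Grid.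

Definition closeb (d : R) (p q : point) : bool := if excluded_middle_informative (close d p q) then true else false.
Lemma closeP d p q : reflect (close d p q) (closeb d p q).
Proof. by rewrite /closeb; case: excluded_middle_informative => h; constructor. Qed.

Lemma lat_conn_from (P : pred pt) z : (forall x, P x -> exists p, [/\ path lat z p, last z p = x & all P p]) -> P z -> lat_conn P.
Proof.
move=> H Pz; apply: (lat_conn_center (z := z)) => // x /H[p [p1 p2 p3]].
by have [|q] := rev_walk (P := P) p1; [rewrite /= Pz | rewrite p2; exists q].
Qed.

(** * Boxes of half-width [rho] on a grid of mesh [h] *)

Section Fine.
Variables (V B : finType) (E : rel V) (k : nat) (r : V) (pos : V -> point) (orig : B -> V) (bof : V -> B).
Variables (bc : B -> curve) (bs : V -> V -> B) (mid : V -> V -> curve) (Xr : rel B).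
Hypothesis E_graph : is_graph E.
Hypothesis bofP : forall v, orig (bof v) = v.
Hypothesis bc_curve : forall b, is_curve (bc b).
Hypothesis bc0 : forall b, bc b 0 = pos (orig b).
Hypothesis bs_orig : forall u v, E u v -> orig (bs u v) = u.
Hypothesis mid_curve : forall u v, E u v -> is_curve (mid u v).
Hypothesis mid0 : forall u v, E u v -> mid u v 0 = bc (bs u v) 1.
Hypothesis mid1 : forall u v, E u v -> mid u v 1 = bc (bs v u) 1.
Hypothesis XrP : forall b b' s t, b' != b -> on01 s -> on01 t -> bc b s = bc b' t ->
  Xr b b' \/ orig b = orig b' /\ bc b s = pos (orig b).
Hypothesis Xk : forall b, (#|[set b' | (b' != b) && Xr b b']| <= k)%N.
Definition pts (P : V + B) : point := match P with inl v => pos v | inr b => bc b 1 end.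
(** Each edge is kept in one orientation, so that its unbundled part is absorbed by one terminal
    region only. *)
Definition canon u v := E u v && (enum_rank u < enum_rank v)%N.
Variables (rho h L : R).
Hypothesis rho0 : 0 < rho.
Hypothesis rho8 : rho <= / 8.
Hypothesis h0 : 0 < h.
Hypothesis h_rho : h <= rho / 4.
Hypothesis pts_far : forall P P', close (2 * rho) (pts P) (pts P') -> P = P'.
Hypothesis bc_far : forall b P s, on01 s -> close (2 * rho) (bc b s) (pts P) -> exists2 s', on01 s' & bc b s' = pts P.
Hypothesis mid_far : forall u v P s, canon u v -> on01 s -> close (2 * rho) (mid u v s) (pts P) ->
  P = inr (bs u v) \/ P = inr (bs v u).
Hypothesis bb_far : forall b b' s t, b' != b -> ~~ Xr b b' -> on01 s -> on01 t -> close (4 * h) (bc b s) (bc b' t) ->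
  orig b = orig b' /\ close (rho / 2) (bc b s) (pos (orig b)).
Hypothesis mb_far : forall u v b s t, canon u v -> on01 s -> on01 t -> close (4 * h) (mid u v s) (bc b t) ->
  (b = bs u v \/ b = bs v u) /\ close (rho / 2) (mid u v s) (bc b 1).
Hypothesis mm_far : forall u v x y s t, canon u v -> canon x y -> (u, v) != (x, y) -> on01 s -> on01 t ->
  close (4 * h) (mid u v s) (mid x y t) ->
  exists d, close (rho / 2) (mid u v s) (bc d 1).
Hypothesis L1 : 1 < L.
Hypothesis bc_bound : forall b s, on01 s -> inside (L - 1) (bc b s).
Hypothesis mid_bound : forall u v s, canon u v -> on01 s -> inside (L - 1) (mid u v s).

Local Notation loc := (loc L h).
Local Notation pix := (pix L h).
Definition box P (x : pt) := closeb rho (loc x) (pts P).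
Definition M := (nfloor (2 * L / h)).+2.

Lemma in0 : on01 0. Proof. by split; lra. Qed.
Lemma in1 : on01 1. Proof. by split; lra. Qed.
Lemma ins p : inside (L - 1) p -> inside L p. Proof. by move=> [? ?]; split; lra. Qed.
Lemma pts_inside P : inside (L - 1) (pts P).
Proof. case: P => [v|b] /=; last exact: bc_bound in1. rewrite -(bofP v) -bc0; exact: bc_bound in0. Qed.

Lemma near_interior x p : close (1 / 2) (loc x) p -> inside (L - 1) p -> interior M x.
Proof.
move=> [/Rabs_def2[a1 a2] /Rabs_def2[b1 b2]] [/Rabs_def2[c1 c2] /Rabs_def2[d1 d2]].
rewrite /= in a1 a2 b1 b2.
have co i q : INR i * h - L - q < 1 / 2 -> - (1 / 2) < INR i * h - L - q -> q < L - 1 -> - (L - 1) < q ->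
    (1 < i < M.-1)%N.
  move=> e1 e2 e3 e4; apply/andP; split.
    apply/ltP; apply: INR_lt; apply: (Rmult_lt_reg_r h) => //; rewrite /= Rmult_1_l; lra.
  apply/ltP; apply: INR_lt; rewrite /M /= -/(INR (nfloor (2 * L / h)).+1) S_INR.
  have [|_ f] := @nfloorP (2 * L / h); first by apply: Rdiv_le_0_compat => //; lra.
  apply: Rle_lt_trans f; apply: (Rmult_le_reg_r h) => //.
  by rewrite /Rdiv Rmult_assoc Rinv_l; lra.
by rewrite /interior; apply/andP; split; [apply: (co _ p.1) | apply: (co _ p.2)].
Qed.
Lemma box_int P x : box P x -> interior M x.
Proof. by move=> /closeP hx; apply: near_interior (pts_inside P); apply: close_le hx; lra. Qed.
Lemma box_pix P : box P (pix (pts P)).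
Proof. by apply/closeP; apply: close_le (pix_close h0 (ins (pts_inside P))); lra. Qed.
Lemma box_disj P P' x : box P x -> box P' x -> P = P'.
Proof.
move=> /closeP h1 /closeP h2; apply: pts_far; apply: close_le (close_trans (close_sym h1) h2); lra.
Qed.
Lemma box_conn' P : lat_conn (box P).
Proof.
pose I a i := if excluded_middle_informative (Rabs (INR i * h - L - a) < rho) then true else false.
have IP a i : reflect (Rabs (INR i * h - L - a) < rho) (I a i).
  by rewrite /I; case: excluded_middle_informative => ?; constructor.
have cv a i j m : I a i -> I a j -> (i <= m <= j)%N -> I a m.
  move=> /IP/Rabs_def2[a1 a2] /IP/Rabs_def2[b1 b2] /andP[/leP/le_INR im /leP/le_INR mj]; apply/IP.
  have := Rmult_le_compat_r h _ _ (Rlt_le _ _ h0) im; have := Rmult_le_compat_r h _ _ (Rlt_le _ _ h0) mj.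
  by move=> *; apply: Rabs_def1; lra.
have := box_conn (@cv (pts P).1) (@cv (pts P).2).
have e x : box P x = I (pts P).1 x.1 && I (pts P).2 x.2.
  apply/closeP/andP; first by move=> [h1 h2]; split; apply/IP.
  by move=> [/IP h1 /IP h2].
move=> H x y; rewrite !e => hx hy; have [p [p1 p2 p3]] := H x y hx hy; exists p; split=> //.
by apply: sub_all p3 => z; rewrite e.
Qed.

Lemma cwalk_ex b : exists w, [/\ path lat (pix (pos (orig b))) w, last (pix (pos (orig b))) w = pix (bc b 1) &
  forall x, x \in pix (pos (orig b)) :: w -> exists2 s, on01 s & close (2 * h) (loc x) (bc b s)].
Proof.
have [w] := curve_walk h0 (bc_curve b) (fun s s0 => ins (bc_bound b s0)).
by rewrite bc0; exists w.
Qed.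
(** The walk stops just before the box of the far terminal: it can be merged with the near
    terminal's region and still ends next to that box, which yields the adjacency of the edge. *)
Lemma mwalk_ex (e : V * V) : exists w, canon e.1 e.2 -> [/\ path lat (pix (bc (bs e.1 e.2) 1)) w,
  forall x, x \in pix (bc (bs e.1 e.2) 1) :: w -> ~~ box (inr (bs e.2 e.1)) x /\
    exists2 s, on01 s & close (2 * h) (loc x) (mid e.1 e.2 s) &
  exists2 z, lat (last (pix (bc (bs e.1 e.2) 1)) w) z & box (inr (bs e.2 e.1)) z].
Proof.
case: e => u v /=; case: (boolP (canon u v)) => [c|_]; last by exists [::].
have Euv : E u v by case/andP: c.
have [w] := curve_walk h0 (mid_curve Euv) (fun s s0 => ins (mid_bound c s0)).
rewrite mid0 // mid1 // => -[w1 w2 w3].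
have nb : bs u v <> bs v u.
  move=> e; have [Es Ei] := E_graph; have := bs_orig Euv; rewrite e bs_orig; last by rewrite Es.
  by move=> e'; move: Euv; rewrite e' Ei.
have n0 : ~~ box (inr (bs v u)) (pix (bc (bs u v) 1)).
  by apply/negP => h1; have := box_disj h1 (box_pix (inr (bs u v))) => -[] /esym.
have hq : has (predC (fun x => ~~ box (inr (bs v u)) x)) w.
  have lb : box (inr (bs v u)) (last (pix (bc (bs u v) 1)) w) by rewrite w2; exact: (box_pix (inr (bs v u))).
  case: w w1 w2 w3 lb => [|a w] w1 w2 w3 lb; first by rewrite /= in lb; rewrite lb in n0.
  by apply/hasP; exists (last (pix (bc (bs u v) 1)) (a :: w)); rewrite /= ?mem_last // negbK.
have [p1 [t [p2 [ew al pp lt nt]]]] := split_first w1 hq.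
exists p1 => _; split=> //; last by exists t; rewrite ?lt // -[box _ t]negbK.
move=> x xp; split.
  by move: xp; rewrite inE => /orP[/eqP->//|]; exact: (allP al).
by apply: w3; rewrite ew; move: xp; rewrite !inE mem_cat => /orP[->//|->]; rewrite orbT.
Qed.

Theorem fine_embedding : exists (T : nat) (EW : rel 'I_T.+1) (p : nat),
  is_graph EW /\ tw_le EW ('C(2 * k + 6, 3) - 1) /\
  contained E (strong (strong EW (path_rel p)) (complete_rel (6 * (2 * k + 3) ^ 2))).
Proof.
have [cw cwP] := fin_all_exists cwalk_ex.
have [mw mwP] := fin_all_exists mwalk_ex.
pose seg u v := pix (bc (bs u v) 1) :: mw (u, v).
(* The terminal region is the box of the terminal together with the truncated walks of the edges
   assigned to it. *)
pose Z b x := box (inr b) x || [exists u, exists v, [&& canon u v, bs u v == b & x \in seg u v]].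
have segP u v x : canon u v -> x \in seg u v -> ~~ box (inr (bs v u)) x /\
    exists2 s, on01 s & close (2 * h) (loc x) (mid u v s).
  by move=> c; have [_ H _] := mwP (u, v) c; exact: H.
have cE u v : canon u v -> E u v by case/andP.
have seg_box u v P x : canon u v -> x \in seg u v -> box P x -> P = inr (bs u v).
  move=> c xs bx; have [nb [s s0 cl]] := segP _ _ _ c xs; move/closeP: (bx) => cb.
  have c2 : close (2 * rho) (mid u v s) (pts P) by apply: close_le (close_trans (close_sym cl) cb); lra.
  by case: (mid_far c s0 c2) => // e; rewrite e in bx; rewrite bx in nb.
have ZP b x : Z b x -> box (inr b) x \/ exists u v, [/\ canon u v, bs u v = b & x \in seg u v].
  case/orP=> [|/existsP[u /existsP[v /and3P[c /eqP e xs]]]]; [by left | right; by exists u, v].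
have bZ b x : box (inr b) x -> Z b x by rewrite /Z => ->.
have sZ u v x : canon u v -> x \in seg u v -> Z (bs u v) x.
  by move=> c xs; apply/orP; right; apply/existsP; exists u; apply/existsP; exists v; rewrite c xs eqxx.
have cwN b x : x \in pix (pos (orig b)) :: cw b -> exists2 s, on01 s & close (2 * h) (loc x) (bc b s).
  by have [_ _ H] := cwP b; exact: H.
have thru b P x : x \in pix (pos (orig b)) :: cw b -> box P x -> exists2 s, on01 s & bc b s = pts P.
  move=> /cwN[s s0 cl] /closeP cb; apply: (bc_far s0).
  by apply: close_le (close_trans (close_sym cl) cb); lra.
(* A bundle close to an unbundled part is one of the two bundles of that edge, close to its
   terminal; the far one is excluded because the walk avoids its box. *)
have thruZ b d x : x \in pix (pos (orig b)) :: cw b -> Z d x -> exists2 s, on01 s & bc b s = bc d 1.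
  move=> xb /ZP[bx|[u [v [c e xs]]]]; first exact: (thru b (inr d) x).
  have [s s0 cl] := cwN _ _ xb; have [nb [t t0 cm]] := segP _ _ _ c xs.
  have c4 : close (4 * h) (mid u v t) (bc b s) by apply: close_le (close_trans (close_sym cm) cl); lra.
  have [[eb|eb] cb] := mb_far c t0 s0 c4.
  - by exists 1; [exact: in1 | rewrite -e -eb].
  - case/negP: nb; apply/closeP; rewrite -eb /=; apply: close_le (close_trans cm cb); lra.
have eX b b' s t P : b' != b -> on01 s -> on01 t -> bc b s = pts P -> bc b' t = pts P ->
    Xr b b' \/ orig b = orig b' /\ pts P = pos (orig b).
  by move=> bb s0 t0 e e'; rewrite -e; apply: (XrP bb s0 t0); rewrite e.
have pos_inj P v : pts P = pos v -> P = inl v.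
  by move=> e; apply: pts_far; rewrite e; apply: close_refl; lra.
apply: (@lattice_embedding V B orig bof k M E r (fun v => box (inl v)) Z cw (fun b => pix (pos (orig b)))
   Xr) => //.
- by move=> v x; apply: box_int.
- move=> b x /ZP[|[u [v [c e xs]]]]; first exact: box_int.
  have [_ [s s0 cl]] := segP _ _ _ c xs; apply: near_interior (mid_bound c s0).
  by apply: close_le cl; lra.
- move=> b x /cwN[s s0 cl]; apply: near_interior (bc_bound b s0).
  by apply: close_le cl; lra.
- by move=> v w x h1 h2; have [] := box_disj h1 h2.
- move=> b d x /ZP[h1|[u [v [c e xs]]]] /ZP[h2|[u' [v' [c' e' xs']]]].
  + by have [] := box_disj h1 h2.
  + by have [->] := seg_box _ _ _ _ c' xs' h1.
  + by have [->] := seg_box _ _ _ _ c xs h2.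
  + case: (eqVneq (u, v) (u', v')) => [[eu ev]|ne]; first by rewrite -e -e' eu ev.
    have [n1 [s s0 cl]] := segP _ _ _ c xs; have [n2 [t t0 cl']] := segP _ _ _ c' xs'.
    have c4 : close (4 * h) (mid u v s) (mid u' v' t) by apply: close_le (close_trans (close_sym cl) cl'); lra.
    have [g cd] := mm_far c c' ne s0 t0 c4.
    have bx : box (inr g) x by apply/closeP; apply: close_le (close_trans cl cd); lra.
    have [ed] := seg_box _ _ _ _ c xs bx; have [ed'] := seg_box _ _ _ _ c' xs' bx.
    by rewrite -e -e' -ed -ed'.
- move=> v b x h1; apply/negP => /ZP[h2|[u [w [c e xs]]]]; first by have := box_disj h1 h2.
  by have := seg_box _ _ _ _ c xs h1.
- by move=> v; apply: box_conn'.
- move=> b; apply: (lat_conn_from (z := pix (bc b 1))); last exact/bZ/(box_pix (inr b)).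
  move=> x /ZP[h1|[u [v [c e xs]]]].
    have [p [p1 p2 p3]] := box_conn' (box_pix (inr b)) h1; exists p; split=> //.
    by apply: sub_all p3 => z; apply: bZ.
  have [w1 _ _] := mwP (u, v) c; rewrite /= e in w1.
  move: xs; rewrite /seg e inE => /orP[/eqP->|xm].
    by exists [::]; split.
  have sub z : z \in mw (u, v) -> Z b z by move=> zm; rewrite -e; apply: sZ c _; rewrite /seg inE zm orbT.
  case/path.splitP: xm w1 sub => p1 p2; rewrite cat_path => /andP[pp _] sub.
  exists (rcons p1 x); rewrite last_rcons pp; split=> //.
  by apply/allP => z zp; apply: sub; rewrite mem_cat zp.
- by move=> b; have [] := cwP b.
- by move=> b; exact: (box_pix (inl (orig b))).
- by move=> b; have [_ -> _] := cwP b; apply: bZ; exact: (box_pix (inr b)).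
- move=> u v uv; have [Es Ei] := E_graph.
  have half u' v' : canon u' v' -> exists z z', [/\ Z (bs u' v') z, Z (bs v' u') z' & lat z z'].
    move=> c; have [_ _ [z lz bz]] := mwP (u', v') c.
    exists (last (pix (bc (bs u' v') 1)) (mw (u', v'))), z; split=> //; last exact: bZ.
    by apply: (sZ _ _ _ c); rewrite /seg mem_last.
  have vu : E v u by rewrite Es.
  case: (ltngtP (enum_rank u) (enum_rank v)) => uv'.
  + have [|z [z' [h1 h2 h3]]] := half u v; first by rewrite /canon uv.
    by exists (bs u v), (bs v u), z, z'; rewrite !bs_orig.
  + have [|z [z' [h1 h2 h3]]] := half v u; first by rewrite /canon vu.
    by exists (bs u v), (bs v u), z', z; rewrite !bs_orig // lat_sym.
  + by move/val_inj/enum_rank_inj: uv' => e; rewrite e Ei in uv.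
- move=> b b' x bb xb xb'; case: (boolP (Xr b b')) => //= nX.
  have [s s0 cl] := cwN _ _ xb; have [t t0 cl'] := cwN _ _ xb'.
  have c4 : close (4 * h) (bc b s) (bc b' t) by apply: close_le (close_trans (close_sym cl) cl'); lra.
  have [oo cp] := bb_far bb nX s0 t0 c4; rewrite oo eqxx /=; apply/closeP => /=; rewrite -oo.
  by apply: close_le (close_trans cl cp); lra.
- move=> b b' x x' w bb xb xb' hx hx'; have [s s0 es] := thru _ _ _ xb hx; have [t t0 et] := thru _ _ _ xb' hx'.
  case: (eX _ _ _ _ _ bb s0 t0 es et) => [->//|[oo /pos_inj[->]]].
  by rewrite oo !eqxx orbT.
- move=> b b' x x' d bb xb xb' hx hx'; have [s s0 es] := thruZ _ _ _ xb hx; have [t t0 et] := thruZ _ _ _ xb' hx'.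
  by case: (eX _ _ _ _ (inr d) bb s0 t0 es et) => // -[_ /pos_inj].
Qed.
End Fine.

(** * Choice of the two scales by compactness *)

Section Scales.
Variables (V B : finType) (E : rel V) (k : nat) (r : V) (pos : V -> point) (orig : B -> V) (bof : V -> B).
Variables (bc : B -> curve) (bs : V -> V -> B) (mid : V -> V -> curve) (Xr : rel B).
Hypothesis E_graph : is_graph E.
Hypothesis bofP : forall v, orig (bof v) = v.
Hypothesis pos_inj : injective pos.
Hypothesis bc_curve : forall b, is_curve (bc b).
Hypothesis bc0 : forall b, bc b 0 = pos (orig b).
Hypothesis term_inj : forall b b', bc b 1 = bc b' 1 -> b = b'.
Hypothesis term_pos : forall b v, bc b 1 <> pos v.
Hypothesis bs_orig : forall u v, E u v -> orig (bs u v) = u.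
Hypothesis mid_curve : forall u v, E u v -> is_curve (mid u v).
Hypothesis mid0 : forall u v, E u v -> mid u v 0 = bc (bs u v) 1.
Hypothesis mid1 : forall u v, E u v -> mid u v 1 = bc (bs v u) 1.
Hypothesis XrP : forall b b' s t, b' != b -> on01 s -> on01 t -> bc b s = bc b' t ->
  Xr b b' \/ orig b = orig b' /\ bc b s = pos (orig b).
Hypothesis Xk : forall b, (#|[set b' | (b' != b) && Xr b b']| <= k)%N.
Hypothesis mb : forall u v b s t, E u v -> on01 s -> on01 t -> mid u v s = bc b t ->
  (b = bs u v \/ b = bs v u) /\ mid u v s = bc b 1.
Hypothesis mm : forall u v x y s t, E u v -> E x y -> ~ ((x = u /\ y = v) \/ (x = v /\ y = u)) ->
  on01 s -> on01 t -> mid u v s = mid x y t -> mid u v s = mid u v 0 \/ mid u v s = mid u v 1.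

Lemma const_curve (p : point) : is_curve (fun _ => p).
Proof. by split; apply: continuity_const => x y. Qed.
Lemma in01_0 : on01 0. Proof. by split; lra. Qed.
Lemma in01_1 : on01 1. Proof. by split; lra. Qed.

Lemma avoid (c : curve) p : is_curve c -> (forall s, on01 s -> c s <> p) ->
  exists2 e, 0 < e & forall s, on01 s -> ~ close e (c s) p.
Proof.
move=> cc no; have r1 : 0 < 1 by lra.
have [|e e0 he] := @curves_sep c (fun _ => p) (fun _ => False) 1 cc (const_curve p) r1.
  by move=> s t s0 _ /(no s s0).
by exists e => // s s0 cl; have [] := he s 0 s0 in01_0 cl.
Qed.

Local Notation pts := (@pts V B pos bc).
Lemma pts_inj : injective pts.
Proof.
move=> [v|b] [w|d] /=; first by move/pos_inj=> ->.
- by move/esym/term_pos.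
- by move/term_pos.
- by move/term_inj=> ->.
Qed.

Lemma scale_pts : exists2 e, 0 < e & forall P P', close e (pts P) (pts P') -> P = P'.
Proof.
have [|[P P']|e e0 he] := @fin_min ((V + B) * (V + B))%type (fun PP e => close e (pts PP.1) (pts PP.2) -> PP.1 = PP.2).
- by move=> i e e' H ee /(close_le (proj2 ee)).
- case: (eqVneq P P') => [->|ne]; first by exists 1 => //; lra.
  have [|e e0 he] := @point_sep (pts P) (pts P'); first by move/pts_inj/eqP; apply/negP.
  by exists e.
by exists e => // P P'; exact: (he (P, P')).
Qed.
Lemma scale_bc : exists2 e, 0 < e & forall b P s, on01 s -> close e (bc b s) (pts P) -> exists2 s', on01 s' & bc b s' = pts P.
Proof.
have [|[b P]|e e0 he] := @fin_min (B * (V + B))%type (fun bP e => forall s, on01 s -> close e (bc bP.1 s) (pts bP.2) -> exists2 s', on01 s' & bc bP.1 s' = pts bP.2).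
- by move=> i e e' H ee s s0 /(close_le (proj2 ee)); exact: H.
- case: (classic (exists2 s', on01 s' & bc b s' = pts P)) => [h|no]; first by exists 1 => //; lra.
  have [|e e0 he] := @avoid (bc b) (pts P) (bc_curve b); first by move=> s s0 es; apply: no; exists s.
  by exists e => // s s0 /(he s s0).
by exists e => // b P; exact: (he (b, P)).
Qed.
Lemma scale_mid : exists2 e, 0 < e & forall u v P s, canon E u v -> on01 s -> close e (mid u v s) (pts P) ->
  P = inr (bs u v) \/ P = inr (bs v u).
Proof.
have [|[[u v] P]|e e0 he] := @fin_min (V * V * (V + B))%type (fun uvP e => forall s, canon E uvP.1.1 uvP.1.2 -> on01 s ->
    close e (mid uvP.1.1 uvP.1.2 s) (pts uvP.2) -> uvP.2 = inr (bs uvP.1.1 uvP.1.2) \/ uvP.2 = inr (bs uvP.1.2 uvP.1.1)).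
- by move=> i e e' H ee s c s0 /(close_le (proj2 ee)); exact: H.
- rewrite /=; case: (boolP (canon E u v)) => [/andP[uv _]|_]; last by exists 1 => //; lra.
  case: (classic (P = inr (bs u v) \/ P = inr (bs v u))) => [h|no]; first by exists 1 => //; lra.
  have [|e e0 he] := @avoid (mid u v) (pts P) (mid_curve uv).
    move=> s s0; case: P no => [w|d] no /= e.
      have e' : mid u v s = bc (bof w) 0 by rewrite bc0 bofP.
      by have [_] := mb uv s0 in01_0 e'; rewrite e => /esym/term_pos.
    by have [[ed|ed] _] := mb uv s0 in01_1 e; apply: no; rewrite ed; [left|right].
  by exists e => // s _ s0 /(he s s0).
by exists e => // u v P; exact: (he (u, v, P)).
Qed.
Lemma scale_bb rho : 0 < rho -> exists2 e, 0 < e & forall b b' s t, b' != b -> ~~ Xr b b' -> on01 s -> on01 t ->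
  close e (bc b s) (bc b' t) -> orig b = orig b' /\ close rho (bc b s) (pos (orig b)).
Proof.
move=> r0; have [|[b b']|e e0 he] := @fin_min (B * B)%type (fun bb e => forall s t, bb.2 != bb.1 -> ~~ Xr bb.1 bb.2 -> on01 s -> on01 t ->
  close e (bc bb.1 s) (bc bb.2 t) -> orig bb.1 = orig bb.2 /\ close rho (bc bb.1 s) (pos (orig bb.1))).
- by move=> i e e' H ee s t h1 h2 s0 t0 /(close_le (proj2 ee)); exact: H.
- rewrite /=; case: (boolP (b' != b)) => [bb|_]; last by exists 1 => //; lra.
  case: (boolP (~~ Xr b b')) => [nX|_]; last by exists 1 => //; lra.
  have [|e e0 he] := @curves_sep (bc b) (bc b') (fun z => orig b = orig b' /\ z = pos (orig b)) rho (bc_curve b) (bc_curve b') r0.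
    by move=> s t s0 t0 /(XrP bb s0 t0)[] //; rewrite (negbTE nX).
  by exists e => // s t _ _ s0 t0 /(he s t s0 t0)[z [h1 ->]].
by exists e => // b b'; exact: (he (b, b')).
Qed.
Lemma scale_mb rho : 0 < rho -> exists2 e, 0 < e & forall u v b s t, canon E u v -> on01 s -> on01 t ->
  close e (mid u v s) (bc b t) -> (b = bs u v \/ b = bs v u) /\ close rho (mid u v s) (bc b 1).
Proof.
move=> r0; have [|[[u v] b]|e e0 he] := @fin_min (V * V * B)%type (fun p e => forall s t, canon E p.1.1 p.1.2 -> on01 s -> on01 t ->
  close e (mid p.1.1 p.1.2 s) (bc p.2 t) -> (p.2 = bs p.1.1 p.1.2 \/ p.2 = bs p.1.2 p.1.1) /\ close rho (mid p.1.1 p.1.2 s) (bc p.2 1)).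
- by move=> i e e' H ee s t h1 s0 t0 /(close_le (proj2 ee)); exact: H.
- rewrite /=; case: (boolP (canon E u v)) => [/andP[uv _]|_]; last by exists 1 => //; lra.
  have [|e e0 he] := @curves_sep (mid u v) (bc b) (fun z => (b = bs u v \/ b = bs v u) /\ z = bc b 1) rho (mid_curve uv) (bc_curve b) r0.
    by move=> s t s0 t0; apply: mb.
  by exists e => // s t _ s0 t0 /(he s t s0 t0)[z [h1 ->]].
by exists e => // u v b; exact: (he (u, v, b)).
Qed.
Lemma scale_mm rho : 0 < rho -> exists2 e, 0 < e & forall u v x y s t, canon E u v -> canon E x y -> (u, v) != (x, y) ->
  on01 s -> on01 t -> close e (mid u v s) (mid x y t) -> exists d, close rho (mid u v s) (bc d 1).
Proof.
move=> r0; have [|[[u v] [x y]]|e e0 he] := @fin_min ((V * V) * (V * V))%type (fun p e => forall s t, canon E p.1.1 p.1.2 -> canon E p.2.1 p.2.2 -> p.1 != p.2 ->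
  on01 s -> on01 t -> close e (mid p.1.1 p.1.2 s) (mid p.2.1 p.2.2 t) -> exists d, close rho (mid p.1.1 p.1.2 s) (bc d 1)).
- by move=> i e e' H ee s t h1 h2 h3 s0 t0 /(close_le (proj2 ee)); exact: H.
- rewrite /=; case: (boolP (canon E u v)) => [/andP[uv ruv]|_]; last by exists 1 => //; lra.
  case: (boolP (canon E x y)) => [/andP[xy rxy]|_]; last by exists 1 => //; lra.
  case: (boolP ((u, v) != (x, y))) => [ne|_]; last by exists 1 => //; lra.
  have [|e e0 he] := @curves_sep (mid u v) (mid x y) (fun z => exists d, z = bc d 1) rho (mid_curve uv) (mid_curve xy) r0.
    move=> s t s0 t0 e.
    have nee : ~ ((x = u /\ y = v) \/ (x = v /\ y = u)).
      case=> [[ex ey]|[ex ey]]; first by rewrite ex ey eqxx in ne.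
      by move: ruv rxy; rewrite ex ey => h1 h2; have := ltn_trans h1 h2; rewrite ltnn.
    by case: (mm uv xy nee s0 t0 e) => ->; [exists (bs u v); rewrite mid0 | exists (bs v u); rewrite mid1].
  by exists e => // s t _ _ _ s0 t0 /(he s t s0 t0)[z [d ->]]; exists d.
by exists e => // u v x y; exact: (he (u, v, (x, y))).
Qed.
Lemma scale_bound : exists L, 1 < L /\ (forall b s, on01 s -> inside (L - 1) (bc b s)) /\
  (forall u v s, canon E u v -> on01 s -> inside (L - 1) (mid u v s)).
Proof.
have mono (i : curve) e e' : (forall s, on01 s -> inside e (i s)) -> e <= e' -> forall s, on01 s -> inside e' (i s).
  by move=> H ee s s0; have [h1 h2] := H s s0; split; lra.
have [||L1 h1] := @fin_max B (fun b e => forall s, on01 s -> inside e (bc b s)).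
- by move=> i; apply: mono.
- by move=> b; apply: curve_bound.
have [||L2 h2] := @fin_max (V * V)%type (fun p e => canon E p.1 p.2 -> forall s, on01 s -> inside e (mid p.1 p.2 s)).
- by move=> i e e' H ee c; apply: mono (H c) ee.
- move=> [u v] /=; case: (boolP (canon E u v)) => [/andP[uv _]|_]; last by exists 0.
  by have [e he] := curve_bound (mid_curve uv); exists e.
have m1 := Rmax_l L1 L2; have m2 := Rmax_r L1 L2; have m3 := Rmax_l 1 (Rmax L1 L2); have m4 := Rmax_r 1 (Rmax L1 L2).
exists (Rmax 1 (Rmax L1 L2) + 1); split; first lra; split.
  by move=> b s s0; apply: (mono _ _ _ (h1 b)) s0; lra.
by move=> u v s c s0; apply: (mono _ _ _ (h2 (u, v) c)) s0; lra.
Qed.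

(** [rho] comes first, separating vertices and terminals from one another and from the curves
    missing them. The mesh comes second, because the separation of curves outside the boxes depends
    on [rho]. *)
Theorem geometric_embedding : exists (T : nat) (EW : rel 'I_T.+1) (p : nat),
  is_graph EW /\ tw_le EW ('C(2 * k + 6, 3) - 1) /\
  contained E (strong (strong EW (path_rel p)) (complete_rel (6 * (2 * k + 3) ^ 2))).
Proof.
have [e1 p1 h1] := scale_pts; have [e2 p2 h2] := scale_bc; have [e3 p3 h3] := scale_mid.
pose rho := Rmin (/ 8) (Rmin e1 (Rmin e2 e3) / 2).
have m1 := Rmin_l (/ 8) (Rmin e1 (Rmin e2 e3) / 2); have m2 := Rmin_r (/ 8) (Rmin e1 (Rmin e2 e3) / 2).
have m3 := Rmin_l e1 (Rmin e2 e3); have m4 := Rmin_r e1 (Rmin e2 e3); have m5 := Rmin_l e2 e3; have m6 := Rmin_r e2 e3.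
have q0 : 0 < Rmin e1 (Rmin e2 e3) by do 2 apply: Rmin_pos => //.
have rho0 : 0 < rho by apply: Rmin_pos; lra.
rewrite -/rho in m1 m2; have rho2 : 0 < rho / 2 by lra.
have [e4 p4 h4] := scale_bb rho2; have [e5 p5 h5] := scale_mb rho2; have [e6 p6 h6] := scale_mm rho2.
(* A pixel on two walks makes their curves [4 * h]-close, as each walk errs by [2 * h]; and
   [2 * h + rho / 2] is at most [rho], so pixels near a coincidence fall inside the box. *)
pose h := Rmin (rho / 4) (Rmin e4 (Rmin e5 e6) / 4).
have n1 := Rmin_l (rho / 4) (Rmin e4 (Rmin e5 e6) / 4); have n2 := Rmin_r (rho / 4) (Rmin e4 (Rmin e5 e6) / 4).
have n3 := Rmin_l e4 (Rmin e5 e6); have n4 := Rmin_r e4 (Rmin e5 e6); have n5 := Rmin_l e5 e6; have n6 := Rmin_r e5 e6.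
have q1 : 0 < Rmin e4 (Rmin e5 e6) by do 2 apply: Rmin_pos => //.
have hp : 0 < h by apply: Rmin_pos; lra.
rewrite -/h in n1 n2.
have [L [L1 [Lb Lm]]] := scale_bound.
apply: (@fine_embedding V B E k r pos orig bof bc bs mid Xr E_graph bofP bc_curve bc0 bs_orig mid_curve mid0 mid1 XrP Xk rho h L) => //.
- by move=> P P' cl; apply: h1; apply: close_le cl; lra.
- by move=> b P s s0 cl; apply: (h2 b P s s0); apply: close_le cl; lra.
- by move=> u v P s c s0 cl; apply: (h3 u v P s c s0); apply: close_le cl; lra.
- by move=> b b' s t a1 a2 s0 t0 cl; apply: (h4 b b' s t a1 a2 s0 t0); apply: close_le cl; lra.
- by move=> u v b s t c s0 t0 cl; apply: (h5 u v b s t c s0 t0); apply: close_le cl; lra.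
- by move=> u v x y s t c c' ne s0 t0 cl; apply: (h6 u v x y s t c c' ne s0 t0); apply: close_le cl; lra.
Qed.
End Scales.

Local Open Scope nat_scope.

(** * Removal of isolated vertices and of bundles serving no edge *)

Section Restrict.
Variables (k : nat) (V : finType) (E : rel V).
Hypothesis E_graph : is_graph E.
Hypothesis kE : kfb_planar k E.
Let V' := {v : V | [exists u, E v u]}.
Let E' : rel V' := fun u v => E (val u) (val v).

(** Every remaining vertex has a bundle, on which its hub is found, and every remaining bundle
    starts at a remaining vertex. *)
Lemma restrict_embedding (r : V') : exists (T : nat) (EW : rel 'I_T.+1) (p : nat),
  is_graph EW /\ tw_le EW ('C(2 * k + 6, 3) - 1) /\
  contained E' (strong (strong EW (path_rel p)) (complete_rel (6 * (2 * k + 3) ^ 2))).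
Proof.
have [n [pos [orig [bc [bsel [mid [pos_inj [bcP [t_inj [t_pos [bs_o [midP [crk [mb mm]]]]]]]]]]]]]] := kE.
have [Es Ei] := E_graph.
pose B := {b : 'I_n | [exists u, exists v, E u v && (bsel u v == b)]}.
have origP (b : B) : [exists u, E (orig (val b)) u].
  have /existsP[u /existsP[v /andP[uv /eqP e]]] := valP b; apply/existsP; exists v.
  by rewrite -e bs_o.
pose orig' b : V' := exist _ (orig (val b)) (origP b).
have bsP u v : E u v -> [exists u', exists v', E u' v' && (bsel u' v' == bsel u v)].
  by move=> uv; apply/existsP; exists u; apply/existsP; exists v; rewrite uv eqxx.
pose mk b hb : B := exist (fun b : 'I_n => [exists u, exists v, E u v && (bsel u v == b)]) b hb.
pose bof (v : V') : B := mk _ (bsP _ _ (xchooseP (existsP (valP v)))).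
pose bs (u v : V') : B := insubd (bof u) (bsel (val u) (val v)).
have bsE u v : E' u v -> val (bs u v) = bsel (val u) (val v).
  by move=> uv; rewrite val_insubd bsP.
have E'_graph : is_graph E' by split=> [u v|u]; [exact: Es | exact: Ei].
have E's u v : E' u v -> E' v u by move=> uv; rewrite /E' Es.
pose Xr (b b' : B) : bool := if excluded_middle_informative (bundles_cross pos orig bc (val b) (val b')) then true else false.
apply: (@geometric_embedding V' B E' k r (fun v => pos (val v)) orig' bof (fun b => bc (val b)) bs
  (fun u v => mid (val u) (val v)) Xr).
- exact: E'_graph.
- by move=> v; apply: val_inj; rewrite /= bs_o //; exact: (xchooseP (existsP (valP v))).
- by move=> u v /pos_inj/val_inj.
- by move=> b; have [] := bcP (val b).
- by move=> b; have [] := bcP (val b).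
- by move=> b b' e; apply: val_inj; apply: NNPP => /t_inj.
- by move=> b v; apply: t_pos.
- by move=> u v uv; apply: val_inj; rewrite /= bsE // bs_o.
- by move=> u v /midP[].
- by move=> u v uv; have [_ [-> _]] := midP _ _ uv; rewrite bsE.
- by move=> u v uv; have [_ [_ [-> _]]] := midP _ _ uv; rewrite bsE // E's.
- move=> b b' s t bb s0 t0 e; rewrite /Xr; case: excluded_middle_informative => h; first by left.
  right; have [o ps] : orig (val b) = orig (val b') /\ bc (val b) s = pos (orig (val b)).
    by apply: NNPP => no; apply: h; exists s, t.
  by split=> //; apply: val_inj.
- move=> b; rewrite cardE -(size_map val); apply: (crk (val b)).
    by rewrite map_inj_uniq ?enum_uniq //; exact: val_inj.
  move=> _ /mapP[b' + ->]; rewrite mem_enum inE /Xr; case: excluded_middle_informative => h; rewrite ?andbF // andbT.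
  by move=> bb; split=> // /val_inj e; rewrite e eqxx in bb.
- move=> u v b s t uv s0 t0 e; have [eb e'] := mb _ _ _ _ _ uv s0 t0 e; split=> //.
  by case: eb => eb; [left|right]; apply: val_inj; rewrite bsE // E's.
- move=> u v x y s t uv xy ne s0 t0 e; have [|//] := mm _ _ _ _ _ _ uv xy _ s0 t0 e.
  by case=> -[a b]; apply: ne; [left|right]; split; apply: val_inj.
Qed.
End Restrict.

Lemma edgeless_tree : is_tree (fun _ _ : 'I_1 => false).
Proof.
split; first by split.
split; first by exists ord0.
split; first by move=> i j; rewrite !ord1; exact: connect0.
by rewrite card_ord subnn; apply/eqP; rewrite cards_eq0; apply/eqP/setP => p; rewrite !inE.
Qed.

Lemma edgeless_tw t : tw_le (fun _ _ : 'I_1 => false) t.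
Proof.
exists 'I_1, (fun _ _ => false), (fun _ => setT); split; last first.
  by move=> i; rewrite cardsT card_ord.
split; first exact: edgeless_tree.
split; first by move=> w; exists ord0; rewrite inE.
by split=> // w i j _ _; rewrite !ord1; exact: connect0.
Qed.

Theorem theorem41 (k : nat) (V : finType) (E : rel V) :
  1 <= k -> is_graph E -> kfb_planar k E ->
  (exists (W : finType) (EW : rel W) (p : nat),
     is_graph EW /\ tw_le EW ('C(2 * k + 6, 3) - 1) /\
     contained E (strong (strong EW (path_rel p))
                         (complete_rel (6 * (2 * k + 3) ^ 2)))) /\
  row_tw_le E ('C(2 * k + 6, 3) * (6 * (2 * k + 3) ^ 2) - 1).
Proof.
move=> k1 gE kE.
have m0 : 0 < 6 * (2 * k + 3) ^ 2 by rewrite muln_gt0 expn_gt0 addn_gt0 orbT.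
suff [W [EW [p [gW [tW cW]]]]] : exists (W : finType) (EW : rel W) (p : nat),
     is_graph EW /\ tw_le EW ('C(2 * k + 6, 3) - 1) /\
     contained E (strong (strong EW (path_rel p)) (complete_rel (6 * (2 * k + 3) ^ 2))).
  split; first by exists W, EW, p.
  have c0 : 0 < 'C(2 * k + 6, 3) by rewrite bin_gt0 (leq_trans _ (leq_addl _ _)).
  have := row_tw_of_product m0 gW tW cW.
  by rewrite (subn1 'C(2 * k + 6, 3)) prednK.
case: (pickP (fun v => [exists u, E v u])) => [r hr|no].
  have [T [EW [p [gW [tW cW]]]]] := restrict_embedding gE kE (exist _ r hr).
  exists 'I_T.+1, EW, (p + #|V|); split=> //; split=> //.
  exact: (contained_isolated ord0 m0 gE cW).
(* Without edges every vertex is isolated, and a one-vertex graph times a long path has room for all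
   of them. *)
exists 'I_1, (fun _ _ => false), (1 + #|V|); split; first by split.
split; first exact: edgeless_tw.
apply: (contained_isolated ord0 m0 gE).
have abs (v : {v | [exists u, E v u]}) : False by have := valP v; rewrite no.
by exists (fun v => (ord0, ord0, Ordinal m0)); split=> u; case: (abs u).
Qed.
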